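(* Let $(D_n)_{n\ge1}$ be connected regular domains of the family $\mathcal D$ such that $x_0\in D_1$, $D_n\Subset D_{n+1}$ for all $n$, and $D=\bigcup_{n\ge1}D_n$, and suppose that for every $n$ the relative kernel $K_{D_n}$ has a jointly continuous version on $D_n\times\partial D_n$. Let $D^K$ be a compact metrizable compactification of $D$, $\partial_{\mathrm m}^KD\subseteq D^K\setminus D$ a Borel set, and $\kappa:\partial_{\mathrm m}^KD\to\mathcal E(D)$ a Borel bijection; write $K_D(x,\eta)=\kappa(\eta)(x)$. Assume that there are $n_1<n_2<\cdots$ (one sequence for all $\eta$) such that $K_D(\cdot,\eta)\,\omega_{x_0}^{D_{n_j}}\Longrightarrow\delta_\eta$ weakly on $D^K$ for every $\eta\in\partial_{\mathrm m}^KD$; fix such a sequence and relabel $(D_{n_j})_j$ as $(D_n)_n$. Let $D^G$ be any compact metrizable compactification of $D$, let $\widehat D=D^G\vee D^K$ with projections $p_G:\widehat D\to D^G$, $p_K:\widehat D\to D^K$, and put $\widehat\partial D=\widehat D\setminus D$, $\widehat\partial_{\mathrm m}D=p_K^{-1}(\partial_{\mathrm m}^KD)$, $\widehat K_D(x,\widehat\eta)=K_D(x,p_K(\widehat\eta))$. Let $\widehat\mu_1$ be a weak limit on $\widehat D$ of a subsequence of $(\omega_{x_0}^{D_n})$ (a refined representing measure for the constant function $1$). For Borel $A\subseteq\widehat\partial D$ and $x\in D$ define $$\widehat\omega_x^D(A)=\int_{A\cap\widehat\partial_{\mathrm m}D}\widehat K_D(x,\widehat\eta)\,d\widehat\mu_1(\widehat\eta).$$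 Then $\{\widehat\omega_x^D:x\in D\}$ is a continuous Radon harmonic measure on $\widehat\partial D$, with $\widehat\omega_{x_0}^D=\widehat\mu_1$. Its integrable boundary functions are exactly $L^1(\widehat\mu_1)$, i.e. $\bigcap_{x\in D}L^1(\widehat\partial D,\widehat\omega_x^D)=L^1(\widehat\mu_1)$, and for every such $f$ the function $x\mapsto\int f\,d\widehat\omega_x^D$ is harmonic on $D$. Both families $\omega_x^{D,G}:=(p_G)_\#\widehat\omega_x^D$ and $\omega_x^{D,K}:=(p_K)_\#\widehat\omega_x^D$ ($x\in D$) are continuous harmonic measures on $D^G\setminus D$ and $D^K\setminus D$, respectively.
   Context: Let $X$ be a metric space. A domain is a nonempty connected open set; $V\Subset U$ means that $\overline V$ is compact and contained in $U$. Measures are positive Borel measures (completed when integrable functions are considered). A harmonic measure on a boundary space $B$ indexed by a domain $U$ is a family $\{\omega_x:x\in U\}$ of measures on $B$ with $\omega_x(B)=1$ and $\omega_x\ll\omega_y$ for all $x,y\in U$; it is continuous if $x\mapsto\int f\,d\omega_x$ is continuous on $U$ for every $f\in\bigcap_{x\in U}L^1(B,\omega_x)$, and Radon if every $\omega_x$ is Radon. A harmonic measure $\{\omega_x^U\}$ on a domain $U$ with $\partial U\ne\varnothing$ is such a family with $B=\partial U$; write $\omega_x^U(f)=\int_{\partial U}f\,d\omega_x^U$. $U$ is regular if for every $\zeta\in\partial U$ and every bounded Borel $f$ on $\partial U$ continuous at $\zeta$ one has $\omega_x^U(f)\to f(\zeta)$ as $U\ni x\to\zeta$. Standing framework: $\mathcal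 D$ is a family of domains of $X$, each with nonempty boundary and equipped with a continuous Radon harmonic measure, such that (i) every $U\in\mathcal D$ is the union of an increasing sequence of regular domains of $\mathcal D$ whose closures are compact and contained in $U$; (ii) for $V\Subset U$ in $\mathcal D$ with $V$ regular, $\omega_x^U(f)=\int_{\partial V}\omega_y^U(f)\,d\omega_x^V(y)$ for all $x\in V$ and all bounded Borel $f$ on $\partial U$. $D\subseteq X$ is a domain and $x_0\in D$ is fixed. A function $u:W\to\mathbb R$ on an open set $W$ is harmonic if it is continuous and $u(x)=\int_{\partial V}u\,d\omega_x^V$ for every regular $V\in\mathcal D$ with $V\Subset W$ and every $x\in V$. $\mathcal H_1(D)$ is the set of strictly positive harmonic functions $h$ on $D$ with $h(x_0)=1$, with the topology of locally uniform convergence, and $\mathcal E(D)$ is its set of extreme points, with the inherited Borel structure. For regular $U\in\mathcal D$ with $U\Subset D$, $x_0\in U$, the relative kernel is $K_U(x,y)=\frac{d\omega_x^U}{d\omega_{x_0}^U}(y)$. A compactification of $D$ is a compact Hausdorff space containing $D$ as a dense subspace. $D^G\vee D^K=\overline{\{(x,x):x\in D\}}\subseteq D^G\times D^K$, with $D$ identified with its diagonal image, and $p_G,p_K$ are the restricted coordinate projections; they map $\widehat\partial D$ onto $D^G\setminus D$ and $D^K\setminus D$. $\Longrightarrow$ is weak convergence against continuous functions on a compact space; measures on $\partial D_n$ are regarded as measures on compactifications via $\partial D_n\subset D$. Under the stated hypotheses $\widehat\mu_1$ is carried by $\widehat\partial_{\mathrm m}D$ and $1=\int_{\widehat\partial_{\mathrm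 m}D}\widehat K_D(x,\widehat\eta)\,d\widehat\mu_1(\widehat\eta)$ for $x\in D$. *)

(* Defs.v *)
From HB Require Import structures.
From mathcomp Require Import all_boot all_order all_algebra.
From mathcomp Require Import all_classical all_reals all_analysis.

Set Implicit Arguments.
Unset Strict Implicit.
Unset Printing Implicit Defensive.

Import Order.TTheory GRing.Theory Num.Theory.
Import numFieldNormedType.Exports.

Local Open Scope classical_set_scope.
Local Open Scope ring_scope.

(* The measurable types of MathComp-Analysis are pointed, so the metric spaces
   carrying Borel measures are taken with a point; all the spaces involved are
   nonempty because the domain D is. *)
#[short(type="pmetricType")]
HB.structure Definition PointedMetric (K : numDomainType) :=
  {T of Metric K T & isPointed T}.

(* The library does not join these two structures on products. *)
HB.instance Definition _ (T S : ptopologicalType) := Pointed.on (T * S)%type.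

Notation borel T := (g_sigma_algebraType (@open T)).

Notation "{ 'bmeasure' T -> \bar R }" := ({measure set (borel T) -> \bar R})
  (at level 0, T at level 69, R at level 10).
Notation "{ 'finite_bmeasure' T -> \bar R }" :=
  ({finite_measure set (borel T) -> \bar R})
  (at level 0, T at level 69, R at level 10).

Section topology.
Context {T : topologicalType}.
Implicit Types U V : set T.

Definition boundary U := closure U `\` interior U.

Definition is_domain U := [/\ U !=set0, connected U & open U].

Definition compactly_contained V U := compact (closure V) /\ closure V `<=` U.

End topology.

(* [i] is only relevant on [D]: it embeds the subspace [D] of [X] as a dense
   subspace of the compact Hausdorff space [T]. *)
Definition compactification {X T : topologicalType} (D : set X) (i : X -> T) :=
  [/\ compact [set: T] /\ hausdorff_space T,
      {in D &, injective i},
      {within D, continuous i},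
      (forall O, open O -> exists O', open O' /\
         i @` (O `&` D) = O' `&` (i @` D)) &
      dense (i @` D)].

(* The join of two compactifications, inside the product. *)
Definition compactification_join {X TG TK : topologicalType} (D : set X)
    (iG : X -> TG) (iK : X -> TK) : set (TG * TK) :=
  closure [set (iG x, iK x) | x in D].

Section borel_measures.
Context {R : realType} {T : ptopologicalType}.
Implicit Types (mu : {bmeasure T -> \bar R}) (B : set T) (f : T -> R).

Definition radon mu :=
  (forall x, exists O, [/\ open O, O x & (mu O < +oo)%E]) /\
  (forall A : set (borel T), measurable A ->
     mu A = ereal_sup [set mu K | K in [set K | compact K /\ K `<=` A]]).

(* Integrability for the completion of [mu]: a function is integrable for the
   completed measure iff it agrees mu-a.e. with an integrable Borel function.
   The library integral of such a function, defined through lower Borel simple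
   functions, is its integral for the completion. *)
Definition L1 B mu f := exists g : borel T -> R,
  mu.-integrable B (EFin \o g) /\ ae_eq mu B f g.

Definition bounded_borel B f :=
  measurable_fun (B : set (borel T)) f /\
  exists M, forall y, B y -> `|f y| <= M.

End borel_measures.

(* A measure on the Borel subset [B] of [T] is represented by the Borel measure
   on [T] that extends it by zero outside [B]. *)
Definition harmonic_measure {R : realType} {I : Type} {T : ptopologicalType}
    (U : set I) (B : set T) (w : I -> {bmeasure T -> \bar R}) :=
  [/\ measurable (B : set (borel T)),
      forall x, U x -> w x (~` B) = 0%E,
      forall x, U x -> w x B = 1%E &
      forall x y, U x -> U y -> w x `<< w y].

Definition continuous_harmonic_measure {R : realType} {X : topologicalType}
    {T : ptopologicalType} (U : set X) (B : set T)
    (w : X -> {bmeasure T -> \bar R}) :=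
  harmonic_measure U B w /\
  forall f : T -> R, (forall x, U x -> L1 B (w x) f) ->
    {within U, continuous (fun x => \int[w x]_(y in B) f y)}.

Section framework.
Context {R : realType} {X : pmetricType R}.
Variables (dom : set (set X)) (w : set X -> X -> {finite_bmeasure X -> \bar R}).
Implicit Types U V W D : set X.

(* [w U x] is only relevant for [U] in [dom] and [x] in [U]. *)

Definition regular_domain U := forall (zeta : X) (f : X -> R),
  boundary U zeta ->
  bounded_borel (boundary U) f ->
  f y @[y --> within (boundary U) (nbhs zeta)] --> f zeta ->
  \int[w U x]_(y in boundary U) f y @[x --> within U (nbhs zeta)] --> f zeta.

Definition harmonic_framework :=
  [/\ forall U, dom U ->
        [/\ is_domain U, boundary U !=set0,
            continuous_harmonic_measure U (boundary U) (fun x => w U x) &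
            forall x, U x -> radon (w U x)],
      forall U, dom U -> exists V : nat -> set X,
        [/\ forall n, dom (V n) /\ regular_domain (V n),
            forall n, V n `<=` V n.+1,
            forall n, compactly_contained (V n) U &
            U = \bigcup_n V n] &
      forall U V (f : X -> R) (x : X), dom U -> dom V ->
        compactly_contained V U -> regular_domain V -> V x ->
        bounded_borel (boundary U) f ->
        \int[w U x]_(z in boundary U) f z =
        \int[w V x]_(y in boundary V) \int[w U y]_(z in boundary U) f z].

(* [u] is only relevant on [W]. *)
Definition harmonic_on W (u : X -> R) :=
  {within W, continuous u} /\
  forall V x, dom V -> regular_domain V -> compactly_contained V W -> V x ->
    u x = \int[w V x]_(y in boundary V) u y.

(* Functions on [D] are represented by their extension by 0 to [X]. *)
Definition H1 D (x0 : X) : set (X -> R) :=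
  [set h | [/\ harmonic_on D h, forall x, D x -> 0 < h x, h x0 = 1 &
               forall x, ~ D x -> h x = 0]].

Definition extreme_points (C : set (X -> R)) : set (X -> R) :=
  [set h | C h /\ forall a b t, C a -> C b -> 0 < t < 1 ->
     h = (fun x => t * a x + (1 - t) * b x) -> a = h /\ b = h].

Definition relative_kernel (x0 : X) U (x : X) : X -> \bar R :=
  Radon_Nikodym (charge_of_finite_measure (w U x)) (w U x0).

Definition jointly_continuous_kernel (x0 : X) U :=
  exists k : X * X -> R,
    {within U `*` boundary U, continuous k} /\
    forall x, U x -> ae_eq (w U x0) (boundary U)
      (fun y => (k (x, y))%:E) (relative_kernel x0 U x).

End framework.

(* Functions on [D] (extended by 0) with the topology of uniform convergence on
   compact subsets of [D]; for the locally compact [D] considered here, this is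
   the topology of locally uniform convergence. *)
Definition locally_uniform {R : realType} {X : pmetricType R} (D : set X) :=
  {family (fun K : set X => compact K /\ K `<=` D), X -> R}.

(* Weak convergence, on the compact space [S], of the images under [i] of the
   measures [g nu_n] on [B_n] to the measure [mu] on [S]. *)
Definition weakly_converges {R : realType} {X T : ptopologicalType}
    (i : X -> T) (S : set T) (B : nat -> set X) (g : X -> R)
    (nu : nat -> {bmeasure X -> \bar R}) (mu : {bmeasure T -> \bar R}) :=
  mu (~` S) = 0%E /\
  forall f : T -> R, {within S, continuous f} ->
    \int[nu n]_(y in B n) (f (i y) * g y) @[n --> \oo] -->
    \int[mu]_(z in S) f z.

(* Main.v *)
Require Import Defs.
From HB Require Import structures.
From mathcomp Require Import all_boot all_order all_algebra.
From mathcomp Require Import all_classical all_reals all_analysis.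
From mathcomp Require Import measurable_realfun ring lra.
Import Order.TTheory GRing.Theory Num.Theory.
Import numFieldNormedType.Exports.
Set Implicit Arguments.
Unset Strict Implicit.
Unset Printing Implicit Defensive.
Local Open Scope classical_set_scope.
Local Open Scope ring_scope.

(** Write [E m] for the m-th domain of the final sequence, [P m] for its harmonic
    measure at [x0], and [k m] for the continuous kernel of [E m].  The family
    [what x] has density [kappa z.2 x] with respect to [mu1], so the theorem
    reduces to two facts about the image [mu] of [mu1] on the second
    compactification: [mu] is carried by [bmK], and the integral of [kappa eta x]
    against [mu] is 1 for every [x] in [D].  Granting them, [what x] is a
    probability, it has the same null sets as [mu1] because harmonic functions in
    [H1] are positive, and a boundary integral of [f] is the mixture of the
    functions [kappa eta] with the weights [f].  The members of [H1] are
    uniformly bounded and equicontinuous at each point of [D], so such a mixture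
    is continuous, and Fubini's theorem gives its mean value property ([mixture_harmonic],
    [density_harmonic_on]).

    The two facts are proved together ([boundary_measure_carried]) by building a
    random extreme function whose mean is 1 ([choquet_one]) and identifying the
    law of its pole with [mu].  A point [y] of the ultraproduct of the boundaries
    of the [E n] is a sequence of boundary points, and [h y x] is the ultralimit
    of the kernels [k n x (y n)].  The Loeb measure, which is the ultraproduct of
    the measures [P n], is a genuine probability, and integration against it is
    the ultralimit of integration against [P n] ([loebE], [integral_ulim_fun]).
    Fubini's theorem and the chain rule for harmonic measures show that
    [k n x y] has the mean value property in [x] for almost all [y]
    ([ae_kernel_mean_value]), so almost every [h y] belongs to [H1]; its mean is
    the ultralimit of the integrals of [k n x], which are 1.

    That almost every [h y] is extreme comes from an energy.  For [h] in [H1] let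
    [energy n q h] be the integral of [k n q z] squared times [h z] against
    [P n].  It is affine in [h], and by Jensen's inequality it is at least
    [h q ^+ 2].  If it comes arbitrarily close to [h q ^+ 2] for a dense set of
    [q], then in any decomposition of [h] strict convexity of the square forces
    the two components to agree at these [q], so [h] is extreme
    ([extreme_of_energy]).  The mean of [energy n q (h y)] over [y] is
    [energy n q 1], the integral of the square of [k n q], whose ultralimit is the
    mean of [h y q ^+ 2].  Thus the nonnegative excess of the energy over
    [h y q ^+ 2] has a mean with lower limit 0, and almost every [h y] is
    extreme.

    Let [xi y] be the point of [bmK] with [kappa (xi y) = h y].  By hypothesis
    the measures with densities [h y] with respect to [P n] converge to the Dirac
    measure at [xi y]; this exhibits [f (xi y)], for continuous [f], as a limit of
    integrals of [f] against these measures.  Hence [xi] is measurable, and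
    averaging over [y], where the density becomes 1, identifies the mean of
    [f (xi y)] with the limit of the integrals of [f] against [P n], which is the
    integral of [f] against [mu].  So [mu] is the law of [xi].  *)

(** * Ultrafilters and internal sets *)

Section ultra.
Context {T : Type} (U : set_system T) {UU : UltraFilter U}.

Lemma ultra_not (A : set T) : ~ U A -> U (~` A).
Proof. by move=> nA; case: (in_ultra_setVsetC A UU). Qed.

Lemma ultra_setC (A : set T) : U (~` A) <-> ~ U A.
Proof.
split=> [UA UA'|/ultra_not//].
have : U (A `&` ~` A) by apply: filterI.
by rewrite setICr => /filter_ex[].
Qed.

Lemma fmap_ultra {S : Type} (u : T -> S) : UltraFilter (u @ U).
Proof.
split=> [|G PG sUG]; first exact: fmap_proper_filter.
apply/seteqP; split=> // A GA /=; rewrite /nbhs/=.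
apply: contrapT => /ultra_not UA; have /sUG GA' : (u @ U) (~` A) by [].
have : G (A `&` ~` A) by apply: filterI.
by rewrite setICr => /filter_ex[].
Qed.

Lemma ultra_cvg_bounded {R : realType} (u : T -> R) a b :
  (\forall n \near U, a <= u n <= b) -> cvg (u @ U).
Proof.
move=> uab; have UuU := fmap_ultra u.
have := @segment_compact R a b; rewrite compact_ultra => /(_ _ UuU).
case=> [|l [_ ul]]; last by apply/cvg_ex; exists l.
by apply: filterS uab => n /=; rewrite in_itv.
Qed.

End ultra.

Section internal.
Context d (T : measurableType d) (U : set_system nat) {UU : UltraFilter U}.

(** The ultraproduct of the sets [A n], as a set of sequences: sequences that agree
    along [U] are not identified, since internal sets do not separate them. *)
Definition internal (A : nat -> set T) : set (nat -> T) :=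
  [set y | U [set n | A n (y n)]].

(** If [A n] were not included in [B n] along [U], choosing points of the
    differences would give a point of [internal A] outside [internal B]. *)
Lemma sub_internal A B :
  internal A `<=` internal B <-> U [set n | A n `<=` B n].
Proof.
split=> [AB|AB y Ay]; last by apply: filterS2 AB Ay => n; exact.
apply: contrapT => /ultra_not UAB.
pose y n := xget point (A n `\` B n).
have yP n : ~ (A n `<=` B n) -> (A n `\` B n) (y n).
  move=> nAB; apply: xgetPex; apply: contrapT => nex; apply: nAB => x Ax.
  by apply: contrapT => nBx; apply: nex; exists x.
have UAy : internal A y by apply: filterS UAB => n /yP[].
have /filter_ex[n [/yP[_]]] : U (~` [set n | A n `<=` B n] `&` [set n | B n (y n)]).
  by apply: filterI => //; exact: AB.
by [].
Qed.

Lemma internal_setC A : ~` internal A = internal (fun n => ~` A n).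
Proof.
apply/seteqP; split=> y; rewrite /internal/=.
  by move/(@ultra_setC _ _ UU).
by move=> h; apply/(@ultra_setC _ _ UU).
Qed.

Lemma internal_setI A B :
  internal A `&` internal B = internal (fun n => A n `&` B n).
Proof.
apply/seteqP; split=> [y [Ay By]|y ABy]; first by apply: filterS2 Ay By.
by split; apply: filterS ABy => n [].
Qed.

Lemma internal_setU A B :
  internal A `|` internal B = internal (fun n => A n `|` B n).
Proof.
apply: setC_inj; rewrite setCU !internal_setC internal_setI.
by congr internal; apply/funext => n; rewrite setCU.
Qed.

Lemma internal_set0 : internal (fun=> set0) = set0.
Proof. by apply/seteqP; split => // y /filter_ex[]. Qed.

Lemma internal_setT : internal (fun=> setT) = setT.
Proof. by apply/seteqP; split => // y _; apply: filterS filterT. Qed.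

(** Countable saturation.  It replaces compactness in the construction of the Loeb
    measure: a point of the intersection is obtained by choosing its n-th
    coordinate in as many of the sets [A i n] as have a common point, but in at
    most [n] of them, and this number exceeds every [k] along [U]. *)
Lemma internal_saturated (A : nat -> nat -> set T) : (\oo `<=` U) ->
  (forall k, \bigcap_(i in `I_k) internal (A i) !=set0) ->
  \bigcap_i internal (A i) !=set0.
Proof.
move=> Uoo Ane.
pose I k := [set n | (k <= n)%N /\ \bigcap_(i in `I_k) A i n !=set0].
have UI k : U (I k).
  have [y Ay] := Ane k; have Uk : U [set n | (k <= n)%N].
    by apply: Uoo; exact: nbhs_infty_ge.
  suff UA : U [set n | forall i, (i < k)%N -> A i n (y n)].
    by apply: filterS2 Uk UA => n kn An; split => //; exists (y n).
  elim: k Ay {Uk} => [|k IH] Ay; first by apply: filterS filterT => n _ i.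
  have Ak : U [set n | A k n (y n)] by apply: (Ay k) => /=.
  have /IH IHk : (\bigcap_(i in `I_k) internal (A i)) y.
    by move=> i /= ik; apply: Ay => /=; exact: ltnW.
  apply: filterS2 Ak IHk => n Akn An i; rewrite ltnS leq_eqVlt => /predU1P[->//|].
  exact: An.
pose K n := [arg max_(k > (ord0 : 'I_n.+1) | `[< I (nat_of_ord k) n >]) (nat_of_ord k)].
have I0 n : I 0%N n by split => //; exists point => i.
have KP n : I (K n) n /\ forall k, I k n -> (k <= K n)%N.
  rewrite /K; case: arg_maxnP => /= [|k /asboolP Ikn kmax]; first exact/asboolP/I0.
  split => // j Ij; have jn : (j < n.+1)%N by case: Ij; rewrite ltnS.
  by apply: (kmax (Ordinal jn)); exact/asboolP.
have /choice[y yP] n : exists y, (\bigcap_(i in `I_(K n)) A i n) y.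
  by case: (KP n) => -[_ [y Hy]] _; exists y.
exists y => k _; apply: filterS (UI k.+1) => n /(KP n).2 kK.
exact: (yP n).
Qed.

End internal.

(** * The Loeb measure *)
(** The space carries its ultrafilter as a parameter so that the algebra of internal
    sets below can be attached to it as a structure. *)
Definition loeb_space d (T : measurableType d) (U : set_system nat)
  (UU : UltraFilter U) : Type := nat -> T.

Section loeb_algebra.
Context d (T : measurableType d) (U : set_system nat) (UU : UltraFilter U).
Local Notation L := (loeb_space T UU).

Definition loeb_event : set (set L) :=
  [set B | exists2 A : nat -> set T, forall n, measurable (A n) & B = internal U A].

Let loeb_event0 : loeb_event set0.
Proof. by exists (fun=> set0) => //; rewrite internal_set0. Qed.

Let loeb_eventU : setU_closed loeb_event.
Proof.
move=> _ _ [A mA ->] [B mB ->]; exists (fun n => A n `|` B n).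
  by move=> n; exact: measurableU.
by rewrite -internal_setU.
Qed.

Let loeb_eventC : setC_closed loeb_event.
Proof.
move=> _ [A mA ->]; exists (fun n => ~` A n); last by rewrite -internal_setC.
by move=> n; exact: measurableC.
Qed.

HB.instance Definition _ := Pointed.copy L (nat -> T).
HB.instance Definition _ := @isAlgebraOfSets.Build default_measure_display L
  loeb_event loeb_event0 loeb_eventU loeb_eventC.

End loeb_algebra.

Section loeb_measure.
Context d (T : measurableType d) (R : realType) (U : set_system nat)
  (UU : UltraFilter U).
Variable P : nat -> probability T R.
Hypothesis Uoo : \oo `<=` U.
Local Notation L := (loeb_space T UU).

Definition ulim (u : nat -> R) : R := lim (u n @[n --> U]).

Lemma ulimP (u : nat -> R) (a b : R) :
  (\forall n \near U, a <= u n <= b) -> u n @[n --> U] --> ulim u.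
Proof. exact: ultra_cvg_bounded. Qed.

Lemma prob_cvg (A : nat -> set T) : (forall n, measurable (A n)) ->
  fine (P n (A n)) @[n --> U] --> ulim (fun n => fine (P n (A n))).
Proof.
move=> mA; apply: (@ulimP _ 0 1); apply: filterS filterT => n _.
by rewrite fine_ge0//= -lee_fin fineK ?fin_num_measure// probability_le1.
Qed.

(** The content of an internal set is defined through a chosen representation; all
    representations agree along [U]. *)
Definition internal_rep (B : set L) : nat -> set T :=
  xget (fun=> set0) [set A | (forall n, measurable (A n)) /\ B = internal U A].

Definition loeb_content (B : set L) : \bar R :=
  (ulim (fun n => fine (P n (internal_rep B n))))%:E.

Lemma loeb_contentE (A : nat -> set T) : (forall n, measurable (A n)) ->
  loeb_content (internal U A) = (ulim (fun n => fine (P n (A n))))%:E.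
Proof.
move=> mA; congr EFin; set A' := internal_rep _.
have [mA' AA'] : (forall n, measurable (A' n)) /\ internal U A = internal U A'.
  have : exists A', [set A' | (forall n, measurable (A' n)) /\
      (internal U A : set L) = internal U A'] A' by exists A.
  by move=> /(xgetPex (fun=> set0)).
apply: (@cvg_lim R) => //.
rewrite -[X in X @ _ --> _](_ : (fun n => fine (P n (A n)) + (fine (P n (A' n)) - fine (P n (A n)))) = _); last first.
  by apply/funext => n; rewrite addrC subrK.
rewrite -[X in _ --> X]addr0; apply: cvgD; first exact: prob_cvg.
apply: cvg_near_cst.
have UAA : U [set n | A n `<=` A' n] by apply/sub_internal; rewrite AA'.
have UAA' : U [set n | A' n `<=` A n] by apply/sub_internal; rewrite AA'.
apply: filterS2 UAA UAA' => n AnA' A'nA.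
by have -> : A n = A' n; [apply/seteqP|rewrite subrr].
Qed.

Let loeb_content0 : loeb_content set0 = 0%E.
Proof.
rewrite -(@internal_set0 _ T U UU) loeb_contentE//; congr EFin.
under [X in ulim X]funext do rewrite measure0.
by rewrite /ulim lim_cst//; exact: norm_hausdorff.
Qed.

Let loeb_content_ge0 B : (0 <= loeb_content B)%E.
Proof.
rewrite lee_fin; set A := internal_rep B.
have mA n : measurable (A n).
  rewrite /A /internal_rep; case: xgetP => [_ -> []//|_]; exact: measurable0.
apply: limr_ge; first by apply: cvgP; exact: prob_cvg.
by apply: filterS filterT => n _; rewrite fine_ge0.
Qed.

Lemma loeb_contentU (A B : nat -> set T) : (forall n, measurable (A n)) ->
  (forall n, measurable (B n)) -> internal U A `&` internal U B = set0 ->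
  loeb_content (internal U A `|` internal U B) =
  (loeb_content (internal U A) + loeb_content (internal U B))%E.
Proof.
move=> mA mB AB0; rewrite internal_setU !loeb_contentE// => [|n]; last exact: measurableU.
rewrite -EFinD; congr EFin; apply: (@cvg_lim R) => //.
have UAB : U [set n | A n `&` B n `<=` set0].
  have : internal U (fun n => A n `&` B n) `<=` internal U (fun=> set0).
    by rewrite -internal_setI internal_set0 AB0.
  by move/sub_internal.
apply: cvg_trans (cvgD (prob_cvg mA) (prob_cvg mB)).
apply: near_eq_cvg; apply: filterS UAB => n ABn /=.
rewrite measureU//; last by apply/seteqP; split.
by rewrite /= fineD// fin_num_measure.
Qed.

(** On internal sets countable additivity is finite additivity: by saturation, a
    countable disjoint union of internal sets that is internal has only finitely
    many nonempty members. *)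
Let loeb_content_sigma_additive : semi_sigma_additive loeb_content.
Proof.
move=> F mF tF [A mA FA].
have /choice[B BP] n : exists B : nat -> set T,
    (forall m, measurable (B m)) /\ F n = internal U B.
  by have [B mB ->] := mF n; exists B.
have FE n : F n = internal U (B n) by case: (BP n).
have mB n m : measurable (B n m) by case: (BP n) => + _; apply.
have [N FN] : exists N, forall n, (N <= n)%N -> F n = set0.
  (* [C 0] is the union, [C k.+1] the complement of the k-th member; these internal
     sets have no common point. *)
  pose C k n := if k is k'.+1 then ~` B k' n else A n.
  have C0 : ~ (\bigcap_i internal U (C i) !=set0).
    case=> y Cy; have : internal U A y by exact: (Cy 0%N).
    rewrite -FA => -[k _]; rewrite FE => By.
    by have := Cy k.+1 Logic.I; rewrite /= -internal_setC; apply.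
  have [k Ck] : exists k, ~ (\bigcap_(i in `I_k) internal U (C i) !=set0).
    apply: contrapT => h; apply: C0; apply: internal_saturated => // k.
    by apply: contrapT => Ck; apply: h; exists k.
  exists k => n kn; apply/seteqP; split => // y Fy; apply: Ck; exists y => -[_|i]/=.
    by rewrite -FA; exists n.
  move=> ik; rewrite -internal_setC -FE => Fiy.
  have iln : (i < n)%N by exact: leq_trans (ltnW ik) kn.
  have FiFn : F i `&` F n = set0.
    by move/trivIsetP : tF; apply => //; rewrite neq_ltn iln.
  by have : set0 y by rewrite -FiFn.
apply: cvg_near_cst; exists N => // m /= Nm.
have -> : \bigcup_n F n = \bigcup_(i < m) F i.
  apply/seteqP; split => [y [i _ Fiy]|y [i _ Fiy]]; last by exists i.
  exists i => //=; rewrite ltnNge; apply/negP => mi.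
  by move: Fiy; rewrite FN// (leq_trans Nm).
elim: m {Nm} => [|m IH]; first by rewrite big_geq// bigcup_mkord big_ord0 loeb_content0.
rewrite big_nat_recr//= IH [in RHS]bigcup_mkord big_ord_recr/= -bigcup_mkord.
pose C n := \bigcup_(i < m) B i n.
have FC : \bigcup_(i < m) F i = internal U C.
  rewrite /C; elim: m {IH C} => [|m IH].
    rewrite bigcup_mkord big_ord0 -(@internal_set0 _ T U UU); congr internal.
    by apply/funext => n; rewrite bigcup_mkord big_ord0.
  rewrite bigcup_mkord big_ord_recr/= -bigcup_mkord IH FE internal_setU.
  by congr internal; apply/funext => n; rewrite [RHS]bigcup_mkord big_ord_recr/= -(bigcup_mkord m (fun i => B i n)).
have mC n : measurable (C n) by apply: bigcup_measurable => k _; exact: mB.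
rewrite FC FE loeb_contentU// -FC -FE.
apply/seteqP; split => // y [[i /= im Fiy] Fmy].
have FiFm : F i `&` F m = set0.
  by move/trivIsetP : tF; apply => //; rewrite neq_ltn im.
by have : set0 y by rewrite -FiFm.
Qed.

HB.instance Definition _ := isMeasure.Build _ L R loeb_content
  loeb_content0 loeb_content_ge0 loeb_content_sigma_additive.

Definition loeb := measure_extension loeb_content.

HB.instance Definition _ := Measure.on loeb.

Lemma loebE (A : nat -> set T) : (forall n, measurable (A n)) ->
  loeb (internal U A) = (ulim (fun n => fine (P n (A n))))%:E.
Proof.
move=> mA; rewrite /loeb /measure_extension measurable_mu_extE; last by exists A.
exact: loeb_contentE.
Qed.

Let loebT : loeb setT = 1%E.
Proof.
rewrite -(@internal_setT _ T U UU) loebE//; congr EFin.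
under [X in ulim X]funext do rewrite probability_setT.
by rewrite /ulim lim_cst//; exact: norm_hausdorff.
Qed.

HB.instance Definition _ := Measure_isProbability.Build _ _ _ loeb loebT.

End loeb_measure.

(** * Integration of ultralimits *)
Section levels.
Context d (T : measurableType d) (R : realType).
Implicit Types (Q : probability T R) (F : T -> R) (B : nat -> set T).

(** When [B j] is the level set where a nonnegative [F] is at least [j.+1 * c], the
    staircase approximates [F] from below within [c].  Its integral involves [F]
    only through the measures of the level sets, which is what passes to the
    ultraproduct. *)
Definition staircase B (c : R) K (t : T) : R := \sum_(j < K) c * \1_(B j) t.

Lemma staircase_level F (c : R) K t : 0 <= c -> 0 <= F t <= K%:R * c ->
  let S := staircase (fun j => [set t | j.+1%:R * c <= F t]) c K t in
  S <= F t <= S + c.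
Proof.
move=> c0 /andP[Ft0 FtK] /=; rewrite /staircase.
pose S k := \sum_(j < k) c * \1_[set t | j.+1%:R * c <= F t] t.
rewrite -/(S K).
have ind j : \1_[set t | j.+1%:R * c <= F t] t = ((j.+1%:R * c <= F t)%R : bool)%:R :> R.
  by rewrite indicE; congr (nat_of_bool _)%:R; apply/idP/idP; rewrite inE.
have [] : [/\ (K%:R * c <= F t -> S K = K%:R * c), S K <= F t & (F t <= K%:R * c -> F t <= S K + c)].
  elim: K {FtK} => [|K [IH1 IH2 IH3]].
    by rewrite /S big_ord0 !mul0r; split => //; rewrite add0r; lra.
  rewrite /S big_ord_recr/= -/(S K) ind -natr1.
  have [h|h] := boolP ((K%:R + 1) * c <= F t).
    have KF : K%:R * c <= F t by lra.
    by rewrite (IH1 KF)/= mulr1; split => [_||?]; lra.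
  rewrite -ltNge in h; rewrite /= mulr0 addr0; split => [?|//|]; first lra.
  have [KF|KF] := leP (K%:R * c) (F t); first by rewrite (IH1 KF) => _; lra.
  by move=> _; apply: IH3; lra.
by move=> _ h1 h2; rewrite h1 h2.
Qed.

Lemma measurable_staircase B c K : (forall j, measurable (B j)) ->
  measurable_fun setT (staircase B c K).
Proof.
move=> mB; by apply: measurable_sum => j; exact: measurable_funM.
Qed.

(** The sets [B j] need not be the level sets of [F]: for an ultralimit they will be
    the ultraproducts of level sets, which differ from its level sets. *)
Lemma integral_staircase Q F B c K : measurable_fun setT F ->
  (forall j, measurable (B j)) -> 0 <= c ->
  (forall t, staircase B c K t <= F t <= staircase B c K t + c) ->
  let s := \sum_(j < K) c * fine (Q (B j)) in
  s <= \int[Q]_t F t <= s + c.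
Proof.
move=> mF mB c0 SF; set s := \sum_(j < K) _; rewrite /=.
have S0 t : 0 <= staircase B c K t.
  by apply: sumr_ge0 => j _; rewrite mulr_ge0.
have mS := measurable_staircase c K mB.
have IS : (\int[Q]_t (staircase B c K t)%:E = s%:E)%E.
  under eq_integral do rewrite /staircase -sumEFin.
  rewrite ge0_integral_sum//=; last 2 first.
  - move=> j; apply/measurable_EFinP; apply: measurable_funM => //.
  - by move=> j t _; rewrite lee_fin mulr_ge0.
  rewrite /s -sumEFin; apply: eq_bigr => j _.
  under eq_integral do rewrite EFinM.
  rewrite ge0_integralZl//; last first.
    exact/measurable_EFinP/measurable_indic.
  by rewrite integral_indic// setIT EFinM fineK// fin_num_measure.
have F0 t : 0 <= F t by have /andP[+ _] := SF t; exact: le_trans.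
have lo : (s%:E <= \int[Q]_t (F t)%:E)%E.
  rewrite -IS; apply: ge0_le_integral => //.
  - by move=> t _; rewrite lee_fin.
  - exact/measurable_EFinP.
  - exact/measurable_EFinP.
  - by move=> t _; rewrite lee_fin; case/andP: (SF t).
have hi : (\int[Q]_t (F t)%:E <= (s + c)%:E)%E.
  rewrite EFinD -IS -[X in (_ <= _ + X)%E]mule1 -(@probability_setT _ _ _ Q) -integral_cst//.
  rewrite -ge0_integralD//; last 2 first.
    by move=> t _; rewrite lee_fin.
    exact/measurable_EFinP.
  apply: ge0_le_integral => //.
  - by move=> t _; rewrite lee_fin.
  - exact/measurable_EFinP.
  - by apply: emeasurable_funD => //; exact/measurable_EFinP.
  - by move=> t _; rewrite -EFinD lee_fin; case/andP: (SF t).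
rewrite /Rintegral -!lee_fin fineK ?lo ?hi// ge0_fin_numE.
  by rewrite (le_lt_trans hi)// ltry.
by apply: integral_ge0 => t _; rewrite lee_fin.
Qed.

End levels.

Lemma cvg_sum_ord {R : realType} {T : Type} (U : set_system T) {FU : Filter U} (K : nat)
  (f : nat -> T -> R) (l : nat -> R) :
  (forall j, (j < K)%N -> f j n @[n --> U] --> l j) ->
  \sum_(j < K) f j n @[n --> U] --> \sum_(j < K) l j.
Proof.
elim: K => [|K IH] fl.
  by under eq_fun do rewrite big_ord0; rewrite big_ord0; exact: cvg_cst.
under eq_fun do rewrite big_ord_recr/=.
rewrite big_ord_recr/=; apply: cvgD; last exact: fl.
by apply: IH => j jK; apply: fl; exact: ltnW.
Qed.

Section loeb_integral.
Context d (T : measurableType d) (R : realType) (U : set_system nat)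
  (UU : UltraFilter U).
Variable P : nat -> probability T R.
Hypothesis Uoo : \oo `<=` U.
Local Notation L := (loeb_space T UU).
Local Notation LM := (g_sigma_algebraType (@measurable _ L)).
Variables (F : nat -> T -> R) (M : R).
Hypothesis mF : forall n, measurable_fun setT (F n).
Hypothesis F0 : forall n t, 0 <= F n t.
Hypothesis FM : \forall n \near U, forall t, F n t <= M.

Definition ulim_fun (y : LM) : R := ulim U (fun n => F n (y n)).

Lemma ulim_fun_cvg y : F n (y n) @[n --> U] --> ulim_fun y.
Proof.
apply: (@ulimP _ _ _ _ 0 M); apply: filterS FM => n FnM.
by rewrite F0 FnM.
Qed.

(** The staircases of [F n] have the staircase over the internal sets [IB c j] as
    ultralimit, so the latter approximates the ultralimit of [F n] within [c]. *)
Let B (c : R) (j n : nat) : set T := [set t | j.+1%:R * c <= F n t].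
Let mB c j n : measurable (B c j n).
Proof.
rewrite (_ : B _ _ _ = setT `&` F n @^-1` `[j.+1%:R * c, +oo[).
  exact: mF.
by rewrite setTI; apply/seteqP; split => t /=; rewrite in_itv/= andbT.
Qed.
Let IB c j : set LM := internal U (B c j).
Let mIB c j : measurable (IB c j).
Proof. by apply: sub_gen_smallest; exists (B c j). Qed.

Let stair_cvg c K (y : LM) :
  staircase (fun j => B c j n) c K (y n) @[n --> U] --> staircase (IB c) c K y.
Proof.
apply: (@cvg_sum_ord _ _ _ _ _ (fun j n => c * \1_(B c j n) (y n)) (fun j => c * \1_(IB c j) y)).
move=> j _; apply: cvgM; first exact: cvg_cst.
apply: cvg_near_cst.
rewrite indicE; have [yB|yB] := boolP (y \in IB c j).
  by move: yB; rewrite inE; apply: filterS => n Bn; rewrite indicE mem_set.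
move: yB; rewrite notin_setE => /ultra_not; apply: filterS => n /= Bn.
by rewrite indicE memNset.
Qed.

Let stair_ulim c K y : 0 <= c -> M <= K%:R * c ->
  staircase (IB c) c K y <= ulim_fun y <= staircase (IB c) c K y + c.
Proof.
move=> c0 MK.
have Fc : \forall n \near U, staircase (fun j => B c j n) c K (y n) <= F n (y n)
   <= staircase (fun j => B c j n) c K (y n) + c.
  apply: filterS FM => n FnM; apply: staircase_level => //.
  by rewrite F0 (le_trans (FnM _)).
have cS := stair_cvg (c := c) (K := K) (y := y); have cF := ulim_fun_cvg (y := y).
apply/andP; split.
  by apply: (ler_cvg_to cS cF); apply: filterS Fc => n /andP[].
have cS' : staircase (fun j => B c j n) c K (y n) + c @[n --> U] --> staircase (IB c) c K y + c.
  by apply: cvgD cS _; exact: cvg_cst.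
by apply: (ler_cvg_to cF cS'); apply: filterS Fc => n /andP[].
Qed.

Let step (e : R) : 0 < e -> exists K : nat, M <= K%:R * e.
Proof.
move=> e0; exists (Num.truncn (`|M| / e)).+1.
rewrite -ler_pdivrMr//; apply: ltW; apply: le_lt_trans (truncnS_gt _).
by rewrite ler_pM2r ?invr_gt0// ler_norm.
Qed.

Lemma measurable_ulim_fun : measurable_fun setT ulim_fun.
Proof.
have /choice[K KP] (n : nat) : exists K : nat, M <= K%:R * n.+1%:R^-1.
  by apply: step; rewrite invr_gt0.
apply: (@measurable_fun_cvg _ _ _ _
  (fun n => staircase (IB n.+1%:R^-1) n.+1%:R^-1 (K n))).
  by move=> n; exact: measurable_staircase.
move=> y _; apply/cvgrPdist_le => e e0.
have : \forall n \near \oo, (n.+1%:R^-1 : R) <= e by apply: filterS (near_infty_natSinv_lt (PosNum e0)) => n /ltW.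
apply: filterS => n ne.
have n0 : 0 <= n.+1%:R^-1 :> R by rewrite invr_ge0.
have /andP[h1 h2] := stair_ulim y n0 (KP n).
by rewrite ger0_norm ?subr_ge0// lerBlDl (le_trans h2)// lerD2l.
Qed.

(** Both integrals are within [c] of sums of measures of level sets, and these sums
    converge by the definition of the Loeb measure. *)
Lemma integral_ulim_fun :
  \int[P n]_t F n t @[n --> U] --> \int[loeb P Uoo]_y ulim_fun y.
Proof.
apply/cvgrPdist_le => e e0.
have e30 : 0 < e / 3 by rewrite divr_gt0.
have [K KP] := step e30; set c := e / 3 in e30 KP.
have /andP[h1 h2] := @integral_staircase _ _ _ (loeb P Uoo) ulim_fun (IB c) c K
  measurable_ulim_fun (mIB c) (ltW e30) (fun y => stair_ulim y (ltW e30) KP).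
set s := \sum_(j < K) _ in h1 h2.
have sc : \sum_(j < K) c * fine (P n (B c j n)) @[n --> U] --> s.
  apply: (@cvg_sum_ord _ _ _ _ _ (fun j n => c * fine (P n (B c j n))) (fun j => c * fine (loeb P Uoo (IB c j)))).
  move=> j _; apply: cvgM; first exact: cvg_cst.
  by rewrite /IB loebE//; exact: prob_cvg.
move/cvgrPdist_le : sc => /(_ _ e30); apply: filterS2 FM => n FnM sn.
have /andP[h3 h4] := @integral_staircase _ _ _ (P n) (F n) (fun j => B c j n) c K
  (mF n) (fun j => mB c j n) (ltW e30)
  (fun t => @staircase_level _ _ _ (F n) c K t (ltW e30)
     ltac:(by rewrite F0 (le_trans (FnM _)))).
move: sn h1 h2 h3 h4; set sn := \sum_(j < K) _ => sn' h1 h2 h3 h4.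
move: sn'; rewrite !ler_norml => /andP[h5 h6].
have ec : e = 3 * c by rewrite /c mulrCA divff// mulr1.
by apply/andP; split; lra.
Qed.

End loeb_integral.

(** * Distances, joint measurability and densities *)
Section metric.
Context {R : realType} {X : metricType R}.

Lemma metric_ball_open (x : X) (r : R) : open (ball x r).
Proof.
rewrite openE => y xy; rewrite /interior -nbhs_ballE.
have r0 : 0 < r - mdist x y by move: xy; rewrite ballEmdist/= subr_gt0.
exists (r - mdist x y) => // z; rewrite !ballEmdist/= => yz.
by rewrite (le_lt_trans (metric_triangle x y z))// -ltrBrDl.
Qed.

Definition dist_set (A : set X) (x : X) : R := inf [set mdist x a | a in A].

Lemma dist_set_ge0 A x : 0 <= dist_set A x.
Proof.
rewrite /dist_set; have [->|/set0P[a Aa]] := eqVneq A set0.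
  by rewrite image_set0 inf0.
by apply: lb_le_inf; [exists (mdist x a), a|move=> _ [b _ <-]; exact: mdist_ge0].
Qed.

Lemma dist_set_le A x a : A a -> dist_set A x <= mdist x a.
Proof.
move=> Aa; apply: ge_inf; last by exists a.
by exists 0 => _ [b _ <-]; exact: mdist_ge0.
Qed.

Lemma dist_set_lip A x y : dist_set A x <= mdist x y + dist_set A y.
Proof.
have [->|/set0P[a Aa]] := eqVneq A set0.
  by rewrite /dist_set !image_set0 inf0 addr0 mdist_ge0.
rewrite -lerBlDl; apply: lb_le_inf; first by exists (mdist y a), a.
move=> _ [b Ab <-]; rewrite lerBlDl; apply: le_trans (metric_triangle x y b).
exact: dist_set_le.
Qed.

Lemma dist_set_continuous A : continuous (dist_set A).
Proof.
move=> x; apply/cvgrPdist_lt => e e0.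
near=> y.
have xy : mdist x y < e.
  have : ball x e y by near: y; apply: nbhsx_ballx.
  by rewrite ballEmdist.
have h1 := dist_set_lip A x y; have h2 := dist_set_lip A y x.
rewrite metric_sym in h2; rewrite ltr_norml; apply/andP; split; lra.
Unshelve. all: by end_near. Qed.

Lemma dist_set_eq0 A x : closed A -> A !=set0 -> dist_set A x = 0 <-> A x.
Proof.
move=> cA [a0 Aa0]; split=> [dA0|Ax]; last first.
  by apply/eqP; rewrite eq_le dist_set_ge0 andbT -(mdistxx x) dist_set_le.
apply: cA => B /nbhs_ballP[e /= e0 eB].
have : inf [set mdist x a | a in A] < e by rewrite -[inf _]/(dist_set A x) dA0.
move/inf_lt; case; first by exists (mdist x a0), a0.
by move=> _ [a Aa <-] xa; exists a; split => //; apply: eB; rewrite ballEmdist.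
Qed.

End metric.

(** A function continuous in the first variable and measurable in the second is the
    limit of the functions obtained by moving the first variable to the first
    point of a dense sequence at distance less than [N.+1^-1]. *)
Section caratheodory.
Context {R : realType} {X : pmetricType R} {d} {Y : measurableType d}.
Variables (D : set X) (q : nat -> X) (F : X * Y -> R).
Hypothesis oD : open D.
Hypothesis qD : forall i, D (q i).
Hypothesis q_dense : forall x e, D x -> 0 < e -> exists i, ball x e (q i).
Hypothesis F0 : forall x y, ~ D x -> F (x, y) = 0.
Hypothesis cF : forall x y, D x -> {for x, continuous (fun x => F (x, y))}.
Hypothesis mF : forall i, measurable_fun setT (fun y => F (q i, y)).

Let near_set N i : set X := [set x | [/\ D x, ball (q i) N.+1%:R^-1 x &
  forall j, (j < i)%N -> ~ ball (q j) N.+1%:R^-1 x]].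

Let measurable_near_set N i : measurable (near_set N i : set (borel X)).
Proof.
have mO (O : set X) : open O -> measurable (O : set (borel X)).
  by move=> oO; apply: sub_gen_smallest.
have -> : near_set N i = D `&` ball (q i) N.+1%:R^-1 `&`
    ~` (\bigcup_(j < i) ball (q j) N.+1%:R^-1).
  apply/seteqP; split => [x [Dx ix nix]|x [[Dx ix] nix]].
    by split => // -[j /= /nix].
  by split => // j ji jx; apply: nix; exists j.
apply: measurableI; first by apply: measurableI; apply: mO => //; exact: metric_ball_open.
by apply: measurableC; apply: bigcup_measurable => j _; apply: mO; exact: metric_ball_open.
Qed.

Let near_set_ex N x : D x -> exists i, near_set N i x.
Proof.
move=> Dx; have N0 : 0 < N.+1%:R^-1 :> R by rewrite invr_gt0.
have ex : exists i, `[< ball (q i) N.+1%:R^-1 x >].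
  by have [i xi] := q_dense Dx N0; exists i; apply/asboolP/ball_sym.
case: (ex_minnP ex) => i /asboolP ix imin; exists i; split => // j ji jx.
by have := imin j; rewrite leqNgt ji => /(_ (asboolT jx)).
Qed.

Let near_set_inj N x i j : near_set N i x -> near_set N j x -> i = j.
Proof.
move=> [_ ix nix] [_ jx njx].
by case: (ltngtP i j) => // h; [case: (njx _ h)|case: (nix _ h)].
Qed.

Let s N (x : X) : X := q (xget 0%N [set i | near_set N i x]).
Let G N (z : borel X * Y) : R := if pselect (D z.1) then F (s N z.1, z.2) else 0.

Let mG N : measurable_fun setT (G N).
Proof.
move=> _ B mB; rewrite setTI.
have -> : G N @^-1` B = (\bigcup_i (near_set N i `*` ((fun y => F (q i, y)) @^-1` B)))
    `|` ((~` D) `*` [set y : Y | B 0]).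
  apply/seteqP; split => -[x y]; rewrite /G/=.
    case: pselect => /= [Dx BF|nDx B0]; last by right.
    left; have [i ix] := near_set_ex N Dx; exists i => //; split => //=.
    by move: BF; rewrite /s; case: xgetP => [j _ jx|/(_ i)//]; rewrite -(near_set_inj ix jx).
  move=> [[i _ [ix /= BF]]|[nDx B0]]; case: pselect => //= Dx; last by case: ix.
  by rewrite /s; case: xgetP => [j _ jx|/(_ i)//]; rewrite -(near_set_inj ix jx).
apply: measurableU.
  apply: bigcupT_measurable => i; apply: measurableX => //.
  by rewrite -[X in measurable X]setTI; exact: mF.
apply: measurableX; first by apply: measurableC; apply: sub_gen_smallest.
have [B0|B0] := pselect (B 0).
  by rewrite (_ : [set _ | _] = setT)//; apply/seteqP; split.
by rewrite (_ : [set _ | _] = set0)//; apply/seteqP; split.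
Qed.

Lemma measurable_caratheodory : measurable_fun setT (F : borel X * Y -> R).
Proof.
apply: (@measurable_fun_cvg _ _ _ _ G) => // -[x y] _.
have [Dx|nDx] := pselect (D x); last first.
  rewrite F0//; apply: cvg_near_cst; apply: nearW => N; rewrite /G/=.
  by case: pselect.
rewrite (_ : (fun N => G N (x, y)) = (fun N => F (s N x, y))); last first.
  by apply/funext => N; rewrite /G/=; case: pselect.
suff sx : s N x @[N --> \oo] --> x by exact: (cvg_comp _ _ sx (cF (y := y) Dx)).
apply/cvg_ballP => e e0; near=> N.
have [i ix] := near_set_ex N Dx.
rewrite /s; case: xgetP => [j _ jx|/(_ i)//].
case: jx => _ /ball_sym h _; apply: le_ball h; near: N.
by apply: filterS (near_infty_natSinv_lt (PosNum e0)) => n /ltW.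
Unshelve. all: by end_near. Qed.

End caratheodory.

(** Integration against a measure given by a density, obtained from the change of
    variables for the Radon-Nikodym derivative, which equals [k] almost
    everywhere. *)
Section density.
Context d (T : measurableType d) (R : realType).
Variables (nu : {finite_measure set T -> \bar R})
          (mu : {sigma_finite_measure set T -> \bar R}) (k : T -> R).
Hypothesis mk : measurable_fun setT k.
Hypothesis nuE : forall A, measurable A -> nu A = (\int[mu]_(t in A) (k t)%:E)%E.

Lemma ge0_integral_density (E : set T) (f : T -> \bar R) : measurable E ->
  (forall t, (0 <= f t)%E) -> measurable_fun E f ->
  (\int[nu]_(t in E) f t = \int[mu]_(t in E) (f t * (k t)%:E))%E.
Proof.
move=> mE f0 mf.
have numu : nu `<< mu.
  apply/null_content_dominatesP => A mA A0; rewrite nuE//.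
  by apply: null_set_integral => //; apply/measurable_EFinP; exact: measurable_funTS.
rewrite -(Radon_Nikodym_SigmaFinite.change_of_variables numu)//.
have mkE : measurable_fun E (EFin \o k) by apply/measurable_EFinP; exact: measurable_funTS.
have intRN : mu.-integrable E (Radon_Nikodym_SigmaFinite.f nu mu).
  by apply: integrableS (Radon_Nikodym_SigmaFinite.f_integrable numu).
apply: ae_eq_integral => //.
- by apply: emeasurable_funM => //; exact: measurable_int intRN.
- exact: emeasurable_funM.
- apply: ae_eqe_mul2l; apply: integral_ae_eq => //.
  move=> A AE mA; rewrite -Radon_Nikodym_SigmaFinite.f_integral//.
  exact: nuE.
Qed.

End density.

Section mkprob.
Context d (T : measurableType d) (R : realType) (m : {measure set T -> \bar R}).
Hypothesis m1 : m setT = 1%E.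

(** The mass hypothesis is an argument so that the probability structure can be
    inferred from the term. *)
Definition mkprob : set T -> \bar R := let _ := m1 in m.
HB.instance Definition _ := Measure.copy mkprob m.
HB.instance Definition _ := Measure_isProbability.Build _ _ _ mkprob m1.

End mkprob.

(** * Exhaustions by regular domains *)
Lemma open_borel (T : ptopologicalType) (O : set T) :
  open O -> measurable (O : set (borel T)).
Proof. by move=> oO; apply: sub_gen_smallest. Qed.

Lemma closed_borel (T : ptopologicalType) (C : set T) :
  closed C -> measurable (C : set (borel T)).
Proof.
by move=> cC; rewrite -(setCK C); apply: measurableC; apply: open_borel; exact: closed_openC.
Qed.

Lemma closed_boundary (T : topologicalType) (U : set T) : closed (boundary U).
Proof.
rewrite /boundary setDE; apply: closedI; first exact: closed_closure.
by apply: open_closedC; exact: open_interior.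
Qed.

Lemma compact_boundary (T : topologicalType) (U : set T) :
  compact (closure U) -> compact (boundary U).
Proof.
by move=> cU; apply: subclosed_compact cU _; [exact: closed_boundary|move=> y []].
Qed.

Lemma within_continuous_bounded {R : realType} (T : topologicalType) (K : set T) (f : T -> R) :
  compact K -> {within K, continuous f} -> exists M, forall y, K y -> `|f y| <= M.
Proof.
move=> cK cf; have [K0|/set0P ne] := eqVneq K set0; first by exists 0 => y; rewrite K0.
have cn : {within K, continuous (fun y => `|f y|)}.
  apply: (@within_continuous_comp _ _ _ _ f (fun x : R => `|x|)) => // y _.
  exact: norm_continuous.
have [c _ cM] := compact_EVT_max ne cK cn.
by exists `|f c| => y Ky; apply: cM; exact: mem_set.
Qed.

Lemma measure_carried d (T : measurableType d) (R : realType)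
    (m : {measure set T -> \bar R}) (B : set T) :
  measurable B -> m (~` B) = 0%E -> m setT = m B.
Proof.
by move=> mB B0; rewrite -(setUv B); apply: measureU0 => //; exact: measurableC.
Qed.

(** The hypotheses of the theorem that concern a single exhaustion of [D]; they are
    inherited by subsequences, so the double extraction of the theorem is absorbed
    in [E]. *)
Record exhaustion {R : realType} {X : pmetricType R} (dom : set (set X))
    (w : set X -> X -> {finite_bmeasure X -> \bar R}) (D : set X) (x0 : X)
    (E : nat -> set X) : Prop := Exhaustion {
  exh_fw : harmonic_framework dom w ;
  exh_dom : forall n, dom (E n) /\ regular_domain w (E n) ;
  exh_x0 : E 0%N x0 ;
  exh_cc : forall n, compactly_contained (E n) (E n.+1) ;
  exh_cup : D = \bigcup_n E n ;
  exh_ker : forall n, jointly_continuous_kernel w x0 (E n) }.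

Section exhaustion_theory.
Context {R : realType} {X : pmetricType R} (dom : set (set X))
    (w : set X -> X -> {finite_bmeasure X -> \bar R}) (D : set X) (x0 : X)
    (E : nat -> set X).
Hypothesis EX : exhaustion dom w D x0 E.
Local Notation bE n := (boundary (E n)).

Lemma exh_open n : open (E n).
Proof.
by case: (exh_fw EX) => /(_ _ (exh_dom EX n).1)[[]].
Qed.

Lemma exh_openD : open D.
Proof. by rewrite (exh_cup EX); apply: bigcup_open => n _; exact: exh_open. Qed.

Lemma exh_closure m n : (m < n)%N -> closure (E m) `<=` E n.
Proof.
elim: n => // n IH; rewrite ltnS leq_eqVlt => /predU1P[->|/IH mn].
  by case: (exh_cc EX n).
by apply: subset_trans mn _; apply: subset_trans (exh_cc EX n).2; exact: subset_closure.
Qed.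

Lemma exh_sub m n : (m <= n)%N -> E m `<=` E n.
Proof.
rewrite leq_eqVlt => /predU1P[->//|/exh_closure]; apply: subset_trans.
exact: subset_closure.
Qed.

Lemma exh_subD n : E n `<=` D.
Proof. by rewrite (exh_cup EX) => x Ex; exists n. Qed.

Lemma exh_mem_x0 n : E n x0.
Proof. exact: exh_sub (leq0n n) _ (exh_x0 EX). Qed.

Lemma exh_closureD n : closure (E n) `<=` D.
Proof. by apply: subset_trans (@exh_subD n.+1); exact: exh_closure. Qed.

Lemma exh_memP x : D x -> exists n, forall m, (n <= m)%N -> E m x.
Proof.
rewrite (exh_cup EX) => -[n _ Ex]; exists n => m nm; exact: exh_sub Ex.
Qed.

Lemma exh_compact n : compact (closure (E n)).
Proof. by case: (exh_cc EX n). Qed.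

Lemma bd_compact n : compact (bE n).
Proof. exact: compact_boundary (@exh_compact n). Qed.

Lemma bd_sub m n : (m < n)%N -> bE m `<=` E n.
Proof. by move=> mn x [+ _]; exact: exh_closure. Qed.

Lemma bd_measurable n : measurable (bE n : set (borel X)).
Proof. by apply: closed_borel; exact: closed_boundary. Qed.

Lemma exh_hm n : continuous_harmonic_measure (E n) (bE n) (w (E n)).
Proof. by case: (exh_fw EX) => /(_ _ (exh_dom EX n).1)[]. Qed.

Lemma w_bd0 n x : E n x -> w (E n) x (~` bE n) = 0%E.
Proof. by have [[_ + _ _] _] := exh_hm n; exact. Qed.

Lemma w_bd1 n x : E n x -> w (E n) x (bE n) = 1%E.
Proof. by have [[_ _ + _] _] := exh_hm n; exact. Qed.

Lemma w_dom n x y : E n x -> E n y -> w (E n) x `<< w (E n) y.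
Proof. by have [[_ _ _ +] _] := exh_hm n; exact. Qed.

Lemma w_setT n x : E n x -> w (E n) x setT = 1%E.
Proof.
move=> Ex; exact: etrans (measure_carried (bd_measurable n) (w_bd0 Ex)) (w_bd1 Ex).
Qed.

Lemma exh_dense : exists q : nat -> X, (forall i, D (q i)) /\
  forall x e, D x -> 0 < e -> exists i, ball x e (q i).
Proof.
have cov n (k : nat) : exists s : seq X, (forall a, a \in s -> closure (E n) a) /\
    forall x, closure (E n) x -> exists2 a, a \in s & ball x k.+1%:R^-1 a.
  have := @exh_compact n; rewrite compact_cover.
  move=> /(_ X (closure (E n)) (fun a => ball a k.+1%:R^-1)).
  case=> [a _|x Ex|s sE sU]; first exact: metric_ball_open.
    by exists x => //; apply: ballxx; rewrite invr_gt0.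
  exists (finmap.enum_fset s); split => [a /sE /set_mem//|x /sU[a /= sa xa]].
  by exists a => //; exact: ball_sym.
have /choice[s sP] (nk : nat * nat) : exists s : seq X,
    (forall a, a \in s -> closure (E nk.1) a) /\
    forall x, closure (E nk.1) x -> exists2 a, a \in s & ball x nk.2.+1%:R^-1 a.
  exact: cov.
(* The centres of finite covers of all [closure (E n)] by balls of radius
   [k.+1^-1], listed in one sequence; indices that code no centre give [x0]. *)
pose q (m : nat) : X := match (choice.unpickle m : option (nat * nat * nat)) with
  | Some (n, k, i) => if (i < size (s (n, k)))%N then nth x0 (s (n, k)) i else x0
  | None => x0 end.
exists q; split => [m|x e Dx e0].
  have Dx0 := @exh_subD 0%N _ (exh_mem_x0 0).
  rewrite /q; case: choice.unpickle => // -[[n k] i]; case: ifPn => // im.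
  by apply: (@exh_closureD n); apply: (sP (n, k)).1; exact: mem_nth.
have [n En] := exh_memP Dx.
have [k ke] : exists k : nat, k.+1%:R^-1 <= e.
  have /filter_ex[k kP] := near_infty_natSinv_lt (PosNum e0).
  by exists k; exact: ltW.
have [|a sa xa] := (sP (n, k)).2 x; first exact/subset_closure/En.
exists (choice.pickle (n, k, index a (s (n, k)))).
by rewrite /q choice.pickleK index_mem sa nth_index//; exact: le_ball xa.
Qed.

End exhaustion_theory.

(** * Continuous versions of the kernels *)
Lemma within_continuous_borel {R : realType} (T : ptopologicalType) (A : set T)
    (f : T -> R) : measurable (A : set (borel T)) -> {within A, continuous f} ->
  measurable_fun (A : set (borel T)) f.
Proof.
move=> mA cf.
apply: (measurability _ (RGenOpens.measurableE R)) => _ [_ [a [b ->] <-]].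
have /continuousP/(_ `]a, b[%classic (interval_open _ _))/open_subspaceP := cf.
case=> // V oV VA.
have -> : A `&` f @^-1` `]a, b[%classic = V `&` A by rewrite setIC -VA.
by apply: measurableI => //; exact: open_borel.
Qed.

(** What is used of a kernel: nonnegative, extended by 0, and continuous in the
    interior variable uniformly in the boundary variable, by compactness of the
    boundary. *)
Record is_kernel {R : realType} {X : pmetricType R}
    (w : X -> {finite_bmeasure X -> \bar R}) (x0 : X) (U : set X)
    (k : X -> X -> R) : Prop := IsKernel {
  ker_ge0 : forall x y, 0 <= k x y ;
  ker_out : forall x y, ~ (U x /\ boundary U y) -> k x y = 0 ;
  ker_cont : forall x e, U x -> 0 < e ->
    \forall x' \near x, forall y, `|k x y - k x' y| <= e ;
  ker_bnd : forall x, U x -> exists M, forall y, k x y <= M ;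
  ker_meas : forall x, measurable_fun setT (k x : borel X -> R) ;
  ker_dens : forall x (A : set (borel X)), U x -> measurable A ->
    w x A = (\int[w x0]_(y in A) (k x y)%:E)%E }.

Section kernel.
Context {R : realType} {X : pmetricType R} (dom : set (set X))
    (w : set X -> X -> {finite_bmeasure X -> \bar R}) (D : set X) (x0 : X)
    (E : nat -> set X).
Hypothesis EX : exhaustion dom w D x0 E.
Local Notation bE n := (boundary (E n)).

Lemma exh_is_kernel n : exists k, is_kernel (w (E n)) x0 (E n) k.
Proof.
have [K [cK KE]] := exh_ker EX n.
have oE := exh_open EX n; have cbE : compact (bE n) := @bd_compact _ _ _ _ _ _ _ EX n.
have mbE := bd_measurable E n.
(* A continuous version may be negative on a null set; its positive part is still
   a continuous version, and it is nonnegative everywhere. *)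
pose k x y : R := if pselect (E n x /\ bE n y) then Num.max 0 (K (x, y)) else 0.
have kE x y : E n x -> bE n y -> k x y = Num.max 0 (K (x, y)).
  by rewrite /k; case: pselect => // h Ex By; case: h.
have kN x y : ~ (E n x /\ bE n y) -> k x y = 0 by rewrite /k; case: pselect.
have k0 x y : 0 <= k x y.
  by rewrite /k; case: pselect => // ?; rewrite le_max lexx.
have maxlip (a b : R) : `|Num.max 0 a - Num.max 0 b| <= `|a - b|.
  have [a0|a0] := leP 0 a; have [b0|b0] := leP 0 b; rewrite ?subr0 ?sub0r ?normrN ?normr0 //.
  - by rewrite !ger0_norm//; lra.
  - by rewrite (ger0_norm b0) ltr0_norm; lra.
have cont1 x y e : E n x -> bE n y -> 0 < e ->
    \forall x' \near x & y' \near y, `|k x y' - k x' y'| <= e.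
  move=> Ex By e0; have e20 : 0 < e / 2 by rewrite divr_gt0.
  have /subspace_continuousP/(_ (x, y)) := cK.
  have ExBy : (E n `*` bE n) (x, y) by [].
  move=> /(_ ExBy)/cvgrPdist_le/(_ _ e20) nK.
  have [[A B] /= [nA nB] ABK] : nbhs (x, y) [set z | (E n `*` bE n) z -> `|K (x, y) - K z| <= e / 2] by [].
  exists (A `&` E n, B) => /=.
    by split => //; apply: filterI => //; exact: open_nbhs_nbhs.
  move=> [x' y'] /= [[Ax' Ex'] By'].
  have [bey'|nbey'] := pselect (bE n y'); last first.
    by rewrite !kN ?subrr ?normr0 ?ltW//; case.
  rewrite !kE//; apply: le_trans (maxlip _ _) _.
  have h1 : `|K (x, y) - K (x', y')| <= e / 2 by apply: (ABK (x', y')).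
  have h2 : `|K (x, y) - K (x, y')| <= e / 2.
    by apply: (ABK (x, y')) => //; split => //=; exact: nbhs_singleton.
  rewrite (_ : K (x, y') - K (x', y') = (K (x, y) - K (x', y')) - (K (x, y) - K (x, y'))); last by ring.
  by rewrite (le_trans (ler_normB _ _))// [leRHS]splitr lerD.
have kcont x e : E n x -> 0 < e ->
    \forall x' \near x, forall y, `|k x y - k x' y| <= e.
  move=> Ex e0; have /compact_near_coveringP cov := cbE.
  have h : \forall x' \near x, bE n `<=` (fun y' => `|k x y' - k x' y'| <= e).
    apply: cov => y By; have := cont1 x y e Ex By e0.
    by case=> -[A B] /= [nA nB] AB; exists (B, A) => //= -[y' x'] /= [? ?]; apply: (AB (x', y')).
  apply: filterS2 h (open_nbhs_nbhs (conj oE Ex)) => x' h Ex' y.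
  have [By|nBy] := pselect (bE n y); first exact: h.
  by rewrite !kN ?subrr ?normr0 ?ltW//; case.
have Kx x : E n x -> {within bE n, continuous (fun y => K (x, y))}.
  move=> Ex; apply/subspace_continuousP => y By.
  apply/cvgrPdist_le => e e0.
  have /subspace_continuousP/(_ (x, y)) := cK.
  have ExBy : (E n `*` bE n) (x, y) by [].
  move=> /(_ ExBy)/cvgrPdist_le/(_ _ e0) nK.
  have [[A B] /= [nA nB] ABK] : nbhs (x, y) [set z | (E n `*` bE n) z -> `|K (x, y) - K z| <= e] by [].
  apply: filterS nB => y' By' bey'; apply: (ABK (x, y')) => //; split => //=.
  exact: nbhs_singleton.
have mk x : measurable_fun setT (k x : borel X -> R).
  have [Ex|nEx] := pselect (E n x); last first.
    by rewrite (_ : k x = cst 0)//; apply/funext => y; rewrite kN// => -[].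
  have -> : k x = (fun y => Num.max 0 (K (x, y))) \_ (bE n).
    apply/funext => y; rewrite patchE; case: ifPn => [/set_mem By|/negP nBy].
      by rewrite kE.
    by rewrite kN// => -[_ By]; apply: nBy; exact: mem_set.
  apply/(measurable_restrictT _ _).1 => //.
  apply: measurable_maxr => //; apply: within_continuous_borel => //.
  exact: Kx.
exists k; split => //.
- move=> x Ex; have [b0|/set0P ne] := eqVneq (bE n) set0.
    by exists 0 => y; rewrite kN// b0 => -[_ []].
  have [c cb cM] := compact_EVT_max ne cbE (Kx x Ex).
  exists (Num.max 0 (K (x, c))) => y.
  have [By|nBy] := pselect (bE n y); last by rewrite kN ?le_max ?lexx// => -[].
  by rewrite kE// ge_max !le_max lexx/= cM ?orbT//; exact: mem_set.
- move=> x A Ex mA.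
  have wd := w_dom EX Ex (exh_mem_x0 EX n).
  rewrite (Radon_Nikodym_SigmaFinite.f_integral wd)//.
  have intf := Radon_Nikodym_SigmaFinite.f_integrable wd.
  apply: ae_eq_integral => //.
  + exact: measurable_funTS (measurable_int _ intf).
  + by apply/measurable_EFinP; exact: measurable_funTS.
  have h1 := ae_eq_Radon_Nikodym_SigmaFinite wd mbE.
  have h2 := KE x Ex.
  have h3 : \forall y \ae w (E n) x0, bE n y.
    exists (~` bE n); split => //; first exact: measurableC.
    exact: (w_bd0 EX (exh_mem_x0 EX n)).
  apply: filterS3 h1 h2 h3 => y /= h1 h2 By _.
  rewrite kE// EFin_max h2//.
  rewrite /relative_kernel -h1//; apply/esym/max_idPr.
  exact: Radon_Nikodym_SigmaFinite.f_ge0.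
Qed.
End kernel.

(** * The mean value property and its uniform estimates *)
Lemma integrable_bounded d (T : measurableType d) (R : realType)
    (mu : {finite_measure set T -> \bar R}) (B : set T) (f : T -> R) (M : R) :
  measurable B -> measurable_fun B f -> (forall y, B y -> `|f y| <= M) ->
  mu.-integrable B (EFin \o f).
Proof.
move=> mB mf fM; apply: measurable_bounded_integrable => //.
  by rewrite -ge0_fin_numE// fin_num_measure.
exists M; split; first exact: num_real.
by move=> x Mx y By; exact: le_trans (fM _ By) (ltW Mx).
Qed.

Section potential.
Context {R : realType} {X : pmetricType R} (dom : set (set X))
    (w : set X -> X -> {finite_bmeasure X -> \bar R}) (D : set X) (x0 : X)
    (E : nat -> set X).
Hypothesis EX : exhaustion dom w D x0 E.
Local Notation bE n := (boundary (E n)).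
Local Notation P n := (w (E n) x0).
Variable k : nat -> X -> X -> R.
Hypothesis kP : forall n, is_kernel (w (E n)) x0 (E n) (k n).

Lemma integral_wk n x (f : X -> R) : E n x -> (forall y, 0 <= f y) ->
  measurable_fun (bE n : set (borel X)) f ->
  (\int[w (E n) x]_(y in bE n) (f y)%:E =
   \int[P n]_(y in bE n) ((f y)%:E * (k n x y)%:E))%E.
Proof.
move=> Ex f0 mf; apply: ge0_integral_density.
- exact: (ker_meas (kP n)).
- by move=> A mA; exact: (ker_dens (kP n)).
- exact: bd_measurable.
- by move=> y; rewrite lee_fin.
- exact/measurable_EFinP.
Qed.

(** The mean value property on the single domain [E n].  It makes sense for
    functions that are only known near [E n], such as kernels and their limits. *)
Definition mean_value n (h : X -> R) : Prop :=
  [/\ measurable_fun (bE n : set (borel X)) h, forall z, 0 <= h z, h x0 = 1 &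
   forall x, E n x -> (h x)%:E = (\int[w (E n) x]_(y in bE n) (h y)%:E)%E].

Lemma mean_value_P n h : mean_value n h ->
  (\int[P n]_(y in bE n) (h y)%:E)%E = 1%E.
Proof. by case=> _ _ h1 hE; rewrite -(hE _ (exh_mem_x0 EX n)) h1. Qed.

(** A uniform comparison of two kernels transfers to all functions with the mean
    value property, since these are averages of kernels with weights [h] of total
    mass [h x0 = 1].  The following two estimates are instances. *)
Lemma mean_value_le n h x x' e : mean_value n h -> E n x -> E n x' -> 0 <= e ->
  (forall y, k n x y <= k n x' y + e) -> h x <= h x' + e.
Proof.
move=> mvh Ex Ex' e0 kk; have [mh h0 _ hE] := mvh.
have mbE := bd_measurable E n.
have mk z : measurable_fun (bE n : set (borel X)) (k n z).
  exact: measurable_funTS (ker_meas (kP n) z).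
rewrite -lee_fin EFinD (hE _ Ex) (hE _ Ex') (integral_wk Ex h0 mh) (integral_wk Ex' h0 mh).
rewrite -[X in (_ <= _ + X)%E]mule1 -(mean_value_P mvh) -ge0_integralZl//; last 2 first.
  exact/measurable_EFinP.
  by move=> y _; rewrite lee_fin.
have kn0 := ker_ge0 (kP n).
rewrite -ge0_integralD//.
- apply: ge0_le_integral => //.
  + by move=> y _; rewrite mule_ge0// lee_fin.
  + by apply: emeasurable_funM; exact/measurable_EFinP.
  + apply: emeasurable_funD; first by apply: emeasurable_funM; exact/measurable_EFinP.
    by apply: emeasurable_funM => //; exact/measurable_EFinP.
  + move=> y By; rewrite -!EFinM -EFinD lee_fin [e * _]mulrC -mulrDr.
    exact: ler_wpM2l.
- by move=> y _; rewrite mule_ge0// lee_fin.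
- by apply: emeasurable_funM; exact/measurable_EFinP.
- by move=> y _; rewrite mule_ge0// lee_fin.
- by apply: emeasurable_funM => //; exact/measurable_EFinP.
Qed.

Lemma mean_value_equicont n x e : E n x -> 0 < e ->
  \forall x' \near x, E n x' /\ forall h, mean_value n h -> `|h x - h x'| <= e.
Proof.
move=> Ex e0.
have nE : nbhs x (E n) by apply: open_nbhs_nbhs; split => //; exact: (exh_open EX).
apply: filterS2 nE (ker_cont (kP n) Ex e0) => x' Ex' kk.
split=> // h mvh.
have h1 : h x <= h x' + e.
  apply: (mean_value_le mvh) => //; first exact: ltW.
  by move=> y; have := kk y; rewrite ler_norml => /andP[_]; rewrite lerBlDl.
have h2 : h x' <= h x + e.
  apply: (mean_value_le mvh) => //; first exact: ltW.
  by move=> y; have := kk y; rewrite distrC ler_norml => /andP[_]; rewrite lerBlDl.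
by rewrite ler_norml; apply/andP; split; lra.
Qed.

Lemma mean_value_bounded n x : E n x ->
  exists M, 0 <= M /\ forall h, mean_value n h -> h x <= M.
Proof.
move=> Ex; have [M kM] := ker_bnd (kP n) Ex.
have kn0 := ker_ge0 (kP n).
have M0 : 0 <= M by exact: le_trans (kn0 x x) (kM x).
exists M; split => // h mvh; have [mh h0 _ hE] := mvh.
have mbE := bd_measurable E n.
rewrite -lee_fin hE// integral_wk// -[leRHS]mule1 -(mean_value_P mvh) -ge0_integralZl//.
- apply: ge0_le_integral => //.
  + by move=> y _; rewrite mule_ge0// lee_fin.
  + apply: emeasurable_funM; first exact/measurable_EFinP.
    by apply/measurable_EFinP; exact: measurable_funTS (ker_meas (kP n) x).
  + by apply: emeasurable_funM => //; exact/measurable_EFinP.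
  + by move=> y By; rewrite -!EFinM lee_fin mulrC ler_wpM2r.
- exact/measurable_EFinP.
- by move=> y _; rewrite lee_fin.
Qed.

Lemma L1_bounded n x (f : X -> R) (M : R) :
  measurable_fun (bE n : set (borel X)) f -> (forall y, bE n y -> `|f y| <= M) ->
  L1 (bE n) (w (E n) x) f.
Proof.
move=> mf fM; exists f; split; first exact: integrable_bounded (bd_measurable E n) mf fM.
exact: ae_eq_refl.
Qed.

Lemma integral_cont n (f : X -> R) (M : R) :
  measurable_fun (bE n : set (borel X)) f -> (forall y, bE n y -> `|f y| <= M) ->
  {within E n, continuous (fun x => \int[w (E n) x]_(y in bE n) f y)}.
Proof.
move=> mf fM; have [_ +] := exh_hm EX n; apply => x Ex.
exact: L1_bounded mf fM.
Qed.

Lemma EFin_integral_w n x (f : X -> R) (M : R) : E n x ->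
  measurable_fun (bE n : set (borel X)) f -> (forall y, bE n y -> `|f y| <= M) ->
  (\int[w (E n) x]_(y in bE n) f y)%:E = (\int[w (E n) x]_(y in bE n) (f y)%:E)%E.
Proof.
move=> Ex mf fM; rewrite fineK//; apply: integrable_fin_num.
  exact: bd_measurable.
exact: integrable_bounded (bd_measurable E n) mf fM.
Qed.

Lemma integral_w_bound n x (f : X -> R) (M : R) : E n x ->
  measurable_fun (bE n : set (borel X)) f -> (forall y, bE n y -> `|f y| <= M) ->
  `|\int[w (E n) x]_(y in bE n) f y| <= M.
Proof.
move=> Ex mf fM; have mb := bd_measurable E n.
have intf := @integrable_bounded _ _ _ (w (E n) x) _ _ _ mb mf fM.
apply: le_trans (le_normr_Rintegral _ _) _ => //.
have intM : (w (E n) x).-integrable (bE n) (EFin \o cst `|M|).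
  by apply: (@integrable_bounded _ _ _ _ _ _ `|M|) => // y _ /=; rewrite normr_id.
have [b0|/set0P[y By]] := eqVneq (bE n) set0.
  by have := w_bd1 EX Ex; rewrite b0 measure0 => /eqP; rewrite eqe eq_sym oner_eq0.
have M0 : 0 <= M by exact: le_trans (normr_ge0 _) (fM _ By).
have -> : M = \int[w (E n) x]_(y in bE n) M.
  transitivity (M * fine (w (E n) x (bE n))); last by rewrite Rintegral_cst.
  by rewrite (w_bd1 EX Ex)/= mulr1.
apply: le_Rintegral => //; first exact: integrable_norm intf.
by apply: (@integrable_bounded _ _ _ _ _ _ M) => // z _ /=; rewrite ger0_norm.
Qed.

(** The consistency of the harmonic measures of nested domains, in the extended real
    form that Tonelli's theorem produces. *)
Lemma integral_w_chain m n x (f : X -> R) (M : R) : (m < n)%N -> E m x ->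
  measurable_fun (bE n : set (borel X)) f -> (forall y, bE n y -> `|f y| <= M) ->
  (\int[w (E n) x]_(y in bE n) (f y)%:E =
   \int[w (E m) x]_(z in bE m) \int[w (E n) z]_(y in bE n) (f y)%:E)%E.
Proof.
move=> mn Ex mf fM.
have Enx : E n x by exact: (exh_sub EX (ltnW mn)).
have sbE := bd_sub EX mn.
rewrite -(EFin_integral_w Enx mf fM).
have [_ _ ch] := exh_fw EX.
have [domn _] := exh_dom EX n; have [domm regm] := exh_dom EX m.
have ccmn : compactly_contained (E m) (E n).
  by split; [exact: exh_compact EX m|exact: exh_closure EX _ _ mn].
rewrite (ch (E n) (E m) f x domn domm ccmn regm Ex); last by split => //; exists M.
rewrite (EFin_integral_w (M := M))//.
- by apply: eq_integral => z /set_mem Bz; rewrite (EFin_integral_w _ mf fM)//; exact: sbE.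
- apply: within_continuous_borel; first exact: bd_measurable.
  exact: continuous_subspaceW sbE (integral_cont mf fM).
- by move=> z Bz; apply: integral_w_bound => //; exact: sbE.
Qed.

End potential.

(** * Kernels have the mean value property for almost every boundary point *)
Section reproducing.
Context {R : realType} {X : pmetricType R} (dom : set (set X))
    (w : set X -> X -> {finite_bmeasure X -> \bar R}) (D : set X) (x0 : X)
    (E : nat -> set X).
Hypothesis EX : exhaustion dom w D x0 E.
Local Notation bE n := (boundary (E n)).
Local Notation P n := (w (E n) x0).
Variable k : nat -> X -> X -> R.
Hypothesis kP : forall n, is_kernel (w (E n)) x0 (E n) (k n).

Lemma dense_in_exh n : exists q : nat -> X, (forall i, E n (q i)) /\
  forall x e, E n x -> 0 < e -> exists i, ball x e (q i).
Proof.
have [q [_ qd]] := exh_dense EX.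
exists (fun i => if pselect (E n (q i)) then q i else x0); split=> [i|x e Ex e0].
  by case: pselect => //= _; exact: exh_mem_x0 EX n.
have /nbhs_ballP[e1 /= e10 e1E] : nbhs x (E n).
  by apply: open_nbhs_nbhs; split => //; exact: exh_open EX n.
have [|i qi] := qd x (Num.min e e1) (exh_subD EX (n := n) Ex).
  by rewrite lt_min e0.
exists i; case: pselect => /= [_|nE]; first by apply: le_ball qi; rewrite ge_min lexx.
by exfalso; apply: nE; apply: e1E; apply: le_ball qi; rewrite ge_min lexx orbT.
Qed.

Lemma kernel_continuous n y x : E n x -> {for x, continuous (fun x => k n x y)}.
Proof.
move=> Ex; apply/cvgrPdist_le => e e0.
by apply: filterS (ker_cont (kP n) Ex e0) => x' /(_ y).
Qed.

Lemma kernel_joint_measurable n :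
  measurable_fun setT (fun z : borel X * borel X => k n z.1 z.2).
Proof.
have [q [qE qd]] := dense_in_exh n.
apply: (@measurable_caratheodory R X _ (borel X) (E n) q (fun z => k n z.1 z.2)) => //.
- exact: exh_open EX n.
- by move=> x y nEx; apply: (ker_out (kP n)) => -[].
- by move=> x y Ex; exact: kernel_continuous.
- by move=> i; exact: ker_meas (kP n) _.
Qed.

Lemma kernel_meas1 n y : measurable_fun setT ((k n)^~ y : borel X -> R).
Proof.
exact: (@measurableT_comp _ _ _ (borel X) (borel X * borel X)%type R
  (fun z => k n z.1 z.2) setT (fun x => (x, y)) (kernel_joint_measurable n)
  (@pair2_measurable _ _ (borel X) (borel X) y)).
Qed.

Lemma kernel_fubini m n x (A : set (borel X)) : E m x -> measurable A ->
  (\int[w (E m) x]_(z in bE m) \int[P n]_(y in A) (k n z y)%:E =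
   \int[P n]_(y in A) \int[w (E m) x]_(z in bE m) (k n z y)%:E)%E.
Proof.
move=> Ex mA; have mb := bd_measurable E m.
pose f (zy : borel X * borel X) : \bar R :=
  (k n zy.1 zy.2 * \1_(bE m) zy.1 * \1_A zy.2)%:E.
have mf : measurable_fun setT f.
  apply/measurable_EFinP; apply: measurable_funM.
    apply: measurable_funM; first exact: kernel_joint_measurable.
    by apply: measurableT_comp => //; exact: measurable_indic.
  by apply: measurableT_comp => //; exact: measurable_indic.
have f0 z : (0 <= f z)%E by rewrite lee_fin !mulr_ge0// (ker_ge0 (kP n)).
have := fubini_tonelli (m1 := w (E m) x) (m2 := P n) f mf f0.
rewrite /f/=.
have -> : (\int[w (E m) x]_z \int[P n]_y (k n z y * \1_(bE m) z * \1_A y)%:E =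
   \int[w (E m) x]_(z in bE m) \int[P n]_(y in A) (k n z y)%:E)%E.
  rewrite [RHS]integral_mkcond; apply: eq_integral => z _; rewrite patchE.
  rewrite indicE; case: ifPn => zb; last first.
    by under eq_integral do rewrite mulr0 mul0r; rewrite integral0.
  rewrite [RHS]integral_mkcond; apply: eq_integral => y _; rewrite patchE indicE mulr1.
  by case: ifPn => _; rewrite ?mulr1 ?mulr0.
move=> ->.
rewrite [RHS]integral_mkcond; apply: eq_integral => y _; rewrite patchE.
have [Ay|nAy] := pselect (A y); last first.
  rewrite memNset//; apply: integral0_eq => z _.
  by rewrite !indicE (memNset nAy) mulr0.
rewrite mem_set// [RHS]integral_mkcond; apply: eq_integral => z _.
rewrite patchE !indicE (mem_set Ay) mulr1.
by case: ifPn => _; rewrite ?mulr1 ?mulr0.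
Qed.

Lemma ae_boundary n : \forall y \ae P n, bE n y.
Proof.
exists (~` bE n); split => //; first by apply: measurableC; exact: bd_measurable.
exact: (w_bd0 EX (exh_mem_x0 EX n)).
Qed.

Lemma kernel_integrable n x B : E n x -> measurable (B : set (borel X)) ->
  (P n).-integrable B (EFin \o k n x).
Proof.
move=> Ex mB; have [M kM] := ker_bnd (kP n) Ex.
apply: (@integrable_bounded _ _ _ _ _ _ M) => //.
  exact: measurable_funTS (ker_meas (kP n) x).
by move=> y _; rewrite ger0_norm// (ker_ge0 (kP n)).
Qed.

Lemma ae_kernel_x0 n : \forall y \ae P n, k n x0 y = 1.
Proof.
have mb := bd_measurable E n; have Ex0 := exh_mem_x0 EX n.
have h1 : ae_eq (P n) (bE n) (EFin \o k n x0) (cst 1%E).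
  apply: integral_ae_eq => //; first exact: kernel_integrable.
  by move=> A Ab mA; rewrite /= -(ker_dens (kP n))// integral_cst// mul1e.
by apply: filterS2 h1 (ae_boundary n) => y /= h1 /h1[].
Qed.

(** Integrated over any Borel set [A] of boundary points both sides are [w (E n) x A]:
    the left one by definition of the kernel, the right one by Fubini's theorem and
    the chain rule. *)
Lemma ae_kernel_mean m n x : (m < n)%N -> E m x ->
  \forall y \ae P n, (k n x y)%:E = (\int[w (E m) x]_(z in bE m) (k n z y)%:E)%E.
Proof.
move=> mn Ex; have mb := bd_measurable E n; have mbm := bd_measurable E m.
have Enx := exh_sub EX (ltnW mn) Ex.
have h1 : ae_eq (P n) (bE n) (EFin \o k n x)
    (fun y => \int[w (E m) x]_(z in bE m) (k n z y)%:E)%E.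
  apply: integral_ae_eq => //; first exact: kernel_integrable.
    apply: measurable_funTS.
    have := @measurable_fun_fubini_tonelli_G _ _ (borel X) (borel X) R
      (w (E m) x) (fun z => (k n z.1 z.2 * \1_(bE m) z.1)%:E).
    rewrite /fubini_G/= => h; rewrite (_ : (fun y => _) = (fun y =>
      \int[w (E m) x]_z (k n z y * \1_(bE m) z)%:E)%E).
      apply: h => [|z].
        apply/measurable_EFinP; apply: measurable_funM; first exact: kernel_joint_measurable.
        by apply: measurableT_comp => //; exact: measurable_indic.
      by rewrite lee_fin mulr_ge0// (ker_ge0 (kP n)).
    apply/funext => y; rewrite integral_mkcond; apply: eq_integral => z _.
    by rewrite patchE indicE; case: ifPn => _; rewrite ?mulr1 ?mulr0.
  move=> A Ab mA; rewrite -kernel_fubini// -(ker_dens (kP n))//.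
  have IA z : (w (E n) z A = \int[w (E n) z]_(y in bE n) (\1_A y)%:E)%E.
    by rewrite integral_indic// setIidl.
  rewrite IA (integral_w_chain EX mn Ex (M := 1)); last 2 first.
    exact: measurable_indic.
    by move=> y _; rewrite indicE; case: (_ \in _); rewrite ?normr1 ?normr0.
  apply: eq_integral => z /set_mem Bz; rewrite -IA (ker_dens (kP n))//.
  exact: (bd_sub EX mn).
by apply: filterS2 h1 (ae_boundary n) => y /= h1 /h1.
Qed.

(** The exceptional null set of [ae_kernel_mean] depends on [x]; it is made
    independent of [x] by using a dense sequence and the continuity of both sides
    in [x]. *)
Lemma ae_kernel_mean_value m n : (m < n)%N ->
  \forall y \ae P n, mean_value w x0 E m ((k n)^~ y).
Proof.
move=> mn; have [q [qE qd]] := dense_in_exh m.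
have h i := ae_kernel_mean mn (qE i).
move: h => /ae_foralln h.
apply: filterS2 h (ae_kernel_x0 n) => y hq h1.
have mbm := bd_measurable E m.
have sbE := bd_sub EX mn.
have my : measurable_fun (bE m : set (borel X)) ((k n)^~ y).
  exact: measurable_funTS (kernel_meas1 n y).
split => //; first by move=> z; exact: (ker_ge0 (kP n)).
have cy : {within bE m, continuous ((k n)^~ y)}.
  apply/subspace_continuousP => z /sbE Ez.
  by apply: cvg_within_filter; exact: kernel_continuous.
have [M kM] := within_continuous_bounded (bd_compact EX (n := m)) cy.
have cI := integral_cont EX my kM.
have hI i : k n (q i) y = \int[w (E m) (q i)]_(z in bE m) k n z y.
  by apply: EFin_inj; rewrite hq (EFin_integral_w w (qE i) my kM).
move=> x Ex; rewrite -(EFin_integral_w w Ex my kM); congr EFin.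
apply/eqP; rewrite -subr_eq0 -normr_le0; apply/ler_addgt0Pl => e e0; rewrite addr0.
have e20 : 0 < e / 2 by rewrite divr_gt0.
have oE := exh_open EX m.
have nE : nbhs x (E m) by exact: open_nbhs_nbhs.
have c1 : \forall x' \near x, `|k n x y - k n x' y| <= e / 2.
  by have /cvgrPdist_le := @kernel_continuous n y x (exh_sub EX (ltnW mn) Ex); exact.
have c2 : \forall x' \near x, `|\int[w (E m) x]_(z in bE m) k n z y -
     \int[w (E m) x']_(z in bE m) k n z y| <= e / 2.
  rewrite continuous_open_subspace// in cI.
  by have /cvgrPdist_le := cI x (mem_set Ex); exact.
have /nbhs_ballP[d1 /= d10 d1P] := c1; have /nbhs_ballP[d2 /= d20 d2P] := c2.
have [|i qi] := qd x (Num.min d1 d2) Ex; first by rewrite lt_min d10.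
have h2 : `|k n x y - k n (q i) y| <= e / 2.
  by apply: d1P; apply: le_ball qi; rewrite ge_min lexx.
have h3 : `|\int[w (E m) x]_(z in bE m) k n z y -
    \int[w (E m) (q i)]_(z in bE m) k n z y| <= e / 2.
  by apply: d2P; apply: le_ball qi; rewrite ge_min lexx orbT.
rewrite (_ : _ - _ = (k n x y - k n (q i) y) - (\int[w (E m) x]_(z in bE m) k n z y - k n (q i) y)); last by ring.
rewrite [X in _ - (_ - X)]hI.
by rewrite (le_trans (ler_normB _ _))// [leRHS]splitr lerD.
Qed.

End reproducing.

(** * Positive harmonic functions and their limits *)
Lemma ae_dominated d (T : measurableType d) (R : realType)
    (mu nu : {measure set T -> \bar R}) (Q : set T) :
  nu `<< mu -> (\forall t \ae mu, Q t) -> \forall t \ae nu, Q t.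
Proof.
move=> /null_content_dominatesP numu [N [mN N0 QN]].
by exists N; split => //; exact: numu.
Qed.

Section positive_harmonic.
Context {R : realType} {X : pmetricType R} (dom : set (set X))
    (w : set X -> X -> {finite_bmeasure X -> \bar R}) (D : set X) (x0 : X)
    (E : nat -> set X).
Hypothesis EX : exhaustion dom w D x0 E.
Local Notation bE n := (boundary (E n)).
Local Notation P n := (w (E n) x0).
Variable k : nat -> X -> X -> R.
Hypothesis kP : forall n, is_kernel (w (E n)) x0 (E n) (k n).
Local Notation mean_value := (mean_value w x0 E).

(** A description of [H1] by the mean value property on the exhausting domains only;
    positivity comes for free, and the description is stable under pointwise
    limits. *)
Definition pos_harm (h : X -> R) : Prop :=
  [/\ {within D, continuous h}, forall m, mean_value m h & forall x, ~ D x -> h x = 0].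

Lemma exh_compact_sub (K : set X) : compact K -> K `<=` D -> exists n, K `<=` E n.
Proof.
move=> /compact_near_coveringP cK KD.
have : \forall n \near \oo, K `<=` E n.
  apply: cK => x Kx; have [n En] := exh_memP EX (KD _ Kx).
  have nE : nbhs x (E n).
    by apply: open_nbhs_nbhs; split; [exact: exh_open EX n|exact: En].
  exists (E n, [set m | (n <= m)%N]) => /=; first by split => //; exact: nbhs_infty_ge.
  by move=> [x' m] /= [Ex' nm]; exact: (exh_sub EX nm).
by move=> /filter_ex[n Kn]; exists n.
Qed.

Lemma bd_subD n : bE n `<=` D.
Proof. by apply: subset_trans (exh_subD EX (n := n.+1)); exact: (bd_sub EX). Qed.

Lemma contD_bd n (h : X -> R) : {within D, continuous h} -> {within bE n, continuous h}.
Proof. by apply: continuous_subspaceW; exact: bd_subD. Qed.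

Lemma contD_meas n (h : X -> R) : {within D, continuous h} ->
  measurable_fun (bE n : set (borel X)) h.
Proof.
move=> ch; apply: within_continuous_borel; first exact: bd_measurable.
exact: contD_bd.
Qed.

Lemma contD_bnd n (h : X -> R) : {within D, continuous h} ->
  exists M, forall y, bE n y -> `|h y| <= M.
Proof. by move=> ch; apply: within_continuous_bounded (bd_compact EX (n := n)) _; exact: contD_bd. Qed.

Lemma H1_pos_harm h : H1 dom w D x0 h -> pos_harm h.
Proof.
move=> [[ch hh] h0 h1 hD]; split => // m.
have mh := contD_meas (n := m) ch; have [M hM] := contD_bnd m ch.
split => // [z|x Ex].
  by have [/h0/ltW//|/hD->] := pselect (D z).
rewrite -(EFin_integral_w w Ex mh hM); congr EFin; apply: hh => //.
- by case: (exh_dom EX m).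
- by case: (exh_dom EX m).
- by split; [exact: exh_compact EX m|exact: exh_closureD EX m].
Qed.

(** If [h] vanishes at [x], it vanishes almost everywhere for [w (E n) x], hence for
    the equivalent measure [P n], which contradicts [h x0 = 1]. *)
Lemma pos_harm_gt0 h x : pos_harm h -> D x -> 0 < h x.
Proof.
move=> [ch mvh _] Dx; have [n En] := exh_memP EX Dx.
have Ex := En n (leqnn n); have [mh h0 h1 hE] := mvh n.
rewrite lt_neqAle h0 andbT eq_sym; apply/eqP => hx0.
have mb := bd_measurable E n.
have Ex0 := exh_mem_x0 EX n.
have := hE x Ex; rewrite hx0 => /esym I0.
have ae0 : ae_eq (w (E n) x) (bE n) (EFin \o h) (cst 0%E).
  apply/ae_eq_integral_abs => //; first exact/measurable_EFinP.
  by rewrite -[RHS]I0; apply: eq_integral => y _ /=; rewrite ger0_norm.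
have := mean_value_P EX (mvh n).
suff -> : (\int[P n]_(y in bE n) (h y)%:E = 0)%E by move/eqP; rewrite eqe eq_sym oner_eq0.
have ae0' : ae_eq (P n) (bE n) (EFin \o h) (cst 0%E).
  exact: (ae_dominated (w_dom EX Ex0 Ex)).
rewrite -[RHS](integral0 (P n) (bE n)).
by apply: ae_eq_integral => //; exact/measurable_EFinP.
Qed.

(** A regular [V] compactly contained in [D] lies in some [E n], where [h] is the
    integral of its own boundary values; the chain rule from [V] to [E n] then
    gives the mean value property on [V]. *)
Lemma pos_harm_H1 h : pos_harm h -> H1 dom w D x0 h.
Proof.
move=> ph; have [ch mvh hD] := ph; split => //; last 2 first.
- by move=> x; exact: pos_harm_gt0.
- by case: (mvh 0%N).
split=> // V x domV regV [cV sV] Vx.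
have [n Vn] := exh_compact_sub cV sV.
have mh := contD_meas (n := n) ch; have [M hM] := contD_bnd n ch.
have [_ _ _ hE] := mvh n.
have hI y : E n y -> h y = \int[w (E n) y]_(z in bE n) h z.
  by move=> Ey; apply: EFin_inj; rewrite hE// (EFin_integral_w w Ey mh hM).
rewrite [LHS]hI; last by apply: Vn; exact: subset_closure.
have [_ _ ch'] := exh_fw EX; have [domn _] := exh_dom EX n.
rewrite (ch' (E n) V h x domn domV (conj cV Vn) regV Vx); last by split => //; exists M.
by apply: eq_Rintegral => y /set_mem[cy _]; rewrite -hI//; exact: Vn.
Qed.

(** The equicontinuity of functions with the mean value property makes the
    convergence uniform on each boundary, so mean values pass to the limit. *)
Lemma pos_harm_limit (U : set_system nat) (UU : ProperFilter U)
    (F : nat -> X -> R) (f : X -> R) :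
  (forall m, \forall n \near U, mean_value m (F n)) ->
  (forall x, D x -> F n x @[n --> U] --> f x) ->
  (forall x, ~ D x -> f x = 0) -> pos_harm f.
Proof.
move=> mvF Ff fD.
have nonneg n m h : mean_value m h -> forall x : X, 0 <= h x by case.
have f0 x : 0 <= f x.
  have [Dx|/fD->//] := pselect (D x).
  apply: (@ler_cvg_to _ _ UU _ (cst 0) (F ^~ x)); [exact: cvg_cst|exact: Ff|].
  by apply: filterS (mvF 0%N) => n [_ + _ _]; exact.
have f1 : f x0 = 1.
  have c1 := Ff _ (exh_subD EX (exh_mem_x0 EX 0)).
  have c2 : F n x0 @[n --> U] --> (1 : R).
    by apply: cvg_near_cst; apply: filterS (mvF 0%N) => n [_ _ + _].
  exact: (cvg_unique _ c1 c2).
have equi m x e : E m x -> 0 < e ->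
    \forall x' \near x, [/\ E m x', `|f x - f x'| <= e &
      forall h, mean_value m h -> `|h x - h x'| <= e].
  move=> Ex e0; apply: filterS (mean_value_equicont EX kP Ex e0) => x' [Ex' hxx'].
  split => //.
  have c1 := Ff _ (exh_subD EX Ex); have c2 := Ff _ (exh_subD EX Ex').
  apply: (@ler_cvg_to _ _ UU _ (fun n => `|F n x - F n x'|) (cst e)).
  - by apply: cvg_norm; exact: cvgB.
  - exact: cvg_cst.
  - by apply: filterS (mvF m) => n /hxx'.
have oD := exh_openD EX.
have cf : {within D, continuous f}.
  rewrite continuous_open_subspace// => x /set_mem Dx.
  apply/cvgrPdist_le => e e0; have [m /(_ _ (leqnn m)) Ex] := exh_memP EX Dx.
  by apply: filterS (equi m x e Ex e0) => x' [].
split => // m; have mf := contD_meas (n := m) cf.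
split => // x Ex; have [M fM] := contD_bnd m cf.
have mb := bd_measurable E m.
(* Equicontinuity near points of [bE m] is available from the mean value property on
   the larger domain [E m.+1]. *)
have unif e : 0 < e -> \forall n \near U, bE m `<=` [set z | `|F n z - f z| <= e].
  move=> e0; have e30 : 0 < e / 3 by rewrite divr_gt0.
  have /compact_near_coveringP := bd_compact EX (n := m); apply => z Bz.
  have Ez : E m.+1 z by exact: (bd_sub EX (ltnSn m)).
  have /cvgrPdist_le/(_ _ e30) cz := Ff _ (exh_subD EX Ez).
  have nU : U [set n | `|f z - F n z| <= e / 3 /\ mean_value m.+1 (F n)].
    exact: filterI cz (mvF m.+1).
  exists ([set z' | [/\ E m.+1 z', `|f z - f z'| <= e / 3 &
      forall h, mean_value m.+1 h -> `|h z - h z'| <= e / 3]],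
      [set n | `|f z - F n z| <= e / 3 /\ mean_value m.+1 (F n)]) => /=.
    by split => //; exact: equi.
  move=> [z' n] /= [[Ez' h1 h2] [h3 /h2 h4]].
  move: h1 h3 h4; rewrite !ler_norml => /andP[a1 a2] /andP[a3 a4] /andP[a5 a6].
  have -> : e = 3 * (e / 3) by rewrite mulrCA divff// mulr1.
  by apply/andP; split; lra.
rewrite -(EFin_integral_w w Ex mf fM); congr EFin.
apply/eqP; rewrite -subr_eq0 -normr_le0; apply/ler_addgt0Pl => e e0; rewrite addr0.
have e20 : 0 < e / 2 by rewrite divr_gt0.
have /cvgrPdist_le/(_ _ e20) cx := Ff _ (exh_subD EX Ex).
have : U [set n | `|f x - F n x| <= e / 2 /\ (mean_value m (F n) /\
    bE m `<=` [set z | `|F n z - f z| <= e / 2])].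
  by apply: filterI cx _; apply: filterI (mvF m) (unif _ e20).
move=> /filter_ex[n [h1 [[mF F0 _ FE] Ff2]]].
have FM y : bE m y -> `|F n y| <= M + e / 2.
  move=> By; have := Ff2 _ By; have := fM _ By => /= g1 g2.
  rewrite (_ : F n y = f y + (F n y - f y)); last by ring.
  by rewrite (le_trans (ler_normD _ _))// lerD.
have h2 : `|F n x - \int[w (E m) x]_(y in bE m) f y| <= e / 2.
  have -> : F n x = \int[w (E m) x]_(y in bE m) F n y.
    by apply: EFin_inj; rewrite (EFin_integral_w w Ex mF FM) FE.
  rewrite -RintegralB//; last 2 first.
    exact: integrable_bounded mb mF FM.
    exact: integrable_bounded mb mf fM.
  apply: (integral_w_bound EX Ex) => //.
  exact: measurable_funB.
rewrite (_ : _ - _ = (f x - F n x) + (F n x - \int[w (E m) x]_(y in bE m) f y)); last by ring.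
by rewrite (le_trans (ler_normD _ _))// [leRHS]splitr lerD.
Qed.

End positive_harmonic.

(** * An energy that detects extreme points *)
Section energy.
Context {R : realType} {X : pmetricType R} (dom : set (set X))
    (w : set X -> X -> {finite_bmeasure X -> \bar R}) (D : set X) (x0 : X)
    (E : nat -> set X).
Hypothesis EX : exhaustion dom w D x0 E.
Local Notation bE n := (boundary (E n)).
Local Notation P n := (w (E n) x0).
Variable k : nat -> X -> X -> R.
Hypothesis kP : forall n, is_kernel (w (E n)) x0 (E n) (k n).
Local Notation mean_value := (mean_value w x0 E).
Local Notation pos_harm := (pos_harm w D x0 E).

(** The second moment of [k n q] under the probability with density [h] with respect
    to [P n]; heuristically, for large [n], the second moment of the values at [q]
    of the extreme components of [h]. *)
Definition energy n q (h : X -> R) : R :=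
  \int[P n]_(z in bE n) ((k n q z) ^+ 2 * h z).

(** The exponents 0, 1 and 2 give the mass, the value at [q] and the energy
    of [h]. *)
Lemma kernel_weight_integrable n q (h : X -> R) j : E n q ->
  {within D, continuous h} ->
  (P n).-integrable (bE n) (EFin \o (fun z => (k n q z) ^+ j * h z)).
Proof.
move=> Eq ch; have [M kM] := ker_bnd (kP n) Eq; have [H hH] := contD_bnd EX n ch.
have kn0 := ker_ge0 (kP n) q.
apply: (@integrable_bounded _ _ _ _ _ _ (M ^+ j * H)).
- exact: bd_measurable.
- apply: measurable_funM; last exact: (contD_meas EX).
  by apply: measurable_funX; exact: measurable_funTS (ker_meas (kP n) q).
- move=> y By; rewrite normrM normrX ler_pM ?exprn_ge0//; last exact: hH.
  by rewrite ger0_norm// lerXn2r// nnegrE (le_trans (kn0 y)).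
Qed.

Lemma kernel_mean n q h : pos_harm h -> E n q ->
  \int[P n]_(z in bE n) (k n q z * h z) = h q.
Proof.
move=> [ch mvh _] Eq; have [mh h0 _ hE] := mvh n; apply: EFin_inj.
rewrite hE// (integral_wk kP Eq h0 mh) fineK.
  by apply: eq_integral => z _; rewrite -EFinM mulrC.
apply: integrable_fin_num; first exact: bd_measurable.
exact: (kernel_weight_integrable 1%N).
Qed.

(** Jensen's inequality: the integral of the square of [k n q z - h q] against the
    probability [h P n], under which [k n q] has mean [h q], is nonnegative. *)
Lemma energy_ge n q h : pos_harm h -> E n q -> (h q) ^+ 2 <= energy n q h.
Proof.
move=> ph Eq; have [ch mvh _] := ph; have [mh h0 _ _] := mvh n.
have mb := bd_measurable E n.
have i2 := kernel_weight_integrable 2%N Eq ch.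
have i1 := kernel_weight_integrable 1%N Eq ch.
have i0 := kernel_weight_integrable 0%N Eq ch.
have i0' : (P n).-integrable (bE n) (EFin \o h).
  by apply: eq_integrable i0 => // z _; rewrite /= expr0 mul1r.
have h1 : \int[P n]_(z in bE n) h z = 1.
  by apply: EFin_inj; rewrite fineK ?integrable_fin_num// -(mean_value_P EX (mvh n)).
have : 0 <= \int[P n]_(z in bE n) ((k n q z - h q) ^+ 2 * h z).
  by apply: Rintegral_ge0 => z _; rewrite mulr_ge0// sqr_ge0.
have -> : \int[P n]_(z in bE n) ((k n q z - h q) ^+ 2 * h z) =
   \int[P n]_(z in bE n) (k n q z ^+ 2 * h z - ((2 * h q) * (k n q z ^+ 1 * h z)
     - (h q) ^+ 2 * (k n q z ^+ 0 * h z))).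
  by apply: eq_Rintegral => z _; ring.
have j1 : (P n).-integrable (bE n) (EFin \o (fun z => 2 * h q * (k n q z ^+ 1 * h z))).
  by apply: eq_integrable (integrableZl mb (2 * h q) i1).
have j0 : (P n).-integrable (bE n) (EFin \o (fun z => h q ^+ 2 * (k n q z ^+ 0 * h z))).
  by apply: eq_integrable (integrableZl mb (h q ^+ 2) i0).
have j : (P n).-integrable (bE n) (EFin \o (fun z => (2 * h q) * (k n q z ^+ 1 * h z)
     - (h q) ^+ 2 * (k n q z ^+ 0 * h z))).
  by apply: eq_integrable (integrableB mb j1 j0).
rewrite !RintegralB// !RintegralZl// mul1r h1 mulr1.
have -> : \int[P n]_(z in bE n) (k n q z ^+ 1 * h z) = h q.
  by rewrite -[RHS](kernel_mean ph Eq).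
by rewrite /energy; lra.
Qed.

Lemma energy_affine n q a b t : pos_harm a -> pos_harm b -> E n q ->
  energy n q (fun x => t * a x + (1 - t) * b x) =
  t * energy n q a + (1 - t) * energy n q b.
Proof.
move=> [ca _ _] [cb _ _] Eq; have mb := bd_measurable E n.
have ia := kernel_weight_integrable 2%N Eq ca.
have ib := kernel_weight_integrable 2%N Eq cb.
rewrite /energy -!RintegralZl// -RintegralD//.
- by apply: eq_Rintegral => z _; ring.
- by apply: eq_integrable (integrableZl mb t ia).
- by apply: eq_integrable (integrableZl mb (1 - t) ib).
Qed.

(** If [h] is [t a + (1 - t) b], affinity of the energy and [energy_ge] for [a] and
    [b] give [t * a q ^+ 2 + (1 - t) * b q ^+ 2 <= h q ^+ 2], which forces
    [a q = b q]. *)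
Lemma extreme_of_energy (q : nat -> X) h : (forall i, D (q i)) ->
  (forall x e, D x -> 0 < e -> exists i, ball x e (q i)) ->
  pos_harm h ->
  (forall i e, 0 < e -> exists n, E n (q i) /\ energy n (q i) h <= (h (q i)) ^+ 2 + e) ->
  extreme_points (H1 dom w D x0) h.
Proof.
move=> qD qd ph hmin; split; first exact: pos_harm_H1 EX _ ph.
move=> a b t Ha Hb /andP[t0 t1] hab.
have pa := H1_pos_harm EX Ha; have pb := H1_pos_harm EX Hb.
have ab_q i : a (q i) = b (q i).
  have le0 : t * a (q i) ^+ 2 + (1 - t) * b (q i) ^+ 2 <= h (q i) ^+ 2.
    apply/ler_addgt0Pr => e e0; have [n [Eq hn]] := hmin i e e0.
    apply: le_trans hn; rewrite hab energy_affine// lerD// ler_wpM2l ?energy_ge ?subr_ge0//; exact: ltW.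
  have hq : h (q i) = t * a (q i) + (1 - t) * b (q i) by rewrite {1}hab.
  have : t * (1 - t) * (a (q i) - b (q i)) ^+ 2 <= 0.
    rewrite (_ : _ * _ ^+ 2 = t * a (q i) ^+ 2 + (1 - t) * b (q i) ^+ 2 - h (q i) ^+ 2).
      by rewrite subr_le0.
    by rewrite hq; ring.
  rewrite pmulr_rle0; last by rewrite mulr_gt0// subr_gt0.
  by move=> s0; apply/eqP; rewrite -subr_eq0 -sqrf_eq0 eq_le s0 sqr_ge0.
have ab : a = b.
  apply/funext => x; have [Dx|nDx] := pselect (D x); last first.
    by case: pa pb => _ _ aD [_ _ bD]; rewrite aD// bD.
  have oD := exh_openD EX.
  case: pa pb => ca _ _ [cb _ _].
  rewrite continuous_open_subspace// in ca; rewrite continuous_open_subspace// in cb.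
  have cab : {for x, continuous (a \- b)}.
    by apply: continuousB; [exact: ca (mem_set Dx)|exact: cb (mem_set Dx)].
  apply/eqP; rewrite -subr_eq0 -normr_le0; apply/ler_addgt0Pl => e e0; rewrite addr0.
  have /cvgrPdist_le/(_ _ e0)/nbhs_ballP[d /= d0 dP] := cab.
  have [i qi] := qd x d Dx d0.
  by have := dP _ qi => /=; rewrite (ab_q i) subrr subr0.
have ha : h = a by rewrite hab -ab; apply/funext => x; ring.
by rewrite -ab ha.
Qed.

End energy.

(** * A random positive harmonic function *)
(** A random function with a property almost surely is replaced by one having it
    surely, by using one fixed good value on the exceptional null set. *)
Lemma ae_everywhere d (Om : measurableType d) (R : realType) (Q : probability Om R)
    (X : Type) (D : set X) (h : Om -> X -> R) (p : set (X -> R)) :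
  (\forall y \ae Q, p (h y)) -> (forall x, D x -> measurable_fun setT (h^~ x)) ->
  exists h' : Om -> X -> R, [/\ forall y, p (h' y),
    forall x, D x -> measurable_fun setT (h'^~ x) & \forall y \ae Q, h' y = h y].
Proof.
move=> [N [mN N0 pN]] mh.
have [y0 Ny0] : exists y0, ~ N y0.
  apply: contrapT => NT; have : Q setT = 1%E by exact: probability_setT.
  rewrite (_ : setT = N) ?N0; first by move=> /eqP; rewrite eqe eq_sym oner_eq0.
  by apply/seteqP; split=> // y _; apply: contrapT => Ny; apply: NT; exists y.
have ph y : ~ N y -> p (h y) by move=> Ny; apply: contrapT => /pN.
exists (fun y => if y \in N then h y0 else h y); split=> [y|x Dx|].
- by case: ifPn => [_|/negP Ny]; apply: ph => // Ny'; apply: Ny; exact: mem_set.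
- rewrite (_ : (fun y => _) = (fun y => if y \in N then h y0 x else h y x)); last first.
    by apply/funext => y; case: ifP.
  apply: measurable_fun_ifT => //; last exact: mh.
  apply: (@measurable_fun_bool _ _ _ _ true).
  have -> : (fun y => y \in N) @^-1` [set true] = N.
    by apply/seteqP; split=> y /= => [/set_mem//|]; exact: mem_set.
  exact: measurableI.
- by exists N; split => // y /= hy; apply: contrapT => Ny; apply: hy; rewrite memNset.
Qed.

Section choquet.
Context {R : realType} {X : pmetricType R} (dom : set (set X))
    (w : set X -> X -> {finite_bmeasure X -> \bar R}) (D : set X) (x0 : X)
    (E : nat -> set X).
Hypothesis EX : exhaustion dom w D x0 E.
Local Notation bE n := (boundary (E n)).
Local Notation P n := (w (E n) x0).
Variable k : nat -> X -> X -> R.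
Hypothesis kP : forall n, is_kernel (w (E n)) x0 (E n) (k n).
Local Notation mean_value := (mean_value w x0 E).
Local Notation pos_harm := (pos_harm w D x0 E).
Local Notation energy := (energy w x0 E k).

(** For [y] in [G n] the mean value property of [k n] holds on all smaller domains at
    once. *)
Lemma good_boundary_points : exists G : nat -> set (borel X),
  forall n, [/\ measurable (G n), P n (~` G n) = 0%E &
    forall y m, G n y -> (m < n)%N -> mean_value m ((k n)^~ y)].
Proof.
suff H n : exists G : set (borel X), [/\ measurable G, P n (~` G) = 0%E &
    forall y m, G y -> (m < n)%N -> mean_value m ((k n)^~ y)].
  by have [G GP] := choice H; exists G.
have h m : \forall y \ae P n, (m < n)%N -> mean_value m ((k n)^~ y).
  have [mn|mn] := ltnP m n; last first.
    by exists set0; split; rewrite ?measure0// => y /=; case.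
  have [N [mN N0 NP]] := ae_kernel_mean_value EX kP mn.
  by exists N; split => // y /= h; apply: NP => /= h'; apply: h => _.
move: h => /ae_foralln[N [mN N0 gN]].
exists (~` N); split; rewrite ?setCK//; first exact: measurableC.
by move=> y m Ny mn; apply: contrapT => nmv; apply: Ny; apply: gN => /(_ m mn).
Qed.

Lemma energy_cst1 n q : E n q -> energy n q (cst 1) = \int[P n]_y (k n q y) ^+ 2.
Proof.
move=> Eq; rewrite /energy [LHS]Rintegral_mkcond; apply: eq_Rintegral => y _.
rewrite patchE mulr1; case: ifPn => // /negP yb; rewrite (ker_out (kP n)) ?expr0n//.
by move=> [_ yb']; apply: yb; exact: mem_set.
Qed.

(** The last clause is the only trace left of the construction: a lower bound, for all
    large [n], on the energy of the constant 1 bounds the second moment of [h y q]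
    from below, because that second moment is the ultralimit of these energies. *)
Lemma loeb_representation : exists (d : measure_display) (Om : measurableType d)
    (Q : probability Om R) (h : Om -> X -> R),
  [/\ forall y, pos_harm (h y),
      forall x, D x -> measurable_fun setT (h^~ x),
      forall x, D x -> exists M, forall y, h y x <= M,
      forall x, D x -> \int[Q]_y (h y x) = 1 &
      forall q N c, D q -> (forall n, (N <= n)%N -> c <= energy n q (cst 1)) ->
        c <= \int[Q]_y (h y q) ^+ 2].
Proof.
have [U [UU Uoo]] := ultraFilterLemma (eventually_filter).
have P1 n : P n setT = 1%E := w_setT EX (exh_mem_x0 EX n).
pose Pn n : probability (borel X) R := mkprob (P1 n).
have [G GP] := good_boundary_points.
have mG n : measurable (G n) by case: (GP n).
have G0 n : P n (~` G n) = 0%E by case: (GP n).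
have aeG n : \forall y \ae P n, G n y.
  by exists (~` G n); split => //; exact: measurableC.
(* Cutting off at [G n] makes the kernels bounded by the estimate for functions with
   the mean value property, uniformly in [n]. *)
pose F x n (y : borel X) : R := k n x y * \1_(G n) y.
have mF x n : measurable_fun setT (F x n).
  by apply: measurable_funM; [exact: ker_meas (kP n) x|exact: measurable_indic].
have F0 x n y : 0 <= F x n y by rewrite mulr_ge0// (ker_ge0 (kP n)).
have FM x : D x -> exists M, 0 <= M /\ \forall n \near U, forall y, F x n y <= M.
  move=> Dx; have [m /(_ _ (leqnn m)) Ex] := exh_memP EX Dx.
  have [M [M0 kM]] := mean_value_bounded EX kP Ex; exists M; split => //.
  apply: (Uoo _); exists m.+1 => // n /= mn y; rewrite /F indicE.
  have [Gy|nGy] := pselect (G n y); last by rewrite memNset// mulr0.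
  rewrite mem_set// mulr1; apply: (kM ((k n)^~ y)).
  by case: (GP n) => _ _; apply.
pose Om := g_sigma_algebraType (@measurable _ (loeb_space (borel X) UU)).
pose Q : probability Om R := loeb Pn Uoo.
pose h0 (y : Om) (x : X) : R := if pselect (D x) then ulim_fun (UU := UU) (F x) y else 0.
have h0E x y : D x -> h0 y x = ulim_fun (UU := UU) (F x) y by rewrite /h0; case: pselect.
have h0c x y : D x -> F x n (y n) @[n --> U] --> h0 y x.
  by move=> Dx; have [M [_ xM]] := FM x Dx; rewrite h0E//; exact: (ulim_fun_cvg (F0 x) xM).
have mh0 x : D x -> measurable_fun setT (h0^~ x).
  move=> Dx; have [M [_ xM]] := FM x Dx.
  rewrite (_ : h0^~ x = ulim_fun (UU := UU) (F x)); last by apply/funext => y; rewrite h0E.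
  exact: (measurable_ulim_fun (mF x) (F0 x) xM).
have aeh0 : \forall y \ae Q, pos_harm (h0 y).
  have mGi : measurable (internal U G : set Om) by apply: sub_gen_smallest; exists G.
  exists (~` internal U G); split; first exact: measurableC.
    rewrite probability_setC// /Q/= loebE//.
    rewrite (_ : (fun n => fine (Pn n (G n))) = cst 1).
      by rewrite /ulim lim_cst ?subee//; exact: norm_hausdorff.
    apply/funext => n; have : Pn n (~` G n) = 0%E by exact: G0.
    rewrite probability_setC// -[X in (_ - X)%E]fineK ?fin_num_measure//.
    by rewrite -EFinB => -[] /eqP; rewrite subr_eq0 => /eqP <-.
  move=> y; apply: contra_not => Gy.
  apply: (@pos_harm_limit _ _ _ _ _ _ _ EX _ kP U _ (fun n x => k n x (y n))) => //.
  - move=> m; have mU : U [set n | (m < n)%N] by apply: (Uoo _); exact: nbhs_infty_gt.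
    by apply: filterS2 mU Gy => n mn Gn; case: (GP n) => _ _; apply.
  - move=> x Dx; apply: cvg_trans (h0c x y Dx); apply: near_eq_cvg.
    by apply: filterS Gy => n Gn; rewrite /F indicE mem_set// mulr1.
  - by move=> x nDx; rewrite /h0; case: pselect.
have [h [ph mh hh0]] := ae_everywhere aeh0 mh0.
have intF x j : D x -> \int[Pn n]_y (F x n y ^+ j) @[n --> U] --> \int[Q]_y (h y x ^+ j).
  move=> Dx; have [M [M0 xM]] := FM x Dx.
  have mFj n : measurable_fun setT (fun y => F x n y ^+ j) by exact: measurable_funX.
  have F0j n y : 0 <= F x n y ^+ j by rewrite exprn_ge0.
  have FMj : \forall n \near U, forall y, F x n y ^+ j <= M ^+ j.
    by apply: filterS xM => n FnM y; rewrite lerXn2r// nnegrE.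
  have -> : \int[Q]_y (h y x ^+ j) =
      \int[Q]_y ulim_fun (U := U) (UU := UU) (fun n y => F x n y ^+ j) y.
    congr fine; apply: ae_eq_integral => //.
    + by apply/measurable_EFinP; apply: measurable_funX; exact: mh.
    + by apply/measurable_EFinP; exact: (measurable_ulim_fun mFj F0j FMj).
    apply: filterS hh0 => y -> _; congr EFin.
    have c1 := ulim_fun_cvg (UU := UU) F0j FMj (y := y).
    have c2 : F x n (y n) ^+ j @[n --> U] --> h0 y x ^+ j.
      exact: (cvg_comp _ _ (h0c x y Dx) (@exprn_continuous R j _)).
    exact: (cvg_unique _ c2 c1).
  exact: (@integral_ulim_fun _ _ R U UU Pn Uoo _ _ mFj F0j FMj).
have intFk x j n : E n x -> \int[Pn n]_y (F x n y ^+ j) = \int[P n]_y (k n x y ^+ j).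
  move=> Ex; congr fine; apply: ae_eq_integral => //.
  - by apply/measurable_EFinP; exact: measurable_funX.
  - by apply/measurable_EFinP; apply: measurable_funX; exact: ker_meas (kP n) x.
  by apply: filterS (aeG n) => y Gy _; rewrite /F indicE mem_set// mulr1.
exists _, Om, Q, h; split => //.
- move=> x Dx; have [m /(_ _ (leqnn m)) Ex] := exh_memP EX Dx.
  have [M [M0 kM]] := mean_value_bounded EX kP Ex; exists M => y.
  by apply: kM; case: (ph y) => _ + _; exact.
- move=> x Dx; have c1 := intF x 1%N Dx.
  have c2 : \int[Pn n]_y (F x n y ^+ 1) @[n --> U] --> (1 : R).
    have [m Ex] := exh_memP EX Dx.
    apply: cvg_near_cst; apply: (Uoo _); exists m => // n /= /Ex Enx.
    rewrite intFk//; transitivity (fine (w (E n) x setT)); last by rewrite (w_setT EX).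
    by rewrite (ker_dens (kP n)).
  exact: (cvg_unique _ c1 c2).
- move=> q N c Dq cN; have c1 := intF q 2%N Dq.
  apply: (ler_cvg_to (@cvg_cst R c nat U _) c1).
  have [m Eq] := exh_memP EX Dq.
  apply: (Uoo _); exists (maxn m N) => // n /=; rewrite geq_max => /andP[/Eq Enq Nn].
  by rewrite intFk// -energy_cst1//; exact: cN.
Qed.

End choquet.

(** * Fubini's theorem for random harmonic functions *)
Section random_pos_harm.
Context {R : realType} {X : pmetricType R} (dom : set (set X))
    (w : set X -> X -> {finite_bmeasure X -> \bar R}) (D : set X) (x0 : X)
    (E : nat -> set X).
Hypothesis EX : exhaustion dom w D x0 E.
Local Notation bE n := (boundary (E n)).
Local Notation P n := (w (E n) x0).
Local Notation pos_harm := (pos_harm w D x0 E).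
Context (d : measure_display) (Om : measurableType d) (Q : probability Om R)
  (h : Om -> X -> R).
Hypothesis ph : forall y, pos_harm (h y).
Hypothesis mh : forall x, D x -> measurable_fun setT (h^~ x).
Hypothesis h1 : forall x, D x -> (\int[Q]_y (h y x)%:E = 1)%E.

Lemma random_joint_measurable :
  measurable_fun setT (fun z : borel X * Om => h z.2 z.1).
Proof.
have [q [qD qd]] := exh_dense EX; have oD := exh_openD EX.
apply: (@measurable_caratheodory R X _ Om D q (fun z => h z.2 z.1)) => //.
- by move=> x y nDx; case: (ph y) => _ _; apply.
- move=> x y Dx; case: (ph y) => + _ _; rewrite continuous_open_subspace//.
  by apply; exact: mem_set.
- by move=> i; exact: mh.
Qed.

Let joint n (f : borel X -> R) (z : borel X * Om) : \bar R :=
  (f z.1 * \1_(bE n) z.1 * h z.2 z.1)%:E.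

Let joint_meas n f : measurable_fun setT f -> measurable_fun setT (joint n f).
Proof.
move=> mf; apply/measurable_EFinP; apply: measurable_funM; last exact: random_joint_measurable.
have mb := bd_measurable E n.
by apply: measurable_funM; apply: measurableT_comp => //; exact: measurable_indic.
Qed.

Let joint_ge0 n f z : (forall x, 0 <= f x) -> (0 <= joint n f z)%E.
Proof.
move=> f0; rewrite lee_fin !mulr_ge0//.
by case: (ph z.2) => _ /(_ 0%N)[].
Qed.

Let jointE n f y : (\int[P n]_x joint n f (x, y) =
  \int[P n]_(x in bE n) (f x * h y x)%:E)%E.
Proof.
rewrite [RHS]integral_mkcond; apply: eq_integral => x _.
by rewrite patchE /joint/= indicE; case: ifPn => _; rewrite ?mulr1// mulr0 mul0r.
Qed.

(** Replacing [f] by its restriction to the boundary makes it measurable on the whole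
    space, as needed to apply Fubini's theorem on the product. *)
Let patch_eq n (f : borel X -> R) y :
  (\int[P n]_(x in bE n) (f x * h y x)%:E =
   \int[P n]_(x in bE n) ((f \_ (bE n)) x * h y x)%:E)%E.
Proof. by apply: eq_integral => x xb; rewrite patchE xb. Qed.

Lemma random_measurable n (f : borel X -> R) : measurable_fun (bE n : set (borel X)) f ->
  (forall x, 0 <= f x) ->
  measurable_fun setT (fun y => \int[P n]_(x in bE n) (f x * h y x)%:E)%E.
Proof.
move=> mf f0; have mb := bd_measurable E n.
have mf' : measurable_fun setT (f \_ (bE n) : borel X -> R) by apply/(measurable_restrictT _ _).1.
have f0' x : 0 <= (f \_ (bE n)) x by rewrite patchE; case: ifP.
have := @measurable_fun_fubini_tonelli_G _ _ (borel X) Om R (P n) _ (joint_meas n mf')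
  (fun z => joint_ge0 n z f0').
rewrite /fubini_G => h'; rewrite (_ : (fun y => _) =
  (fun y => \int[P n]_x joint n (f \_ (bE n)) (x, y))%E)//.
by apply/funext => y; rewrite patch_eq jointE.
Qed.

Lemma random_integral n (f : borel X -> R) : measurable_fun (bE n : set (borel X)) f ->
  (forall x, 0 <= f x) ->
  (\int[Q]_y \int[P n]_(x in bE n) (f x * h y x)%:E =
   \int[P n]_(x in bE n) (f x)%:E)%E.
Proof.
move=> mf f0; have mb := bd_measurable E n.
have mf' : measurable_fun setT (f \_ (bE n) : borel X -> R) by apply/(measurable_restrictT _ _).1.
have f0' x : 0 <= (f \_ (bE n)) x by rewrite patchE; case: ifP.
have := @fubini_tonelli _ _ (borel X) Om R (P n) Q _ (joint_meas n mf')
  (fun z => joint_ge0 n z f0').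
under [X in _ = X -> _]eq_integral do rewrite jointE -patch_eq.
move=> <-; rewrite [RHS]integral_mkcond; apply: eq_integral => x _.
rewrite patchE /joint/=; case: ifPn => xb.
  rewrite indicE patchE xb mulr1.
  under eq_integral do rewrite EFinM.
  have Dx : D x by apply: (bd_subD EX) (set_mem xb).
  rewrite ge0_integralZl//.
  - by rewrite h1// mule1.
  - by apply/measurable_EFinP; exact: mh.
  - by move=> y _; rewrite lee_fin; case: (ph y) => _ /(_ 0%N)[].
  - by rewrite lee_fin.
by apply: integral0_eq => y _; rewrite indicE (negbTE xb) mulr0 mul0r.
Qed.

End random_pos_harm.

(** * The constant function 1 as a mean of extreme functions *)
Section choquet_one.
Context {R : realType} {X : pmetricType R} (dom : set (set X))
    (w : set X -> X -> {finite_bmeasure X -> \bar R}) (D : set X) (x0 : X)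
    (E : nat -> set X).
Hypothesis EX : exhaustion dom w D x0 E.
Local Notation bE n := (boundary (E n)).
Local Notation P n := (w (E n) x0).

(** The random function of [loeb_representation] is almost surely extreme. *)
Lemma choquet_one : exists (d : measure_display) (Om : measurableType d)
    (Q : probability Om R) (h : Om -> X -> R),
  [/\ forall y, extreme_points (H1 dom w D x0) (h y),
      forall x, D x -> measurable_fun setT (h^~ x) &
      forall x, D x -> (\int[Q]_y (h y x)%:E = 1)%E].
Proof.
have /choice[k kP] n := exh_is_kernel EX n.
have [d [Om [Q [h [ph mh hM h1 hsq]]]]] := loeb_representation EX kP.
have h0 y x : 0 <= h y x by case: (ph y) => _ /(_ 0%N)[].
have EFin_h (f : Om -> R) M : measurable_fun setT f -> (forall y, 0 <= f y <= M) ->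
    (\int[Q]_y (f y)%:E = (\int[Q]_y f y)%:E)%E.
  move=> mf fM; rewrite fineK//; apply: integrable_fin_num => //.
  by apply: (@integrable_bounded _ _ _ _ _ _ M) => // y _; have /andP[f0 ?] := fM y; rewrite ger0_norm.
have h1E x : D x -> (\int[Q]_y (h y x)%:E = 1)%E.
  move=> Dx; have [M xM] := hM x Dx; rewrite (EFin_h _ M) ?h1//; first exact: mh.
  by move=> y; rewrite h0 xM.
have mb n := bd_measurable E n.
have mk2 n q : measurable_fun (bE n : set (borel X)) (fun z => k n q z ^+ 2).
  by apply: measurable_funX; exact: measurable_funTS (ker_meas (kP n) q).
have k20 n q z : 0 <= k n q z ^+ 2 by exact: sqr_ge0.
have enE n q g : E n q -> {within D, continuous g} ->
    (\int[P n]_(z in bE n) (k n q z ^+ 2 * g z)%:E = (energy w x0 E k n q g)%:E)%E.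
  move=> Eq cg; rewrite fineK//; apply: integrable_fin_num => //.
  exact: (kernel_weight_integrable EX kP 2%N).
have mhq q : D q -> measurable_fun setT (fun y => h y q ^+ 2).
  by move=> Dq; apply: measurable_funX; exact: mh.
have men n q : E n q -> measurable_fun setT (fun y => energy w x0 E k n q (h y)).
  move=> Eq; apply/measurable_EFinP.
  rewrite (_ : _ \o _ = (fun y => \int[P n]_(z in bE n) (k n q z ^+ 2 * h y z)%:E)%E).
    exact: (random_measurable EX ph mh).
  by apply/funext => y /=; rewrite -enE//; case: (ph y).
have ien n q : E n q ->
    (\int[Q]_y (energy w x0 E k n q (h y))%:E = (energy w x0 E k n q (cst 1))%:E)%E.
  move=> Eq; rewrite -enE//; last by apply: continuous_subspaceT => x; exact: cst_continuous.
  under [RHS]eq_integral do rewrite mulr1.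
  rewrite -(random_integral EX ph mh h1E (mk2 n q) (k20 n q)).
  by apply: eq_integral => y _; rewrite -enE//; case: (ph y).
(* On [B] the energy exceeds [h y q ^+ 2] by [e] for all [n >= N].  Averaging over
   [y] gives the second moment plus [e * Q B] as a lower bound for
   [energy n q 1], hence for the second moment itself, so [Q B = 0]. *)
have key q e : D q -> 0 < e -> \forall y \ae Q,
    exists n, E n q /\ energy w x0 E k n q (h y) <= h y q ^+ 2 + e.
  move=> Dq e0; have [N Nq] := exh_memP EX Dq.
  pose A n := [set y | h y q ^+ 2 + e < energy w x0 E k n q (h y)].
  pose B := \bigcap_(n in [set n | (N <= n)%N]) A n.
  have mA n : (N <= n)%N -> measurable (A n).
    move=> Nn; rewrite (_ : A n = setT `&`
        (fun y => energy w x0 E k n q (h y) - (h y q ^+ 2 + e)) @^-1` `]0, +oo[%classic).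
      apply: measurable_funB => //; first exact: men (Nq _ Nn).
      by apply: measurable_funD => //; exact: mhq.
    by rewrite setTI; apply/seteqP; split => y; rewrite /A/= in_itv/= andbT subr_gt0.
  have mB : measurable B by apply: bigcap_measurable => //; exists N => /=.
  have [M xM] := hM q Dq.
  have QBE : ((fine (Q B))%:E = Q B)%E by rewrite fineK ?fin_num_measure.
  have le_energy n : (N <= n)%N ->
      \int[Q]_y h y q ^+ 2 + e * fine (Q B) <= energy w x0 E k n q (cst 1).
    move=> Nn; have Eq := Nq _ Nn; rewrite -lee_fin EFinD EFinM QBE.
    have -> : ((\int[Q]_y h y q ^+ 2)%:E = \int[Q]_y (h y q ^+ 2)%:E)%E.
      apply/esym/(EFin_h (fun y => h y q ^+ 2) (M ^+ 2)) => [|y]; first exact: mhq.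
      apply/andP; split; first exact: sqr_ge0.
      by apply: lerXn2r; rewrite ?nnegrE// (le_trans (h0 y q)).
    have -> : Q B = (\int[Q]_y (\1_B y)%:E)%E by rewrite integral_indic// setIT.
    rewrite -ge0_integralZl//; last 2 first.
      exact/measurable_EFinP/measurable_indic.
      by rewrite lee_fin ltW.
    rewrite -ge0_integralD//; last 4 first.
      by move=> y _; rewrite lee_fin sqr_ge0.
      exact/measurable_EFinP/mhq.
      by move=> y _; rewrite mule_ge0// lee_fin ltW.
      by apply: emeasurable_funM => //; exact/measurable_EFinP/measurable_indic.
    rewrite -ien//; apply: ge0_le_integral => //.
    - by move=> y _; rewrite adde_ge0 ?lee_fin ?sqr_ge0// mulr_ge0// ltW.
    - apply: emeasurable_funD; first exact/measurable_EFinP/mhq.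
      by apply: emeasurable_funM => //; exact/measurable_EFinP/measurable_indic.
    - exact/measurable_EFinP/men.
    - move=> y _; rewrite -EFinM -EFinD lee_fin indicE.
      have [By|nBy] := pselect (B y); last first.
        by rewrite memNset// mulr0 addr0; have hh := energy_ge EX kP (ph y) Eq; exact: hh.
      by rewrite mem_set// mulr1; apply: ltW; exact: By.
  have QB0 : Q B = 0%E.
    have := hsq q N _ Dq le_energy; rewrite gerDl pmulr_rle0// => fB.
    rewrite -QBE; congr EFin; apply/eqP.
    by rewrite eq_le fB fine_ge0.
  exists B; split => // y nex n Nn; rewrite /A/= ltNge; apply/negP => le.
  by apply: nex; exists n; split => //; exact: Nq.
have [q [qD qd]] := exh_dense EX.
have aeE : \forall y \ae Q, extreme_points (H1 dom w D x0) (h y).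
  have hij i j := key (q i) j.+1%:R^-1 (qD i) ltac:(by rewrite invr_gt0).
  have hi i := ae_foralln (hij i).
  have [N [mN N0 NP]] := ae_foralln hi.
  exists N; split => // y nex; apply: NP => /= hy; apply: nex.
  apply: (extreme_of_energy EX kP qD qd (ph y)) => i e e0.
  have [j je] : exists j : nat, j.+1%:R^-1 <= e.
    have /filter_ex[j jP] := near_infty_natSinv_lt (PosNum e0).
    by exists j; exact: ltW.
  have [n [Eq le]] := hy i j; exists n; split => //.
  by rewrite (le_trans le)// lerD2l.
have [h' [ph' mh' hh']] := ae_everywhere aeE mh.
exists d, Om, Q, h'; split => // x Dx.
rewrite -(h1E x Dx); apply: ae_eq_integral => //.
- by apply/measurable_EFinP; exact: mh'.
- by apply/measurable_EFinP; exact: mh.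
- by apply: filterS hh' => y -> _.
Qed.

End choquet_one.

(** * Continuous test functions on metric spaces *)
Lemma locally_uniform_nbhs {R : realType} {X : pmetricType R} (D : set X) (x : X)
    (h : @locally_uniform R X D) e :
  D x -> 0 < e -> nbhs h [set g : X -> R | `|h x - g x| < e].
Proof.
move=> Dx e0; pose fam (K : set X) := compact K /\ K `<=` D.
have fx : fam [set x] by split; [exact: compact_set1|move=> _ ->].
have entE : entourage [set z : R * R | `|z.1 - z.2| < e] by exists e.
have H := @fam_nbhs X R fam [set x] _ h entE fx.
by apply: (@filterS _ _ (nbhs_filter h) _ _ _ H) => g /(_ x erefl).
Qed.

(** Evaluations are continuous for locally uniform convergence. *)
Lemma evaluation_measurable {R : realType} {X : pmetricType R} (D : set X) (x : X) :
  D x -> measurable_fun setT ((fun h => h x) : borel (@locally_uniform R X D) -> R).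
Proof.
move=> Dx; apply: (measurability _ (RGenOpens.measurableE R)) => _ [_ [a [b ->] <-]].
rewrite setTI; apply: sub_gen_smallest; rewrite openE => h /=.
rewrite in_itv/= => /andP[ah hb]; rewrite /interior.
have e0 : 0 < Num.min (h x - a) (b - h x) by rewrite lt_min !subr_gt0 ah hb.
have H := locally_uniform_nbhs h Dx e0.
apply: (@filterS _ _ (nbhs_filter _) _ _ _ H) => g /=.
rewrite lt_min !ltr_norml in_itv/= => /andP[/andP[h1 h2] /andP[h3 h4]].
by apply/andP; split; lra.
Qed.

(** The indicator of an open set is the increasing limit of the functions
    [min 1 (j * dist)], where [dist] is the distance to the complement; open sets
    generate the Borel sets and are stable under intersection. *)
Lemma measure_eq_continuous {R : realType} {T : pmetricType R}
    (m1 m2 : {measure set (borel T) -> \bar R}) : (m1 setT < +oo)%E ->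
  (forall f : T -> R, continuous f -> (forall x, 0 <= f x <= 1) ->
    (\int[m1]_x (f x)%:E = \int[m2]_x (f x)%:E)%E) ->
  forall A : set (borel T), measurable A -> m1 A = m2 A.
Proof.
move=> m1oo m12.
have mT : m1 setT = m2 setT.
  have mI (m : {measure set (borel T) -> \bar R}) :
      m setT = (\int[m]_x (cst 1 x)%:E)%E.
    by rewrite (eq_integral (cst 1%E))// integral_cst// mul1e.
  rewrite !mI; apply: m12; first by move=> x; exact: cst_continuous.
  by move=> x /=; rewrite ler01 lexx.
suff opn (O : set T) : open O -> m1 O = m2 O.
  apply: (@measure_unique _ _ (borel T) (@open T) (fun=> setT)) => //.
  - by move=> A B; exact: openI.
  - by move=> i; exact: openT.
  - by apply/seteqP; split => // x _; exists 0%N.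
move=> oO; have [CO0|/set0P CO] := eqVneq (~` O) set0.
  by rewrite (_ : O = setT)//; rewrite -(setCK O) CO0 setC0.
have mO : measurable (O : set (borel T)) by exact: open_borel.
have cO : closed (~` O) by exact: open_closedC.
pose f j (x : T) : R := Num.min 1 (j%:R * dist_set (~` O) x).
have d0 := dist_set_ge0 (~` O).
have f01 j x : 0 <= f j x <= 1.
  by rewrite /f le_min ler01 mulr_ge0//= ge_min lexx.
have cf j : continuous (f j).
  move=> x; apply: (@continuous_min R T (cst 1) (fun x => j%:R * dist_set (~` O) x) x).
    exact: cst_continuous.
  by apply: continuousM; [exact: cst_continuous|exact: dist_set_continuous].
have mf j : measurable_fun setT (EFin \o f j : borel T -> \bar R).
  apply/measurable_EFinP; apply: within_continuous_borel => //.
  exact: continuous_subspaceT (cf j).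
have fO x : (EFin \o f j) x @[j --> \oo] --> (\1_O x)%:E.
  apply: cvg_EFin; first by apply: nearW.
  apply: cvg_near_cst; rewrite indicE.
  have [Ox|nOx] := pselect (O x); last first.
    apply: nearW => j; rewrite memNset//= /f.
    have /(dist_set_eq0 x cO CO).2 -> : (~` O) x by [].
    by rewrite mulr0 min_r.
  rewrite mem_set//=.
  have dx : 0 < dist_set (~` O) x.
    rewrite lt_neqAle d0 andbT eq_sym; apply/eqP => /(dist_set_eq0 x cO CO).
    by apply.
  exists (Num.truncn (dist_set (~` O) x)^-1).+1 => // j /= jd.
  apply/min_idPl; rewrite -ler_pdivrMr// div1r; apply: ltW.
  by apply: lt_le_trans (truncnS_gt _) _; rewrite ler_nat.
have ndf x : {homo (fun j => (f j x)%:E) : n m / (n <= m)%N >-> (n <= m)%E}.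
  move=> n m nm; rewrite lee_fin /f le_min ge_min lexx/= ge_min.
  by apply/orP; right; rewrite ler_wpM2r// ler_nat.
have cv (m : {measure set (borel T) -> \bar R}) :
    (\int[m]_x (f j x)%:E)%E @[j --> \oo] --> m O.
  have -> : m O = (\int[m]_x (\1_O x)%:E)%E by rewrite integral_indic// setIT.
  have E0 : (fun x => (\1_O x)%:E) = (fun x : borel T => limn (fun j => (f j x)%:E)).
    by apply/funext => x; apply/esym/cvg_lim => //; exact: fO.
  rewrite [X in _ --> (\int[m]_x X x)%E](_ : _ = (fun x : borel T => limn (fun j => (f j x)%:E)))//.
  apply: cvg_monotone_convergence => //.
  by move=> n x _; rewrite lee_fin; case/andP: (f01 n x).
have c1 := cv m1; have c2 := cv m2.
have E12 : (fun j => \int[m1]_x (f j x)%:E)%E = (fun j => \int[m2]_x (f j x)%:E)%E.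
  by apply/funext => j; apply: m12.
rewrite E12 in c1; exact: (cvg_unique (@ereal_hausdorff R) c1 c2).
Qed.

(** An open set is where the truncated distance to its complement is positive. *)
Lemma measurable_of_tests {R : realType} {T : pmetricType R} d (Om : measurableType d)
    (xi : Om -> T) :
  (forall f : T -> R, continuous f -> (forall x, 0 <= f x <= 1) ->
     measurable_fun setT (f \o xi)) ->
  measurable_fun setT (xi : Om -> borel T).
Proof.
move=> mxi; apply: (@measurability _ _ Om (borel T) setT xi (@open T)) => //.
move=> _ [] O oO <-; rewrite setTI.
have [CO0|/set0P CO] := eqVneq (~` O) set0.
  rewrite (_ : O = setT); first by rewrite preimage_setT; exact: measurableT.
  by rewrite -(setCK O) CO0 setC0.
have cO : closed (~` O) by exact: open_closedC.
pose f (x : T) : R := Num.min 1 (dist_set (~` O) x).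
have f01 x : 0 <= f x <= 1.
  by rewrite /f le_min ler01 dist_set_ge0//= ge_min lexx.
have cf : continuous f.
  move=> x; apply: (@continuous_min R T (cst 1) (dist_set (~` O)) x).
    exact: cst_continuous.
  exact: dist_set_continuous.
have f0 x : 0 < f x <-> O x.
  rewrite /f lt_min ltr01/=; split=> [d0|Ox].
    apply: contrapT => nOx; move: d0.
    by rewrite (dist_set_eq0 x cO CO).2// ltxx.
  rewrite lt_neqAle dist_set_ge0 andbT eq_sym; apply/eqP => /(dist_set_eq0 x cO CO).
  by apply.
rewrite (_ : _ @^-1` _ = setT `&` (f \o xi) @^-1` `]0, +oo[%classic).
  exact: mxi.
by rewrite setTI; apply/seteqP; split => y /=; rewrite in_itv/= andbT f0.
Qed.

(** * The boundary measure of the constant function 1 *)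
Lemma dominated_Rintegral_cvg d (T : measurableType d) (R : realType)
    (mu : {finite_measure set T -> \bar R}) (f_ : nat -> T -> R) (f : T -> R) (M : R) :
  (forall n, measurable_fun setT (f_ n)) -> (forall n t, `|f_ n t| <= M) ->
  (forall t, f_ n t @[n --> \oo] --> f t) ->
  \int[mu]_t f_ n t @[n --> \oo] --> \int[mu]_t f t.
Proof.
move=> mf fM ff.
have mff : measurable_fun setT f by apply: (measurable_fun_cvg mf) => t _; exact: ff.
have fM' t : `|f t| <= M.
  by apply: (ler_cvg_to (cvg_norm (ff t)) (@cvg_cst R M nat \oo _)); exact: nearW.
have iM : mu.-integrable setT (EFin \o cst M).
  by apply: (@integrable_bounded _ _ _ _ _ _ `|M|) => // t _ /=.
have fin : (\int[mu]_t (f t)%:E)%E \is a fin_num.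
  by apply: integrable_fin_num => //; exact: (@integrable_bounded _ _ _ _ _ _ M).
apply: fine_cvg; rewrite fineK//.
apply: (@dominated_cvg _ _ _ _ _ _ (fun n t => (f_ n t)%:E) _ (EFin \o cst M)) => //.
- by move=> n; apply/measurable_EFinP.
- by move=> t _; apply: cvg_EFin; [exact: nearW|exact: ff].
- by move=> n t _ /=; rewrite lee_fin.
Qed.

Section image_measure.
Context d1 d2 (T1 : measurableType d1) (T2 : measurableType d2) (R : realType).
Variables (m : {measure set T1 -> \bar R}) (f : T1 -> T2).
Hypothesis mf : measurable_fun setT f.

Definition image_measure : set T2 -> \bar R := let _ := mf in pushforward m f.

Let image0 : image_measure set0 = 0%E. Proof. exact: measure0. Qed.

Let image_ge0 A : (0 <= image_measure A)%E. Proof. exact: measure_ge0. Qed.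

Let image_sigma_additive : semi_sigma_additive image_measure.
Proof. exact: measure_semi_sigma_additive. Qed.

HB.instance Definition _ := isMeasure.Build _ _ _ image_measure
  image0 image_ge0 image_sigma_additive.

Lemma ge0_integral_image (D : set T2) (g : T2 -> \bar R) :
  measurable D -> measurable_fun D g -> (forall y, D y -> (0 <= g y)%E) ->
  (\int[image_measure]_(y in D) g y = \int[m]_(x in f @^-1` D) g (f x))%E.
Proof.
move=> mD mg g0; apply: (ge0_integral_pushforward mf m mD mg).
by move=> y /set_mem; exact: g0.
Qed.

End image_measure.

Section boundary_measure.
Context {R : realType} {X : pmetricType R} (dom : set (set X))
    (w : set X -> X -> {finite_bmeasure X -> \bar R}) (D : set X) (x0 : X)
    (E : nat -> set X).
Hypothesis EX : exhaustion dom w D x0 E.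
Local Notation bE n := (boundary (E n)).
Local Notation P n := (w (E n) x0).
Context (T : pmetricType R) (i : X -> T) (bm : set T) (kappa : T -> X -> R).
Hypothesis ci : {within D, continuous i}.
Hypothesis mbm : measurable (bm : set (borel T)).
Hypothesis mkappa : measurable_fun (bm : set (borel T))
    (kappa : borel T -> borel (@locally_uniform R X D)).
Hypothesis bij_kappa : set_bij bm (extreme_points (H1 dom w D x0)) kappa.
Hypothesis kappa_weak : forall eta, bm eta ->
  forall f : T -> R, continuous f -> (forall x, 0 <= f x <= 1) ->
  \int[P n]_(y in bE n) (f (i y) * kappa eta y) @[n --> \oo] --> f eta.
Context (mu : {measure set (borel T) -> \bar R}).
Hypothesis mu_fin : (mu setT < +oo)%E.
Hypothesis mu_weak : forall f : T -> R, continuous f -> (forall x, 0 <= f x <= 1) ->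
  \int[P n]_(y in bE n) f (i y) @[n --> \oo] --> \int[mu]_z f z.

Lemma kappa_measurable x : D x -> measurable_fun (bm : set (borel T)) (kappa ^~ x).
Proof.
move=> Dx; exact: (measurableT_comp (evaluation_measurable Dx) mkappa).
Qed.

(** The law of the pole [xi] of the random extreme function is [mu]: both integrate a
    continuous [f] to the limit of its integrals over the boundaries. *)
Lemma boundary_measure_carried :
  mu (~` bm) = 0%E /\ forall x, D x -> (\int[mu]_(eta in bm) (kappa eta x)%:E = 1)%E.
Proof.
have [d [Om [Q [h [ph mh h1]]]]] := choquet_one EX.
have H1h y : H1 dom w D x0 (h y) by case: (ph y).
have pph y : pos_harm w D x0 E (h y) by exact: H1_pos_harm EX _ (H1h y).
have h0 y x : 0 <= h y x by case: (pph y) => _ /(_ 0%N)[].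
have /choice[xi xiP] y : exists eta, bm eta /\ kappa eta = h y.
  by case: bij_kappa => _ _ /(_ _ (ph y))[eta beta <-]; exists eta.
have mi n (f : T -> R) : continuous f -> measurable_fun (bE n : set (borel X)) (f \o i).
  move=> cf; apply: (contD_meas EX).
  by apply: within_continuous_comp => // x _; exact: cf.
(* For fixed [y] the numbers [J f n y] converge to [f (xi y)], since [h y] is
   [kappa (xi y)]; averaged over [y] they are the integrals of [f] against
   [P n]. *)
pose J (f : T -> R) n y := \int[P n]_(x in bE n) (f (i x) * h y x).
have JE (f : T -> R) n y : continuous f -> (forall x, 0 <= f x <= 1) ->
    ((J f n y)%:E = \int[P n]_(x in bE n) (f (i x) * h y x)%:E)%E /\ 0 <= J f n y <= 1.
  move=> cf f01; have [ch mvh _] := pph y.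
  have mhn := contD_meas EX (n := n) ch; have mb := bd_measurable E n.
  have le1 : (\int[P n]_(x in bE n) (f (i x) * h y x)%:E <= 1)%E.
    rewrite -(mean_value_P EX (mvh n)); apply: ge0_le_integral => //.
    - by move=> x _; rewrite lee_fin mulr_ge0//; case/andP: (f01 (i x)).
    - by apply/measurable_EFinP; apply: measurable_funM => //; exact: mi.
    - exact/measurable_EFinP.
    - by move=> x _; rewrite lee_fin ler_piMl//; case/andP: (f01 (i x)).
  have ge0 : (0 <= \int[P n]_(x in bE n) (f (i x) * h y x)%:E)%E.
    by apply: integral_ge0 => x _; rewrite lee_fin mulr_ge0//; case/andP: (f01 (i x)).
  have fin : (\int[P n]_(x in bE n) (f (i x) * h y x)%:E)%E \is a fin_num.
    by rewrite ge0_fin_numE// (le_lt_trans le1)// ltry.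
  by rewrite fineK// -!lee_fin fineK// ge0 le1.
have mJ (f : T -> R) n : continuous f -> (forall x, 0 <= f x <= 1) -> measurable_fun setT (J f n).
  move=> cf f01; apply/measurable_EFinP.
  rewrite (_ : _ \o _ = (fun y => \int[P n]_(x in bE n) (f (i x) * h y x)%:E)%E).
    apply: (random_measurable EX pph mh (f := f \o i)); first exact: mi.
    by move=> x; case/andP: (f01 (i x)).
  by apply/funext => y /=; rewrite (JE f n y cf f01).1.
have J_xi (f : T -> R) y : continuous f -> (forall x, 0 <= f x <= 1) ->
    J f n y @[n --> \oo] --> f (xi y).
  move=> cf f01; have [bxi kxi] := xiP y.
  by have := kappa_weak bxi cf f01; rewrite kxi.
have mxi : measurable_fun setT (xi : Om -> borel T).
  apply: measurable_of_tests => f cf f01.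
  by apply: (measurable_fun_cvg (fun n => mJ f n cf f01)) => y _; exact: J_xi.
have intJ (f : T -> R) n : continuous f -> (forall x, 0 <= f x <= 1) ->
    \int[Q]_y J f n y = \int[P n]_(x in bE n) f (i x).
  move=> cf f01; congr fine.
  rewrite -(random_integral EX pph mh h1 (f := f \o i)); first last.
  - by move=> x; case/andP: (f01 (i x)).
  - exact: mi.
  - by apply: eq_integral => y _; rewrite (JE f n y cf f01).1.
have int_xi (f : T -> R) : continuous f -> (forall x, 0 <= f x <= 1) ->
    \int[Q]_y f (xi y) = \int[mu]_z f z.
  move=> cf f01.
  have c1 : \int[Q]_y J f n y @[n --> \oo] --> \int[Q]_y f (xi y).
    apply: (dominated_Rintegral_cvg (M := 1)) => [n|n y|y].
    - exact: mJ.
    - by case: (JE f n y cf f01) => _ /andP[J0 J1]; rewrite ger0_norm.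
    - exact: J_xi.
  have c2 := mu_weak cf f01.
  rewrite (_ : (fun n => _) = (fun n => \int[P n]_(x in bE n) f (i x))) in c1.
    exact: (cvg_unique _ c1 c2).
  by apply/funext => n; exact: intJ.
pose nu := image_measure Q mxi.
have Emu (A : set (borel T)) : measurable A -> nu A = mu A.
  apply: (@measure_eq_continuous _ _ nu mu).
    by rewrite /nu /= /image_measure /pushforward preimage_setT probability_setT ltry.
  move=> f cf f01.
  have f0 x : (0 <= (f x)%:E)%E by rewrite lee_fin; case/andP: (f01 x).
  have mf : measurable_fun setT (f : borel T -> R).
    by apply: within_continuous_borel => //; exact: continuous_subspaceT.
  have mfE : measurable_fun setT (EFin \o (f : borel T -> R)) by exact/measurable_EFinP.
  rewrite ge0_integral_image// preimage_setT.
  have bnd : (\int[mu]_x (f x)%:E)%E \is a fin_num.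
    rewrite ge0_fin_numE ?integral_ge0//.
    apply: le_lt_trans mu_fin; rewrite -[leRHS]mul1e -integral_cst//.
    by apply: ge0_le_integral => // x _; rewrite lee_fin; case/andP: (f01 x).
  rewrite -[RHS]fineK//; have := int_xi f cf f01; rewrite /Rintegral => <-.
  rewrite fineK//; apply: integrable_fin_num => //.
  apply: (@integrable_bounded _ _ _ _ _ _ 1) => //.
    exact: (measurableT_comp mf mxi).
  by move=> y _; case/andP: (f01 (xi y)) => ? ?; rewrite ger0_norm.
split=> [|x Dx].
  rewrite -Emu; last exact: measurableC.
  rewrite /nu /image_measure /pushforward (_ : _ @^-1` _ = set0) ?measure0//.
  by apply/seteqP; split => // y; case: (xiP y).
have mkx := kappa_measurable Dx.
rewrite -(eq_measure_integral mu (m1 := nu)); last by move=> A mA _; exact: Emu.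
rewrite ge0_integral_image//; last 2 first.
- exact/measurable_EFinP.
- move=> eta beta; rewrite lee_fin; case: bij_kappa => /(_ _ beta)[[_ k0 _ _] _] _ _.
  exact/ltW/k0.
rewrite (_ : _ @^-1` _ = setT); last by apply/seteqP; split => // y _; case: (xiP y).
rewrite -(h1 x Dx); apply: eq_integral => y _ /=.
by have [_ ->] := xiP y.
Qed.

End boundary_measure.

(** * Integrals of functions equal almost everywhere to a Borel function *)
Section ae_nonmeasurable.
Context d (T : measurableType d) (R : realType) (mu : {measure set T -> \bar R}).
Local Open Scope ereal_scope.
Import HBNNSimple.

Let nnintegral (f : T -> \bar R) : \bar R :=
  ereal_sup [set sintegral mu h | h in [set h : {nnsfun T >-> R} | forall x, (h x)%:E <= f x]].

Let le_nnintegral_negligible (F G : T -> \bar R) (N : set T) :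
  measurable N -> mu N = 0 -> (forall t, 0 <= G t) ->
  (forall t, ~ N t -> F t <= G t) -> nnintegral F <= nnintegral G.
Proof.
move=> mN N0 G0 FG; apply: ge_ereal_sup => _ [h hF <-].
pose h' := mul_nnsfun h (indic_nnsfun R (measurableC mN)).
have h'E t : (h' t = h t * \1_(~` N) t)%R by [].
apply: ereal_sup_ubound; exists h' => [t|].
  rewrite h'E indicE; have [Nt|nNt] := pselect (N t).
    by rewrite memNset ?mulr0// => /(_ Nt).
  by rewrite mem_set// mulr1; apply: le_trans (FG _ nNt); exact: hF.
rewrite -!integralT_nnsfun; apply: ae_eq_integral => //.
- exact/measurable_EFinP.
- exact/measurable_EFinP.
exists N; split => // t; apply: contra_notP => nNt _.
by rewrite h'E indicE mem_set// mulr1.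
Qed.

(** The integrands may fail to be measurable, as do the functions that are integrable
    for a completed measure.  The integral is still a supremum of integrals of simple
    functions below the integrand, and setting these to 0 on a null set does not
    change their integrals. *)
Lemma integral_ae_eq_any (B : set T) (f g : T -> \bar R) : ae_eq mu B f g ->
  \int[mu]_(x in B) f x = \int[mu]_(x in B) g x.
Proof.
case=> N [mN N0 fgN].
have fg t : ~ N t -> (f \_ B) t = (g \_ B) t.
  move=> nNt; rewrite !patchE; case: ifPn => // tB.
  by apply: contrapT => fgt; apply: nNt; apply: fgN => /(_ (set_mem tB)).
rewrite /integral; change (nnintegral (f \_ B)^\+ - nnintegral (f \_ B)^\- =
  nnintegral (g \_ B)^\+ - nnintegral (g \_ B)^\-).
congr (_ - _); apply/eqP; rewrite eq_le; apply/andP; split.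
all: apply: (le_nnintegral_negligible mN N0) => [t|t nNt].
all: rewrite ?(funepos_ge0, funeneg_ge0)//.
all: by rewrite ?funeposE ?funenegE fg.
Qed.

End ae_nonmeasurable.

(** * Measures with a density *)
Section density_measure.
Context d (T : measurableType d) (R : realType) (mu : {measure set T -> \bar R}).
Variable k : T -> R.
Hypothesis mk : measurable_fun setT k.
Hypothesis k0 : forall t, 0 <= k t.

(** The hypotheses on [k] are arguments so that the measure structure can be inferred
    from the term. *)
Definition density_measure : set T -> \bar R :=
  let _ := mk in let _ := k0 in fun A => (\int[mu]_(t in A) (k t)%:E)%E.

Let density0 : density_measure set0 = 0%E. Proof. exact: integral_set0. Qed.

Let density_ge0 A : (0 <= density_measure A)%E.
Proof. by apply: integral_ge0 => t _; rewrite lee_fin. Qed.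

Let density_sigma_additive : semi_sigma_additive density_measure.
Proof.
move=> F mF tF mUF; rewrite /density_measure ge0_integral_bigcup//.
- by apply: is_cvg_nneseries => n _ _; exact: density_ge0.
- by apply/measurable_EFinP; exact: measurable_funTS.
- by move=> t _; rewrite lee_fin.
Qed.

HB.instance Definition _ := isMeasure.Build _ _ _ density_measure
  density0 density_ge0 density_sigma_additive.

End density_measure.

(** * Radon measures on compact spaces *)
Section regularity.
Context {R : realType} {T : ptopologicalType} (mu : {measure set (borel T) -> \bar R}).
Hypothesis cT : compact [set: T].
Hypothesis muT : (mu setT < +oo)%E.
Hypothesis closed_Gdelta : forall C : set T, closed C ->
  exists O : nat -> set T, (forall n, open (O n)) /\ C = \bigcap_n O n.

(** Regularity of one Borel set; this property is stable under complements and
    countable unions, and holds for closed sets when these are countable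
    intersections of open sets. *)
Definition sandwiched (A : set (borel T)) : Prop := forall e : R, 0 < e ->
  exists C O : set T, [/\ closed C, open O, C `<=` A, A `<=` O & (mu (O `\` C) <= e%:E)%E].

Let mu_fin (A : set (borel T)) : measurable A -> (mu A < +oo)%E.
Proof.
move=> mA; apply: le_lt_trans muT.
apply: le_measure; [exact: mem_set mA|exact: mem_set measurableT|exact: subsetT].
Qed.

Lemma sandwiched_closed (C : set T) : closed C -> sandwiched C.
Proof.
move=> cC e e0; case: (closed_Gdelta cC) => O [oO CO].
pose V n := \bigcap_(j < n.+1) O j.
have oV n : open (V n).
  by rewrite /V bigcap_mkord; apply: big_ind => //; [exact: openT|exact: openI].
have CV n : C `<=` V n by rewrite CO => x Cx j _; exact: Cx.
have mV n : measurable (V n `\` C : set (borel T)).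
  by apply: measurableD; [exact: open_borel|exact: closed_borel].
have V0 : \bigcap_n (V n `\` C) = set0.
  apply/seteqP; split => // x Vx; have [_ nCx] := Vx 0%N Logic.I.
  by apply: nCx; rewrite CO => n _; have [+ _] := Vx n Logic.I; apply => /=.
have := @nonincreasing_cvg_mu _ _ _ mu (fun n => V n `\` C : set (borel T)).
rewrite V0 measure0 => cv.
have {cv}: mu (V n `\` C) @[n --> \oo] --> 0%E.
  apply: cv => //; first exact: mu_fin.
  move=> n m nm; apply/subsetPset => x [Vx nC]; split => // j /= jn.
  by apply: Vx => /=; exact: leq_trans jn _.
move=> /fine_cvgP[_ /cvgr0Pnorm_le/(_ _ e0)] /filter_ex[n le].
exists C, (V n); split => //.
rewrite -(fineK (x := mu _)) ?ge0_fin_numE//; last exact: mu_fin.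
by rewrite lee_fin (le_trans (ler_norm _)).
Qed.

Lemma sandwiched_setC A : sandwiched A -> sandwiched (~` A).
Proof.
move=> sA e e0; case: (sA e e0) => C [] O [cC oO CA AO le].
exists (~` O), (~` C); split.
- exact: open_closedC.
- exact: closed_openC.
- exact: subsetC.
- exact: subsetC.
- by rewrite setDE setCK setIC -setDE.
Qed.

Lemma sandwiched_bigcup (A : nat -> set (borel T)) :
  (forall n, sandwiched (A n)) -> sandwiched (\bigcup_n A n).
Proof.
move=> sA e e0.
have e40 n : 0 < e / 2 / (2 ^ n.+1)%:R by rewrite !divr_gt0// ltr0n expn_gt0.
have /choice[CO COP] n : exists CO : set T * set T,
    [/\ closed CO.1, open CO.2, CO.1 `<=` A n, A n `<=` CO.2 &
      (mu (CO.2 `\` CO.1) <= (e / 2 / (2 ^ n.+1)%:R)%:E)%E].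
  by case: (sA n _ (e40 n)) => C [] O COP; exists (C, O).
pose C n := (CO n).1; pose O n := (CO n).2.
have cC n : closed (C n) by case: (COP n).
have oO n : open (O n) by case: (COP n).
have CA n : C n `<=` A n by case: (COP n).
have AO n : A n `<=` O n by case: (COP n).
have leCO n : (mu (O n `\` C n) <= (e / 2 / (2 ^ n.+1)%:R)%:E)%E by case: (COP n).
pose W n := \bigcup_(j < n.+1) C j.
have cW n : closed (W n).
  rewrite /W bigcup_mkord; apply: big_ind => //; [exact: closed0|exact: closedU].
have mW n : measurable (W n : set (borel T)) by exact: closed_borel.
have mO n : measurable (O n : set (borel T)) by exact: open_borel.
have mC n : measurable (C n : set (borel T)) by exact: closed_borel.
have mUO : measurable (\bigcup_n O n : set (borel T)) by exact: bigcup_measurable.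
have mUC : measurable (\bigcup_n C n : set (borel T)) by exact: bigcup_measurable.
have le1 : (mu (\bigcup_n O n `\` \bigcup_n C n) <= (e / 2)%:E)%E.
  apply: (@le_trans _ _ (mu (\bigcup_n (O n `\` C n)))).
    apply: le_measure; [by apply: mem_set; exact: measurableD|apply: mem_set|].
      by apply: bigcup_measurable => n _; exact: measurableD.
    move=> x [[n _ Ox] nC]; exists n => //; split => // Cx; apply: nC; by exists n.
  have mOC n : measurable (O n `\` C n : set (borel T)) by exact: measurableD.
  have mUOC : measurable (\bigcup_n (O n `\` C n) : set (borel T)) by exact: bigcup_measurable.
  apply: le_trans (measure_sigma_subadditive mu mOC mUOC (@subset_refl _ _)) _.
  apply: le_trans; first by apply: lee_nneseries => // n _; exact: leCO.
  apply: epsilon_trick0.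
  by apply: ltW; rewrite divr_gt0.
have [n le2] : exists n, (mu (\bigcup_n C n `\` W n) <= (e / 2)%:E)%E.
  have V0 : \bigcap_n (\bigcup_n C n `\` W n) = set0.
    apply/seteqP; split => // x Vx; have [[n _ Cx] _] := Vx 0%N Logic.I.
    by have [_] := Vx n Logic.I; apply; exists n => /=.
  have := @nonincreasing_cvg_mu _ _ _ mu (fun n => \bigcup_n C n `\` W n : set (borel T)).
  rewrite V0 measure0 => cv.
  have mD n : measurable (\bigcup_n C n `\` W n : set (borel T)) by exact: measurableD.
  have {cv}: mu (\bigcup_n C n `\` W n) @[n --> \oo] --> 0%E.
    apply: cv => //; first exact: mu_fin.
    move=> n m nm; apply/subsetPset => x [Vx nC]; split => // -[j /= jn Cx].
    by apply: nC; exists j => //=; exact: leq_trans jn _.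
  have e20 : 0 < e / 2 by rewrite divr_gt0.
  move=> /fine_cvgP[_ /cvgr0Pnorm_le/(_ _ e20)] /filter_ex[n le]; exists n.
  rewrite -(fineK (x := mu _)) ?ge0_fin_numE//; last exact: mu_fin.
  by rewrite lee_fin (le_trans (ler_norm _)).
exists (W n), (\bigcup_n O n); split => //.
- by apply: bigcup_open => j _; exact: oO.
- by move=> x [j _ /CA Ax]; exists j.
- by move=> x [j _ /AO Ox]; exists j.
apply: (@le_trans _ _ (mu ((\bigcup_n O n `\` \bigcup_n C n) `|` (\bigcup_n C n `\` W n)))).
  apply: le_measure; [by apply: mem_set; exact: measurableD|apply: mem_set|].
    by apply: measurableU; exact: measurableD.
  move=> x [Ox nW]; have [Cx|nC] := pselect ((\bigcup_n C n) x); first by right.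
  by left.
apply: le_trans (measureU2 _ _ _) _; [exact: measurableD|exact: measurableD|].
by rewrite [e in leRHS]splitr EFinD leeD.
Qed.

Lemma sandwiched_measurable (A : set (borel T)) : measurable A -> sandwiched A.
Proof.
move: A; apply: smallest_sub => [|O oO]; last first.
  rewrite -(setCK O); apply: sandwiched_setC; apply: sandwiched_closed.
  exact: open_closedC.
split.
- exact: sandwiched_closed closed0.
- by move=> A sA; rewrite setTD; exact: sandwiched_setC.
- exact: sandwiched_bigcup.
Qed.

Lemma radon_compact : hausdorff_space T -> radon mu.
Proof.
move=> hT; split; first by move=> x; exists setT; split => //; exact: openT.
move=> A mA; apply/eqP; rewrite eq_le; apply/andP; split; last first.
  apply: ge_ereal_sup => _ [B [cB BA] <-].
  apply: le_measure => //; apply: mem_set => //.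
  by apply: closed_borel; exact: compact_closed hT cB.
apply/lee_addgt0Pr => e e0.
case: (sandwiched_measurable mA e0) => C [] O [cC oO CA AO le].
have mC := closed_borel cC.
have mOC : measurable (O `\` C : set (borel T)) by apply: measurableD => //; exact: open_borel.
apply: (@le_trans _ _ (mu (C `|` (O `\` C)))).
  apply: le_measure; [exact: mem_set|by apply: mem_set; exact: measurableU|].
  by move=> x /AO Ox; have [Cx|nC] := pselect (C x); [left|right].
apply: le_trans (measureU2 mu mC mOC) _; apply: leeD => //.
apply: ereal_sup_ubound; exists C => //; split => //.
exact: subclosed_compact cC cT _.
Qed.

End regularity.

(** * Joins of compactifications *)
Lemma prod_hausdorff (T1 T2 : topologicalType) :
  hausdorff_space T1 -> hausdorff_space T2 -> hausdorff_space (T1 * T2)%type.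
Proof.
move=> h1 h2 [p1 p2] [q1 q2] pq; congr pair; [apply: h1 => A B nA nB|apply: h2 => A B nA nB].
  have [||[x y] [/= Ax Bx]] := pq (A `*` setT) (B `*` setT); last by exists x; case: Ax; case: Bx.
    by exists (A, setT) => //; split => //; exact: filterT.
  by exists (B, setT) => //; split => //; exact: filterT.
have [||[x y] [/= Ax Bx]] := pq (setT `*` A) (setT `*` B); last by exists y; case: Ax; case: Bx.
  by exists (setT, A) => //; split => //; exact: filterT.
by exists (setT, B) => //; split => //; exact: filterT.
Qed.

Lemma sigma_compact_image_borel (S : topologicalType) (T : ptopologicalType)
    (j : S -> T) (D : set S) (K : nat -> set S) :
  hausdorff_space T -> {within D, continuous j} -> D = \bigcup_n K n ->
  (forall n, compact (K n)) -> measurable (j @` D : set (borel T)).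
Proof.
move=> hT cj DK cK; rewrite DK image_bigcup; apply: bigcup_measurable => n _.
apply: closed_borel; apply: compact_closed => //.
apply: continuous_compact => //; apply: continuous_subspaceW cj.
by rewrite DK => x Kx; exists n.
Qed.

Section join.
Context {R : realType} {X TG TK : pmetricType R} (D : set X).

(** In a compactification the points of [D] have the neighbourhoods they have in [D];
    hence if points of [D] approach [i1 x] in the first space, they approach [x] in
    [D], and their images under [i2] approach [i2 x]. *)
Lemma embedding_converges (T1 T2 : pmetricType R) (i1 : X -> T1) (i2 : X -> T2) x (z2 : T2) :
  compactification D i1 -> {within D, continuous i2} -> D x ->
  (forall A B, nbhs (i1 x) A -> nbhs z2 B ->
     exists y, [/\ D y, A (i1 y) & B (i2 y)]) ->
  z2 = i2 x.
Proof.
move=> [_ inj1 _ emb _] c2 Dx meet.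
apply: (@metric_hausdorff _ T2) => A B nA nB.
have /subspace_continuousP/(_ x Dx B nB) := c2.
rewrite /= nbhsE => -[V [oV Vx] VB].
case: (emb V oV) => W [oW VW].
have Wx : W (i1 x).
  have : (i1 @` (V `&` D)) (i1 x) by exists x.
  by rewrite VW => -[].
have [y [Dy Wy Ay]] := meet W A (open_nbhs_nbhs (conj oW Wx)) nA.
have : (W `&` i1 @` D) (i1 y) by split => //; exists y.
rewrite -VW => -[y' [Vy' Dy'] yy'].
have y'y : y' = y by apply: inj1; rewrite ?inE//; exact: mem_set.
by exists (i2 y); split => //; apply: VB => //; rewrite -y'y.
Qed.

Context (iG : X -> TG) (iK : X -> TK).
Hypothesis cG : compactification D iG.
Hypothesis cK : compactification D iK.
Local Notation hatD := (compactification_join D iG iK).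

Lemma join_nbhs z A B : hatD z -> nbhs z.1 A -> nbhs z.2 B ->
  exists y, [/\ D y, A (iG y) & B (iK y)].
Proof.
move=> hz nA nB; case: (hz (A `*` B)); first by exists (A, B).
by move=> _ [[y Dy <-] [/= Ay By]]; exists y.
Qed.

(** A point of the join that projects to [D] in one factor lies on the diagonal image
    of [D], so that both projections map the ideal boundary to ideal boundaries. *)
Lemma join_fst z x : hatD z -> D x -> z.1 = iG x -> z.2 = iK x.
Proof.
move=> hz Dx zx; case: (cK) => _ _ cc _ _.
apply: (embedding_converges cG cc Dx) => A B; rewrite -zx => nA nB.
exact: join_nbhs hz nA nB.
Qed.

Lemma join_snd z x : hatD z -> D x -> z.2 = iK x -> z.1 = iG x.
Proof.
move=> hz Dx zx; case: (cG) => _ _ cc _ _.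
apply: (embedding_converges cK cc Dx) => A B; rewrite -zx => nA nB.
by case: (join_nbhs hz nB nA) => y [Dy Ay By]; exists y.
Qed.

(** Balls of radius [n.+1^-1], taken in both factors. *)
Lemma prod_closed_Gdelta (C : set (TG * TK)%type) : closed C ->
  exists O : nat -> set (TG * TK)%type, (forall n, open (O n)) /\ C = \bigcap_n O n.
Proof.
move=> cC; exists (fun n => \bigcup_(c in C) (ball c.1 n.+1%:R^-1 `*` ball c.2 n.+1%:R^-1)).
split=> [n|].
  apply: bigcup_open => c _; rewrite openE => -[a b] [/= ac bc].
  exists (ball c.1 n.+1%:R^-1, ball c.2 n.+1%:R^-1) => //=.
  by split; apply: open_nbhs_nbhs; split => //; exact: metric_ball_open.
apply/seteqP; split=> [c Cc n _|z Oz].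
  by exists c => //; split => /=; apply: ballxx; rewrite invr_gt0.
apply: cC => B [[B1 B2] /= [/nbhs_ballP[e1 /= e10 eB1] /nbhs_ballP[e2 /= e20 eB2]] B12].
have e0 : 0 < Num.min e1 e2 by rewrite lt_min e10.
have /filter_ex[n ne] := near_infty_natSinv_lt (PosNum e0).
have [c Cc [/ball_sym z1 /ball_sym z2]] := Oz n Logic.I.
exists c; split => //; apply: B12; split => /=.
  by apply: eB1; apply: le_ball z1; apply: le_trans (ltW ne) _; rewrite ge_min lexx.
by apply: eB2; apply: le_ball z2; apply: le_trans (ltW ne) _; rewrite ge_min lexx orbT.
Qed.

End join.

(** * Mixtures of harmonic functions *)
Section harmonic_mixture.
Context {R : realType} {X : pmetricType R} (dom : set (set X))
    (w : set X -> X -> {finite_bmeasure X -> \bar R}) (D : set X) (x0 : X)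
    (E : nat -> set X).
Hypothesis EX : exhaustion dom w D x0 E.
Local Notation bE n := (boundary (E n)).
Local Notation P n := (w (E n) x0).
Context d (Y : measurableType d) (mu : {finite_measure set Y -> \bar R})
  (dens : X -> Y -> R).
(** The second case accounts for points outside the carrier of the boundary measure. *)
Hypothesis dens_H1 : forall z, H1 dom w D x0 (dens^~ z) \/ forall x, dens x z = 0.
Hypothesis mdens : forall x, measurable_fun setT (dens x).

Lemma dens_ge0 x z : 0 <= dens x z.
Proof.
have [[_ h0 _ hD]|->//] := dens_H1 z.
by have [/h0/ltW//|/hD->] := pselect (D x).
Qed.

Lemma dens_out x z : ~ D x -> dens x z = 0.
Proof. by have [[_ _ _ hD]|//] := dens_H1 z; move=> /hD. Qed.

Lemma dens_bounded x : D x -> exists M, 0 <= M /\ forall z, dens x z <= M.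
Proof.
move=> Dx; have [n /(_ _ (leqnn n)) Ex] := exh_memP EX Dx.
have /choice[k kP] n' := exh_is_kernel EX n'.
have [M [M0 kM]] := mean_value_bounded EX kP Ex; exists M; split => // z.
have [/(H1_pos_harm EX)[_ mv _]|->//] := dens_H1 z.
by apply: (kM (dens^~ z)); exact: mv.
Qed.

Lemma dens_equicont x e : D x -> 0 < e ->
  \forall x' \near x, forall z, `|dens x z - dens x' z| <= e.
Proof.
move=> Dx e0; have [n /(_ _ (leqnn n)) Ex] := exh_memP EX Dx.
have /choice[k kP] n' := exh_is_kernel EX n'.
apply: filterS (mean_value_equicont EX kP Ex e0) => x' [_ kM] z.
have [/(H1_pos_harm EX)[_ mv _]|h0] := dens_H1 z.
  by apply: (kM (dens^~ z)); exact: mv.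
by rewrite !h0 subrr normr0 ltW.
Qed.

Lemma dens_joint_measurable : measurable_fun setT (fun z : borel X * Y => dens z.1 z.2).
Proof.
have [q [qD qd]] := exh_dense EX; have oD := exh_openD EX.
apply: (@measurable_caratheodory R X _ Y D q (fun z => dens z.1 z.2)) => //.
- by move=> x y nDx; exact: dens_out.
- move=> x y Dx; apply/cvgrPdist_le => e e0.
  by apply: filterS (dens_equicont Dx e0) => x' /(_ y).
- by move=> i; exact: mdens.
Qed.

Definition mixture (g : Y -> R) x : R := \int[mu]_z (g z * dens x z).

Lemma mixture_integrable (g : Y -> R) x : mu.-integrable setT (EFin \o g) ->
  mu.-integrable setT (EFin \o (fun z => g z * dens x z)).
Proof.
move=> ig; have [Dx|nDx] := pselect (D x); last first.
  apply: eq_integrable (integrable0 _ _) => // z _ /=.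
  by rewrite dens_out// mulr0.
have [M [M0 dM]] := dens_bounded Dx.
apply: eq_integrable (integrableMl _ ig (mdens x) _) => //.
exists M; split; first exact: num_real.
by move=> a Ma y _ /=; rewrite ger0_norm ?dens_ge0// (le_trans (dM y))// ltW.
Qed.

Lemma mixture_continuous g : mu.-integrable setT (EFin \o g) ->
  {within D, continuous (mixture g)}.
Proof.
move=> ig; have oD := exh_openD EX.
rewrite continuous_open_subspace// => x /set_mem Dx; apply/cvgrPdist_le => e e0.
pose I := \int[mu]_z `|g z|.
have I0 : 0 <= I by apply: Rintegral_ge0.
have iag : mu.-integrable setT (EFin \o (fun z => `|g z|)).
  by apply: eq_integrable (integrable_abse ig).
have e1 : 0 < e / (I + 1) by rewrite divr_gt0// ltr_wpDl.
apply: filterS (dens_equicont Dx e1) => x' dxx'.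
rewrite /mixture -RintegralB//; last 2 first.
- exact: mixture_integrable.
- exact: mixture_integrable.
apply: le_trans (le_normr_Rintegral _ _) _ => //.
  apply: eq_integrable (integrableB _ (mixture_integrable x ig) (mixture_integrable x' ig)) => //.
have iz : mu.-integrable setT (EFin \o (fun z => e / (I + 1) * `|g z|)).
  by apply: eq_integrable (integrableZl _ (e / (I + 1)) iag).
apply: (@le_trans _ _ (\int[mu]_z (e / (I + 1) * `|g z|))).
  apply: le_Rintegral => //.
    apply: (@eq_integrable _ _ _ _ _ _ _ _ _
      (integrable_abse (integrableB _ (mixture_integrable x ig) (mixture_integrable x' ig)))) => //.
  by move=> z _; rewrite -mulrBr normrM mulrC ler_wpM2r.
rewrite RintegralZl// -/I mulrAC ler_pdivrMr ?ltr_wpDl//.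
by rewrite ler_pM2l// lerDl.
Qed.

Lemma H1_mean_E h V x : H1 dom w D x0 h -> dom V -> regular_domain w V ->
  compactly_contained V D -> V x ->
  (\int[w V x]_(y in boundary V) (h y)%:E = (h x)%:E)%E.
Proof.
move=> [[ch hh] _ _ _] domV regV ccV Vx; rewrite (hh V x domV regV ccV Vx).
have bV : boundary V `<=` D by move=> y [+ _]; exact: ccV.2.
have mb : measurable (boundary V : set (borel X)).
  by apply: closed_borel; exact: closed_boundary.
have chb : {within boundary V, continuous h} by exact: continuous_subspaceW ch.
have [M hM] := within_continuous_bounded (compact_boundary ccV.1) chb.
rewrite fineK//; apply: integrable_fin_num => //.
apply: (@integrable_bounded _ _ _ _ _ _ M) => //.
exact: within_continuous_borel.
Qed.

(** Tonelli's theorem; the joint measurability of the densities comes from their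
    continuity in the first variable. *)
Lemma ge0_mixture_mean (g : Y -> R) V x : measurable_fun setT g -> (forall z, 0 <= g z) ->
  dom V -> regular_domain w V -> compactly_contained V D -> V x ->
  measurable (boundary V : set (borel X)) ->
  (\int[w V x]_(y in boundary V) \int[mu]_z (g z * dens y z)%:E =
   \int[mu]_z (g z * dens x z)%:E)%E.
Proof.
move=> mg g0 domV regV ccV Vx mb.
pose f (yz : borel X * Y) : \bar R :=
  (\1_(boundary V) yz.1 * (g yz.2 * dens yz.1 yz.2))%:E.
have mf : measurable_fun setT f.
  apply/measurable_EFinP; apply: measurable_funM.
    by apply: measurableT_comp => //; exact: measurable_indic.
  by apply: measurable_funM; [exact: measurableT_comp|exact: dens_joint_measurable].
have f0 z : (0 <= f z)%E by rewrite lee_fin !mulr_ge0// dens_ge0.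
have := fubini_tonelli (m1 := w V x) (m2 := mu) f mf f0.
rewrite /f/= => H.
transitivity (\int[w V x]_y \int[mu]_z (\1_(boundary V) y * (g z * dens y z))%:E)%E.
  rewrite integral_mkcond; apply: eq_integral => y _; rewrite patchE indicE.
  case: ifPn => _; first by apply: eq_integral => z _; rewrite mul1r.
  by apply/esym/integral0_eq => z _; rewrite mul0r.
rewrite H; apply: eq_integral => z _.
transitivity (\int[w V x]_(y in boundary V) (g z * dens y z)%:E)%E.
  rewrite [RHS]integral_mkcond; apply: eq_integral => y _; rewrite patchE indicE.
  by case: ifPn => _; rewrite ?mul1r ?mul0r.
under eq_integral do rewrite EFinM.
rewrite ge0_integralZl//; first last.
- by rewrite lee_fin.
- by move=> y _; rewrite lee_fin dens_ge0.
- apply/measurable_EFinP/measurable_funTS.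
  exact: (@measurableT_comp _ _ _ (borel X) (borel X * Y)%type R
    (fun z => dens z.1 z.2) setT (fun x => (x, z)) dens_joint_measurable
    (@pair2_measurable _ _ (borel X) Y z)).
have [hz|hz] := dens_H1 z.
  by rewrite (H1_mean_E hz domV regV ccV Vx).
by rewrite hz mulr0 integral0_eq ?mule0// => y _; rewrite hz.
Qed.

Lemma mixture_harmonic g : mu.-integrable setT (EFin \o g) -> harmonic_on dom w D (mixture g).
Proof.
move=> ig; split; first exact: mixture_continuous.
move=> V x domV regV ccV Vx.
have mg : measurable_fun setT g by apply/measurable_EFinP; exact: measurable_int ig.
have mb : measurable (boundary V : set (borel X)).
  by apply: closed_borel; exact: closed_boundary.
have bV : boundary V `<=` D by move=> y [+ _]; exact: ccV.2.
pose gp z := Num.max (g z) 0; pose gn z := Num.max (- g z) 0.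
have igp : mu.-integrable setT (EFin \o gp).
  apply: eq_integrable (integrable_funepos _ ig) => // z _.
  by rewrite /= funeposE/= -EFin_max.
have ign : mu.-integrable setT (EFin \o gn).
  apply: eq_integrable (integrable_funeneg _ ig) => // z _.
  by rewrite /= funenegE/= -EFin_max.
have gE z : g z = gp z - gn z.
  by rewrite /gp /gn; case: (leP (g z) 0) => h; case: (leP (- g z) 0) => h'; lra.
have mixE y : mixture g y = mixture gp y - mixture gn y.
  rewrite /mixture -RintegralB//; [|exact: mixture_integrable|exact: mixture_integrable].
  by apply: eq_Rintegral => z _; rewrite gE mulrBl.
have pos (f : Y -> R) : mu.-integrable setT (EFin \o f) -> (forall z, 0 <= f z) ->
    mixture f x = \int[w V x]_(y in boundary V) mixture f y /\
    (w V x).-integrable (boundary V) (EFin \o mixture f).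
  move=> iff f0.
  have mff : measurable_fun setT f by apply/measurable_EFinP; exact: measurable_int iff.
  have mixfE y : (mixture f y)%:E = (\int[mu]_z (f z * dens y z)%:E)%E.
    by rewrite fineK//; apply: integrable_fin_num => //; exact: mixture_integrable.
  have := ge0_mixture_mean mff f0 domV regV ccV Vx mb.
  rewrite -mixfE; under eq_integral do rewrite -mixfE.
  move=> HI; split; first by rewrite /Rintegral HI.
  apply/integrableP; split.
    apply/measurable_EFinP; apply: within_continuous_borel => //.
    by apply: continuous_subspaceW bV _; exact: mixture_continuous.
  under eq_integral => y _.
    rewrite /= ger0_norm; last first.
      by apply: Rintegral_ge0 => z _; rewrite mulr_ge0// dens_ge0.
    over.
  by rewrite HI ltry.
have [hp ip] := pos gp igp (fun z => ltac:(by rewrite /gp le_max lexx orbT)).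
have [hn in_] := pos gn ign (fun z => ltac:(by rewrite /gn le_max lexx orbT)).
rewrite mixE hp hn -RintegralB//.
by apply: eq_Rintegral => y _; rewrite mixE.
Qed.

End harmonic_mixture.

(** * Integrability for the completed measures *)
Section completed_integrability.
Context {R : realType} {T : ptopologicalType}.
Implicit Types (mu nu : {bmeasure T -> \bar R}) (B : set T) (f : T -> R).

(** Extending by 0 allows one to work with integrals over the whole space. *)
Lemma L1_integrable mu B f : measurable (B : set (borel T)) -> L1 B mu f ->
  exists g : borel T -> R, mu.-integrable setT (EFin \o g) /\
    ae_eq mu setT (f \_ B) g.
Proof.
move=> mB [g [ig [N [mN N0 fgN]]]]; exists (g \_ B); split.
  by rewrite -restrict_EFin; exact/(integrable_mkcond _ mB).1.
exists N; split => // t; apply: contra_notP => nNt _; rewrite !patchE.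
case: ifPn => // tB; apply: contrapT => fgt; apply: nNt; apply: fgN.
by move=> /(_ (set_mem tB)).
Qed.

Lemma L1_domI mu nu B f : measurable (B : set (borel T)) -> nu `<< mu ->
  (forall g : borel T -> R, mu.-integrable setT (EFin \o g) ->
     nu.-integrable setT (EFin \o g)) ->
  L1 B mu f -> L1 B nu f.
Proof.
move=> mB numu imp /(L1_integrable mB)[g [ig fg]]; exists g; split.
  by apply: integrableS (imp _ ig).
case: fg => N [mN N0 fgN]; exists N; split => //.
  exact: (null_content_dominatesP _ _).1 numu _ mN N0.
move=> t; apply: contra_notP => nNt Bt; apply: contrapT => fgt.
apply: nNt; apply: fgN => /(_ Logic.I); by rewrite patchE mem_set.
Qed.

Lemma Rintegral_ae_eqT mu B f (g : borel T -> R) : ae_eq mu setT (f \_ B) g ->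
  \int[mu]_(z in B) f z = \int[mu]_z g z.
Proof.
move=> fg; congr fine; rewrite integral_mkcond; apply: integral_ae_eq_any.
case: fg => N [mN N0 fgN]; exists N; split => // t; apply: contra_notP => nNt _.
apply: contrapT => fgt; apply: nNt; apply: fgN => /(_ Logic.I) eqt; apply: fgt.
by rewrite restrict_EFin /= eqt.
Qed.

End completed_integrability.

(** * Images of harmonic measures *)
Section image_harmonic.
Context {R : realType} {X : topologicalType} {T T' : ptopologicalType}.
Variables (U : set X) (B : set T) (w : X -> {bmeasure T -> \bar R}).
Variables (p : T -> T') (B' : set T').
Hypothesis mp : measurable_fun setT (p : borel T -> borel T').
Hypothesis mB' : measurable (B' : set (borel T')).
Hypothesis BB' : B `<=` p @^-1` B'.
Hypothesis hw : continuous_harmonic_measure U B w.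
Let w' x : {bmeasure T' -> \bar R} := image_measure (w x) mp.

(** A boundary function on the image pulls back to a boundary function with the same
    integrals, so continuity is inherited. *)
Lemma image_continuous_harmonic_measure : continuous_harmonic_measure U B' w'.
Proof.
case: hw => -[mB w0 w1 wdom] cw.
have mpA (A : set (borel T')) : measurable A -> measurable (p @^-1` A : set (borel T)).
  by move=> mA; rewrite -[_ @^-1` _]setTI; exact: mp.
have w'0 x : U x -> w' x (~` B') = 0%E.
  move=> Ux; apply: (@subset_measure0 _ _ _ (w x) (p @^-1` (~` B')) (~` B)) => //.
  - by apply: mpA; exact: measurableC.
  - exact: measurableC.
  - by move=> z nB' /BB'.
  - exact: w0.
have wT x : U x -> w x setT = 1%E.
  by move=> Ux; rewrite (measure_carried mB (w0 x Ux)) w1.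
split.
  split => // [x Ux|x y Ux Uy].
    by rewrite -(measure_carried mB' (w'0 x Ux)) /w' /= /image_measure /pushforward wT.
  apply/null_content_dominatesP => A mA A0.
  exact: (null_content_dominatesP _ _).1 (wdom x y Ux Uy) _ (mpA _ mA) A0.
move=> f Lf.
have key x : U x -> L1 B (w x) (f \o p) /\
    \int[w' x]_(z in B') f z = \int[w x]_(z in B) (f (p z)).
  move=> Ux; have [g [ig fg]] := L1_integrable mB' (Lf x Ux).
  have mg : measurable_fun setT g by apply/measurable_EFinP; exact: measurable_int ig.
  have igp : (w x).-integrable setT (EFin \o (g \o p)).
    apply/integrableP; split; first exact/measurable_EFinP/measurableT_comp.
    case/integrableP: ig => _.
    rewrite ge0_integral_image ?preimage_setT//.
    by apply/measurable_EFinP; exact: measurableT_comp.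
  have fgp : ae_eq (w x) setT ((f \o p) \_ B) (g \o p).
    case: fg => N [mN N0 fgN]; exists (p @^-1` N `|` ~` B); split.
    - by apply: measurableU; [exact: mpA|exact: measurableC].
    - by rewrite null_set_setU//; [exact: mpA|exact: measurableC|exact: w0].
    - move=> z; apply: contra_notP => /not_orP[nNz /contrapT Bz] _.
      apply: contrapT => fgz; apply: nNz; apply: fgN => /(_ Logic.I) eqz.
      apply: fgz; rewrite patchE mem_set//= -eqz patchE mem_set//.
      exact: BB'.
  split; last first.
    rewrite (Rintegral_ae_eqT fg) (Rintegral_ae_eqT fgp); congr fine.
    rewrite (integral_pushforward mp (f := EFin \o g)) ?preimage_setT//.
    exact/measurable_EFinP.
  exists (g \o p); split; first by apply: integrableS igp.
  case: fgp => N [mN N0 fgN]; exists N; split => // t; apply: contra_notP => nNt Bt.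
  by apply: contrapT => fgt; apply: nNt; apply: fgN => /(_ Logic.I); rewrite patchE mem_set.
apply: (@subspace_eq_continuous _ _ _ (fun x => \int[w x]_(z in B) f (p z))).
  by move=> x /set_mem Ux; exact/esym/(key x Ux).2.
by apply: cw => x Ux; case: (key x Ux).
Qed.

End image_harmonic.

(** * Harmonic measures given by a boundary density *)
Section density_harmonic_measure.
Context {R : realType} {X : pmetricType R} (dom : set (set X))
    (w : set X -> X -> {finite_bmeasure X -> \bar R}) (D : set X) (x0 : X)
    (E : nat -> set X).
Hypothesis EX : exhaustion dom w D x0 E.
Context (T : ptopologicalType) (mu : {bmeasure T -> \bar R}) (S bm : set T)
  (dens : X -> borel T -> R).
Hypothesis mu1 : mu setT = 1%E.
Hypothesis mS : measurable (S : set (borel T)).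
Hypothesis mbm : measurable (bm : set (borel T)).
Hypothesis bmS : bm `<=` S.
Hypothesis mu_bm : mu (~` bm) = 0%E.
Hypothesis dens_bm : forall z, bm z -> H1 dom w D x0 (dens^~ z).
Hypothesis dens_out_bm : forall x z, ~ bm z -> dens x z = 0.
Hypothesis mdens : forall x, measurable_fun setT (dens x).
Hypothesis int_dens : forall x, D x -> (\int[mu]_z (dens x z)%:E = 1)%E.

Let dens_H1 z : H1 dom w D x0 (dens^~ z) \/ forall x, dens x z = 0.
Proof.
by have [/dens_bm|nz] := pselect (bm z); [left|right => x; exact: dens_out_bm].
Qed.

Let P : probability (borel T) R := mkprob mu1.

Definition density_harmonic x : {bmeasure T -> \bar R} :=
  density_measure mu (mdens x) (dens_ge0 dens_H1 x).
Local Notation wh := density_harmonic.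

Lemma density_harmonicE x A : wh x A = (\int[mu]_(z in A) (dens x z)%:E)%E.
Proof. by []. Qed.

Lemma density_harmonic_setT x : D x -> wh x setT = 1%E.
Proof. exact: int_dens. Qed.

Lemma density_harmonic_dominated x : wh x `<< mu.
Proof.
apply/null_content_dominatesP => A mA A0; rewrite density_harmonicE.
by apply: null_set_integral => //; apply/measurable_EFinP; exact: measurable_funTS.
Qed.

(** If the integral of a density over [A] vanishes, the density vanishes almost
    everywhere on [A]; but it is positive on [bm], so [A] meets [bm] in a null
    set. *)
Lemma density_harmonic_dominates x : D x -> mu `<< wh x.
Proof.
move=> Dx; apply/null_content_dominatesP => A mA A0.
have mdA : measurable_fun A (EFin \o dens x).
  by apply/measurable_EFinP; exact: measurable_funTS.
have : (\int[mu]_(z in A) `|(EFin \o dens x) z| = 0)%E.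
  rewrite -[RHS]A0; apply: eq_integral => z _.
  by rewrite /= ger0_norm// (dens_ge0 dens_H1).
move=> /(ae_eq_integral_abs mu mA mdA).1[N [mN N0 AN]].
apply: (@subset_measure0 _ _ _ mu A (N `|` ~` bm)) => //.
- by apply: measurableU => //; exact: measurableC.
- move=> z Az; have [bz|nbz] := pselect (bm z); [left|by right].
  apply: AN => /(_ Az)[dz0]; have [_ h0 _ _] := dens_bm bz.
  by have := h0 x Dx; rewrite dz0 ltxx.
- by apply: (@null_set_setU _ _ _ mu) => //; exact: measurableC.
Qed.

Lemma density_integral x (g : borel T -> R) : D x -> measurable_fun setT g ->
  \int[wh x]_z g z = mixture P dens g x.
Proof.
move=> Dx mg.
have wx1 : wh x setT = 1%E := int_dens Dx.
pose Q : probability (borel T) R := mkprob wx1.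
have ge0 (f : borel T -> \bar R) : (forall z, 0 <= f z)%E -> measurable_fun setT f ->
    (\int[wh x]_z f z = \int[mu]_z (f z * (dens x z)%:E))%E.
  move=> f0 mf.
  exact: (@ge0_integral_density _ _ _ Q P (dens x) (mdens x) (fun _ _ => erefl) setT f).
have mgE : measurable_fun setT (EFin \o g) by exact/measurable_EFinP.
rewrite /mixture /Rintegral; congr fine; rewrite integralE [RHS]integralE; congr (_ - _)%E.
- rewrite ge0; [|by move=> z; exact: funepos_ge0|exact: measurable_funepos].
  apply: eq_integral => z _; rewrite !funeposE -[in RHS](mul0e (dens x z)%:E).
  by rewrite EFinM -maxe_pMl// lee_fin (dens_ge0 dens_H1).
- rewrite ge0; [|by move=> z; exact: funeneg_ge0|exact: measurable_funeneg].
  apply: eq_integral => z _; rewrite !funenegE -[in RHS](mul0e (dens x z)%:E).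
  by rewrite EFinM -mulNe -maxe_pMl// lee_fin (dens_ge0 dens_H1).
Qed.

Lemma density_integrable x (g : borel T -> R) : D x -> mu.-integrable setT (EFin \o g) ->
  (wh x).-integrable setT (EFin \o g).
Proof.
move=> Dx ig; have mgE := measurable_int _ ig.
have mg : measurable_fun setT g by exact/measurable_EFinP.
have wx1 : wh x setT = 1%E := int_dens Dx.
pose Q : probability (borel T) R := mkprob wx1.
apply/integrableP; split => //.
have := @ge0_integral_density _ _ _ Q P (dens x) (mdens x) (fun _ _ => erefl) setT
  (fun z => `|(EFin \o g) z|)%E measurableT (fun _ => abse_ge0 _) (measurableT_comp (@abse_measurable R _) mgE).
move=> ->.
have /(mixture_integrable EX dens_H1 mdens x)/integrableP[_] : P.-integrable setT (EFin \o g) by [].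
apply: le_lt_trans; rewrite le_eqVlt; apply/orP; left; apply/eqP; apply: eq_integral => z _.
by rewrite /= normrM (ger0_norm (dens_ge0 dens_H1 _ _)).
Qed.

Lemma density_L1 x f : D x -> L1 S mu f -> L1 S (wh x) f.
Proof.
move=> Dx; apply: L1_domI mS (density_harmonic_dominated x) _ => g.
exact: density_integrable.
Qed.

(** One Borel function [g] serves for all [x] at once, because every [wh x] is
    dominated by [mu]. *)
Lemma density_integral_L1 f : L1 S mu f -> exists g : borel T -> R,
  P.-integrable setT (EFin \o g) /\
  forall x, D x -> \int[wh x]_(z in S) f z = mixture P dens g x.
Proof.
move=> /(L1_integrable mS)[g [ig fg]]; exists g; split => // x Dx.
have mg : measurable_fun setT g by apply/measurable_EFinP; exact: measurable_int ig.
rewrite -(density_integral Dx mg); apply: Rintegral_ae_eqT.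
case: fg => N [mN N0 fgN]; exists N; split => //.
exact: (null_content_dominatesP _ _).1 (density_harmonic_dominated x) _ mN N0.
Qed.

Lemma density_harmonic_on f : L1 S mu f ->
  harmonic_on dom w D (fun x => \int[wh x]_(z in S) f z).
Proof.
move=> /density_integral_L1[g [ig fg]].
have [cm hm] := mixture_harmonic EX dens_H1 mdens ig; split.
  apply: (@subspace_eq_continuous _ _ _ (mixture P dens g)) cm.
  by move=> x /set_mem Dx; exact/esym/fg.
move=> V x domV regV ccV Vx; rewrite fg; last by apply: ccV.2; exact: subset_closure.
rewrite (hm V x domV regV ccV Vx); apply: eq_Rintegral => y /set_mem[By _].
by rewrite fg//; exact: ccV.2.
Qed.

Hypothesis dens_x0 : forall z, bm z -> dens x0 z = 1.
Hypothesis Dx0 : D x0.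

Lemma density_harmonic_x0 A : measurable A -> wh x0 A = mu A.
Proof.
move=> mA; rewrite -[RHS]mul1e -integral_cst//.
apply: integral_ae_eq_any; exists (~` bm); split => //; first exact: measurableC.
by move=> z; apply: contra_not => bz _; rewrite dens_x0//; exact: contrapT.
Qed.

Lemma density_L1_iff f : (forall x, D x -> L1 S (wh x) f) <-> L1 S mu f.
Proof.
split => [/(_ x0 Dx0)|Lf x Dx]; last exact: density_L1.
apply: L1_domI mS (density_harmonic_dominates Dx0) _ => g.
move=> /integrableP[mg fin]; apply/integrableP; split => //.
by move: fin; rewrite (eq_measure_integral mu)// => A mA _; exact: density_harmonic_x0.
Qed.

Lemma density_continuous_harmonic_measure : continuous_harmonic_measure D S wh.
Proof.
have muS : mu (~` S) = 0%E.
  apply: (@subset_measure0 _ _ _ mu (~` S) (~` bm)) => //; try exact: measurableC.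
  exact: subsetC.
have w0 x : D x -> wh x (~` S) = 0%E.
  move=> Dx; apply: (null_content_dominatesP _ _).1 (density_harmonic_dominated x) _ _ muS.
  exact: measurableC.
split.
  split => // [x Dx|x y Dx Dy].
    by rewrite -(measure_carried mS (w0 x Dx)) density_harmonic_setT.
  apply: null_dominates_trans (density_harmonic_dominated x) (density_harmonic_dominates Dy).
move=> f /density_L1_iff Lf; exact: (density_harmonic_on Lf).1.
Qed.

End density_harmonic_measure.

(** * Harmonic measure on the ideal boundary of the join *)
Lemma exhaustion_subsequence {R : realType} {X : pmetricType R} (dom : set (set X))
    (w : set X -> X -> {finite_bmeasure X -> \bar R}) (D : set X) (x0 : X)
    (E : nat -> set X) (s : nat -> nat) :
  exhaustion dom w D x0 E -> {homo s : m n / (m < n)%N} ->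
  exhaustion dom w D x0 (E \o s).
Proof.
move=> EX hs; split => [|n||n||n] /=.
- exact: exh_fw EX.
- exact: exh_dom EX _.
- exact: exh_mem_x0 EX _.
- split; first exact: exh_compact EX _.
  by apply: (exh_closure EX); exact: hs.
- apply/seteqP; split => [x /(exh_memP EX)[n nE]|x [n _]]; last exact: (exh_subD EX).
  exists n => //; apply: nE.
  elim: n => // n IH; exact: leq_ltn_trans IH (hs _ _ (ltnSn n)).
- exact: exh_ker EX _.
Qed.

Lemma homo_cvg_infty (s : nat -> nat) : {homo s : m n / (m < n)%N} -> s n @[n --> \oo] --> \oo.
Proof.
move=> hs; have sn n : (n <= s n)%N.
  by elim: n => // n IH; exact: leq_ltn_trans IH (hs _ _ (ltnSn n)).
by move=> A [N _ NA]; exists N => // n /= Nn; apply: NA => /=; exact: leq_trans Nn (sn n).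
Qed.

Lemma continuous_borel (T1 T2 : ptopologicalType) (p : T1 -> T2) : continuous p ->
  measurable_fun setT (p : borel T1 -> borel T2).
Proof.
move=> cp; apply: (@measurability _ _ (borel T1) (borel T2) setT p (@open T2)) => // => _ [V oV <-].
rewrite setTI; apply: open_borel; apply: open_comp => // x _; exact: cp.
Qed.

Theorem corollary4p15 (R : realType) (X : pmetricType R)
  (dom : set (set X)) (w : set X -> X -> {finite_bmeasure X -> \bar R})
  (D : set X) (x0 : X) (Dn : nat -> set X)
  (TK : pmetricType R) (iK : X -> TK) (bmK : set TK) (kappa : TK -> X -> R)
  (nj : nat -> nat)
  (TG : pmetricType R) (iG : X -> TG)
  (phi : nat -> nat) (mu1 : {bmeasure (TG * TK)%type -> \bar R}) :
  harmonic_framework dom w ->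
  is_domain D ->
  (forall n, dom (Dn n) /\ regular_domain w (Dn n)) ->
  Dn 0%N x0 ->
  (forall n, compactly_contained (Dn n) (Dn n.+1)) ->
  D = \bigcup_n Dn n ->
  (forall n, jointly_continuous_kernel w x0 (Dn n)) ->
  compactification D iK ->
  measurable (bmK : set (borel TK)) ->
  bmK `<=` ~` (iK @` D) ->
  measurable_fun (bmK : set (borel TK))
    (kappa : borel TK -> borel (@locally_uniform R X D)) ->
  set_bij bmK (extreme_points (H1 dom w D x0)) kappa ->
  {homo nj : m n / (m < n)%N} ->
  (forall eta, bmK eta ->
    weakly_converges iK [set: TK] (fun j => boundary (Dn (nj j))) (kappa eta)
      (fun j => w (Dn (nj j)) x0) (dirac (eta : borel TK))) ->
  compactification D iG ->
  {homo phi : m n / (m < n)%N} ->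
  weakly_converges (fun x => (iG x, iK x)) (compactification_join D iG iK)
    (fun m => boundary (Dn (nj (phi m)))) (cst 1)
    (fun m => w (Dn (nj (phi m))) x0) mu1 ->
  let hatD : set (TG * TK) := compactification_join D iG iK in
  let bhat : set (TG * TK) := hatD `\` [set (iG x, iK x) | x in D] in
  let bmhat : set (TG * TK) := hatD `&` [set z | bmK z.2] in
  exists what : X -> {bmeasure (TG * TK)%type -> \bar R},
    [/\ (forall x (A : set (borel (TG * TK)%type)), D x -> measurable A ->
           A `<=` bhat ->
           what x A = (\int[mu1]_(z in A `&` bmhat) (kappa z.2 x)%:E)%E),
        continuous_harmonic_measure D bhat what /\
        (forall x, D x -> radon (what x)),
        (forall A : set (borel (TG * TK)%type), measurable A ->
           what x0 A = mu1 A),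
        (forall f : TG * TK -> R,
           (forall x, D x -> L1 bhat (what x) f) <-> L1 bhat mu1 f) /\
        (forall f : TG * TK -> R, L1 bhat mu1 f ->
           harmonic_on dom w D (fun x => \int[what x]_(z in bhat) f z)) &
        (exists wG : X -> {bmeasure TG -> \bar R},
           (forall x (A : set (borel TG)), D x -> measurable A ->
              wG x A = pushforward (what x) (fst : _ -> borel TG) A) /\
           continuous_harmonic_measure D (~` (iG @` D)) wG) /\
        (exists wK : X -> {bmeasure TK -> \bar R},
           (forall x (A : set (borel TK)), D x -> measurable A ->
              wK x A = pushforward (what x) (snd : _ -> borel TK) A) /\
           continuous_harmonic_measure D (~` (iK @` D)) wK)].
Proof.
move=> fw domD domDn Dn0 ccDn Dcup kerDn cK mbmK bmK_out mkappa bij_kappa hnj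
  kweak cG hphi mu1weak hatD bhat bmhat.
have EX0 : exhaustion dom w D x0 Dn by split.
pose E := (Dn \o nj) \o phi.
have EX : exhaustion dom w D x0 E.
  by apply: exhaustion_subsequence hphi; exact: exhaustion_subsequence hnj.
have [[cTK hTK] _ ciK _ _] := cK; have [[cTG hTG] _ ciG _ _] := cG.
have cfst : continuous (fst : TG * TK -> TG) by move=> z; exact: cvg_fst.
have csnd : continuous (snd : TG * TK -> TK) by move=> z; exact: cvg_snd.
have mfst := continuous_borel cfst; have msnd := continuous_borel csnd.
have [mu1_hat mu1_weak] := mu1weak.
have mhatD : measurable (hatD : set (borel (TG * TK)%type)).
  by apply: closed_borel; exact: closed_closure.
have mChatD : measurable (~` hatD : set (borel (TG * TK)%type)) by exact: measurableC.
(* The total mass comes from testing the weak convergence against 1; the real-valued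
   integral of 1 would be 0 if the mass were infinite. *)
have mu1T : mu1 setT = 1%E.
  have : (fun n => \int[w (E n) x0]_(_ in boundary (E n)) (1 * 1 : R)) @ \oo -->
      \int[mu1]_(_ in hatD) (1 : R).
    exact: (mu1_weak (cst 1) (continuous_subspaceT (@cst_continuous _ _ _))).
  have -> : (fun n => \int[w (E n) x0]_(_ in boundary (E n)) (1 * 1 : R)) = cst 1.
    apply/funext => n; rewrite mulr1 -[RHS]/(fine 1%E) -(w_bd1 EX (exh_mem_x0 EX n)).
    congr fine; rewrite -[RHS]mul1e -integral_cst//; exact: (bd_measurable E n).
  move=> /(cvg_unique (@Rhausdorff R) (cvg_cst _)); rewrite /Rintegral integral_cst// mul1e.
  rewrite (measure_carried mhatD mu1_hat).
  by case: (mu1 hatD) => [r /= <-|/= /eqP|/= /eqP]//; rewrite oner_eq0.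
have mpsnd (A : set (borel TK)) : measurable A ->
    measurable (snd @^-1` A : set (borel (TG * TK)%type)).
  by move=> mA; rewrite -[_ @^-1` _]setTI; exact: msnd.
pose mu : {bmeasure TK -> \bar R} := image_measure mu1 msnd.
have kappa_weak eta : bmK eta ->
    forall f : TK -> R, continuous f -> (forall x, 0 <= f x <= 1) ->
    \int[w (E n) x0]_(y in boundary (E n)) (f (iK y) * kappa eta y)
      @[n --> \oo] --> f eta.
  move=> beta f cf _; have [_ /(_ f (continuous_subspaceT cf)) cvf] := kweak eta beta.
  have mf : measurable_fun setT (f : borel TK -> R).
    by apply: within_continuous_borel => //; exact: continuous_subspaceT.
  have <- : \int[dirac (eta : borel TK)]_(z in [set: borel TK]) (f : borel TK -> R) z = f eta.
    rewrite /Rintegral integral_dirac//; last exact/measurable_EFinP.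
    by rewrite diracT mul1e.
  exact: (cvg_comp _ _ (homo_cvg_infty hphi) cvf).
have mu_weak (f : TK -> R) : continuous f -> (forall x, 0 <= f x <= 1) ->
    \int[w (E n) x0]_(y in boundary (E n)) f (iK y) @[n --> \oo] --> \int[mu]_z f z.
  move=> cf f01.
  have cfs : {within hatD, continuous (f \o snd : TG * TK -> R)}.
    by apply: continuous_subspaceT => z; apply: continuous_comp; [exact: csnd|exact: cf].
  have : (fun n => \int[w (E n) x0]_(y in boundary (E n)) (f (iK y) * 1)) @ \oo -->
    \int[mu1]_(z in hatD) f z.2 by exact: (mu1_weak _ cfs).
  have -> : (fun n => \int[w (E n) x0]_(y in boundary (E n)) (f (iK y) * 1)) =
      (fun n => \int[w (E n) x0]_(y in boundary (E n)) f (iK y)).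
    by apply/funext => n; apply: eq_Rintegral => y _; rewrite mulr1.
  have <- : \int[mu1]_(z in hatD) f z.2 = \int[mu]_z f z; last by [].
  have ae : ae_eq mu1 setT ((f \o snd : TG * TK -> R) \_ hatD) (f \o snd).
    exists (~` hatD); split => // z; apply: contra_not => hz _.
    by rewrite patchE mem_set.
  rewrite (Rintegral_ae_eqT ae) /Rintegral; congr fine.
  rewrite [RHS](ge0_integral_image mu1 msnd) ?preimage_setT//.
    apply/measurable_EFinP.
    by apply: within_continuous_borel => //; exact: continuous_subspaceT.
  by move=> y _; rewrite lee_fin; case/andP: (f01 y).
have muT : (mu setT < +oo)%E by rewrite /mu /= /image_measure /pushforward mu1T ltry.
have [mu_bm int_kappa] := boundary_measure_carried EX ciK mbmK mkappa bij_kappa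
  kappa_weak muT mu_weak.
have kappaH1 eta : bmK eta -> H1 dom w D x0 (kappa eta).
  by case: bij_kappa => /(_ eta) + _ _ => /[apply] -[].
have mbmhat : measurable (bmhat : set (borel (TG * TK)%type)).
  by apply: measurableI => //; exact: mpsnd.
have mu1_bmhat : mu1 (~` bmhat) = 0%E.
  rewrite /bmhat setCI; apply: (@null_set_setU _ _ _ mu1) => //.
  by apply: measurableC; exact: mpsnd.
pose dens x : borel (TG * TK)%type -> R := (fun z => kappa z.2 x) \_ bmhat.
have mdens x : measurable_fun setT (dens x).
  have [Dx|nDx] := pselect (D x).
    apply/(measurable_restrictT _ mbmhat).
    have im : [set z.2 | z in bmhat] `<=` bmK by move=> _ [z [_ bz] <-].
    have := @measurable_comp _ _ _ (borel (TG * TK)%type) (borel TK) R bmK (kappa ^~ x)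
      bmhat snd mbmK im (kappa_measurable mkappa Dx) (measurable_funTS msnd).
    exact.
  rewrite (_ : dens x = cst 0)//; apply/funext => z; rewrite /dens patchE.
  by case: ifPn => // /set_mem[_ bz]; have [_ _ _ ->] := kappaH1 _ bz.
have dens_bm z : bmhat z -> H1 dom w D x0 (dens^~ z).
  move=> bz; rewrite (_ : dens^~ z = kappa z.2); first by apply: kappaH1; case: bz.
  by apply/funext => x; rewrite /dens patchE mem_set.
have dens_out_bm x z : ~ bmhat z -> dens x z = 0.
  by move=> nbz; rewrite /dens patchE memNset.
have int_dens x : D x -> (\int[mu1]_z (dens x z)%:E = 1)%E.
  move=> Dx; rewrite -(int_kappa x Dx) [RHS](ge0_integral_image mu1 msnd)//; last 2 first.
  - by apply/measurable_EFinP; exact: (kappa_measurable mkappa Dx).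
  - move=> eta /kappaH1[_ k0 _ _]; rewrite lee_fin; exact/ltW/k0.
  rewrite [RHS]integral_mkcond; apply: integral_ae_eq_any.
  exists (~` bmhat); split => //; first exact: measurableC.
  move=> z; apply: contra_not => bz _; have [_ bz2] := bz.
  by rewrite /dens !patchE !mem_set.
have iD : {within D, continuous (fun x => (iG x, iK x) : TG * TK)}.
  apply/subspace_continuousP => x Dx; apply: cvg_pair.
  - exact: (subspace_continuousP _ _).1 ciG x Dx.
  - exact: (subspace_continuousP _ _).1 ciK x Dx.
have DE : D = \bigcup_n closure (E n).
  apply/seteqP; split => [x /(exh_memP EX)[n /(_ n (leqnn n)) Ex]|x [n _]].
    by exists n => //; exact: subset_closure.
  exact: (exh_closureD EX).
have mbhat : measurable (bhat : set (borel (TG * TK)%type)).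
  apply: measurableD => //.
  exact: sigma_compact_image_borel (prod_hausdorff hTG hTK) iD DE (exh_compact EX).
have bmhat_sub : bmhat `<=` bhat.
  move=> z [hz bz]; split => // -[x Dx zE].
  by apply: (bmK_out _ bz); exists x => //; rewrite -zE.
have Dx0 : D x0 by apply: (exh_subD EX0) Dn0.
have dens_x0 z : bmhat z -> dens x0 z = 1 by move=> /dens_bm[].
pose what := density_harmonic mu1 dens_bm dens_out_bm mdens.
have chm : continuous_harmonic_measure D bhat what.
  exact: (density_continuous_harmonic_measure EX mu1T mbhat mbmhat bmhat_sub mu1_bmhat
    _ _ _ int_dens dens_x0 Dx0).
exists what; split.
- move=> x A Dx mA _; rewrite integral_mkcondr.
  by apply: eq_integral => z _; rewrite restrict_EFin.
- split => // x Dx; apply: radon_compact.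
  + by rewrite -setXTT; exact: compact_setX.
  + by change ((\int[mu1]_z (dens x z)%:E < +oo)%E); rewrite (int_dens x Dx) ltry.
  + exact: prod_closed_Gdelta.
  + exact: prod_hausdorff.
- by move=> A mA; apply: density_harmonic_x0.
- split => f.
    exact: (density_L1_iff EX mu1T mbhat mbmhat mu1_bmhat _ _ _ int_dens dens_x0 Dx0).
  exact: (density_harmonic_on EX mu1T mbhat _ _ _ int_dens).
- split.
  + exists (fun x => image_measure (what x) mfst); split => //.
    apply: (image_continuous_harmonic_measure mfst _ _ chm).
      by apply: measurableC; exact: sigma_compact_image_borel hTG ciG DE (exh_compact EX).
    move=> z [hz nz] /= [x Dx zx]; apply: nz; exists x => //.
    by rewrite (surjective_pairing z) -(join_fst cG cK hz Dx (esym zx)) zx.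
  + exists (fun x => image_measure (what x) msnd); split => //.
    apply: (image_continuous_harmonic_measure msnd _ _ chm).
      by apply: measurableC; exact: sigma_compact_image_borel hTK ciK DE (exh_compact EX).
    move=> z [hz nz] /= [x Dx zx]; apply: nz; exists x => //.
    by rewrite (surjective_pairing z) -(join_snd cG cK hz Dx (esym zx)) zx.
Qed.
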